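(* Let $\{\epsilon_i\}_{i\in\mathbb{Z}}$ be i.i.d. random variables with mean zero and finite variance $\sigma^2$, such that $\epsilon_1$ has zero median and a differentiable density $f$ on $\mathbb{R}$ with $f(0)>0$ and $\sup_{x\in\mathbb{R}}|f'(x)|<\infty$. Let $(\rho_n)$ be a deterministic sequence with $\rho_n>1$ and $n(\rho_n-1)\to 0$ as $n\to\infty$, and let $(\kappa_n)$ be a sequence of positive integers with $\kappa_n/n\to\infty$ and $\kappa_n(\rho_n-1)\to0$ as $n\to\infty$. For each $n$, let $y_0=\sum_{j=0}^{\kappa_n}\rho_n^j\epsilon_{-j}$ and $y_i=\rho_n y_{i-1}+\epsilon_i$ for $1\le i\le n$, and let $\hat\rho_{\rm LAD}$ be the least absolute deviation estimator of $\rho_n$ based on $y_0,\dots,y_n$. Then, as $n\to\infty$, $$\sqrt{n\kappa_n}\,(\hat{\rho}_{\rm LAD}-\rho_n)\rightarrow_d\frac{\mathcal{C}}{2\sigma f(0)}$$ and $$\sqrt{\sum_{i=1}^ny_{i-1}^2}\,(\hat{\rho}_{\rm LAD}-\rho_n)\rightarrow_d\mathscr{N}\left(0,\frac{1}{4f^2(0)}\right).$$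
   Context: The variables $y_i=y_{n,i}$ form a triangular array; the index $n$ is omitted. The least absolute deviation (LAD) estimator $\hat\rho_{\rm LAD}$ (depending on $n$) is a random variable that is a solution of $\hat{\rho}_{\rm LAD}=\arg\min_{\rho\in\mathbb{R}}\left\{\frac{1}{n}\sum_{i=1}^n|y_i-\rho y_{i-1}|\right\}$ (the minimizer need not be unique; any solution is taken). $\rightarrow_d$ denotes weak convergence (convergence in distribution), $\mathcal{C}$ is a standard Cauchy random variable, and $\mathscr{N}(\mu,s^2)$ is a normal random variable with mean $\mu$ and variance $s^2$. *)

(* Defs.v *)
From HB Require Import structures.
From mathcomp Require Import all_boot all_order all_algebra finmap.
From mathcomp Require Import all_classical all_reals all_analysis.
From mathcomp Require Import measurable_realfun.

Set Implicit Arguments.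
Unset Strict Implicit.
Unset Printing Implicit Defensive.

Import Order.TTheory GRing.Theory Num.Theory.
Import numFieldNormedType.Exports.

Local Open Scope classical_set_scope.
Local Open Scope ring_scope.

Section random_variables.
Context d (T : measurableType d) (R : realType) (P : probability T R).

Definition has_law (X : {RV P >-> R}) (mu : set R -> \bar R) : Prop :=
  forall A : set R, measurable A -> distribution P X A = mu A.

Definition has_density (X : {RV P >-> R}) (f : R -> R) : Prop :=
  [/\ measurable_fun [set: R] f, forall x, 0 <= f x &
    has_law X (fun A => \int[lebesgue_measure]_(x in A) (f x)%:E)%E].

Definition is_median (X : {RV P >-> R}) (m : R) : Prop :=
  ((2^-1)%:E <= P [set w | (X w <= m)%R])%E /\
  ((2^-1)%:E <= P [set w | (m <= X w)%R])%E.

Definition mutually_independent (I : choiceType) (X : I -> {RV P >-> R}) :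
    Prop :=
  forall (J : {fset I}) (A : I -> set R), (forall i, measurable (A i)) ->
  P (\bigcap_(i in [set` J]) (X i @^-1` A i)) =
    (\prod_(i <- J) P (X i @^-1` A i))%E.

Definition identically_distributed (I : Type) (X : I -> {RV P >-> R}) : Prop :=
  forall i j, has_law (X i) (distribution P (X j)).

Definition iid (I : choiceType) (X : I -> {RV P >-> R}) : Prop :=
  mutually_independent X /\ identically_distributed X.

End random_variables.

(* The limit Z may live on another probability space.  Measurability is part
   of the definition because 'E_P[_] is total: without it, the expectations
   of non-measurable functions would be meaningless. *)
Definition cvg_in_distribution d (T : measurableType d) (R : realType)
    (P : probability T R) (X_ : nat -> T -> R)
    d' (T' : measurableType d') (P' : probability T' R) (Z : T' -> R) : Prop :=
  [/\ forall n, measurable_fun [set: T] (X_ n),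
      measurable_fun [set: T'] Z &
      forall g : R -> R, continuous g -> (exists M : R, forall x, `|g x| <= M) ->
        'E_P[g \o X_ n]%E @[n --> \oo] --> 'E_P'[g \o Z]%E].

Section lad.
Context (R : realType).

Definition lad_loss (n : nat) (y : nat -> R) (r : R) : R :=
  n%:R^-1 * \sum_(1 <= i < n.+1) `|y i - r * y i.-1|.

Definition is_lad (n : nat) (y : nat -> R) (r : R) : Prop :=
  forall r', lad_loss n y r <= lad_loss n y r'.

End lad.

Definition cauchy_pdf (R : realType) (x : R) : R := pi^-1 * (1 + x ^+ 2)^-1.

Definition cauchy_prob (R : realType) : set R -> \bar R :=
  fun A => (\int[lebesgue_measure]_(x in A) (cauchy_pdf x)%:E)%E.
Arguments cauchy_prob R : clear implicits.

Section cauchy_probability.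
Context (R : realType).
Notation mu := (@lebesgue_measure R).

Lemma cauchy_pdf_ge0 (x : R) : 0 <= cauchy_pdf x.
Proof.
by rewrite mulr_ge0// invr_ge0 ?pi_ge0// addr_ge0// sqr_ge0.
Qed.

Lemma measurable_cauchy_pdf : measurable_fun [set: R] (@cauchy_pdf R).
Proof.
apply: measurable_funM => //.
exact: (continuous_measurable_fun (@continuous_oneDsqrV R)).
Qed.

Lemma integral_cauchy_pdf : (\int[mu]_x (cauchy_pdf x)%:E = 1)%E.
Proof.
under eq_integral do rewrite EFinM.
have mV : measurable_fun [set: R] (fun x : R => (1 + x ^+ 2)^-1).
  exact: (continuous_measurable_fun (@continuous_oneDsqrV R)).
have V0 (x : R) : 0 <= (1 + x ^+ 2)^-1.
  by rewrite invr_ge0 addr_ge0// sqr_ge0.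
rewrite ge0_integralZl//=; last 3 first.
- exact/measurable_EFinP.
- by move=> x _; rewrite lee_fin.
- by rewrite lee_fin invr_ge0 pi_ge0.
rewrite ge0_symfun_integralT//=.
- rewrite (_ : [set x : R | 0 <= x] = `[0%R, +oo[%classic); last first.
    by apply/seteqP; split=> x /=; rewrite in_itv/= andbT.
  rewrite integral0y_oneDsqr -[2%E]/(2%:E) -!EFinM [2 * _]mulrC divfK//.
  by rewrite mulVf// gt_eqF// pi_gt0.
- exact: continuous_oneDsqrV.
- by move=> x /=; rewrite sqrrN.
Qed.

Lemma integrable_cauchy_pdf : mu.-integrable [set: R] (EFin \o @cauchy_pdf R).
Proof.
apply/integrableP; split.
  by apply/measurable_EFinP; exact: measurable_cauchy_pdf.
under eq_integral do rewrite /= ger0_norm ?cauchy_pdf_ge0//.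
by rewrite integral_cauchy_pdf ltry.
Qed.

Let cauchy0 : cauchy_prob R set0 = 0%E.
Proof. by rewrite /cauchy_prob integral_set0. Qed.

Let cauchy_ge0 A : (0 <= cauchy_prob R A)%E.
Proof.
by rewrite /cauchy_prob integral_ge0//= => x _; rewrite lee_fin cauchy_pdf_ge0.
Qed.

Let cauchy_sigma_additive : semi_sigma_additive (cauchy_prob R).
Proof.
move=> /= A mA tA mUA.
rewrite /cauchy_prob integral_bigcup//=; last first.
  by apply: (integrableS _ _ (subsetT _)) => //; exact: integrable_cauchy_pdf.
apply: is_cvg_ereal_nneg_natsum_cond => n _ _.
by apply: integral_ge0 => /= x ?; rewrite lee_fin cauchy_pdf_ge0.
Qed.

HB.instance Definition _ := isMeasure.Build _ _ _
  (cauchy_prob R) cauchy0 cauchy_ge0 cauchy_sigma_additive.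

Let cauchy_setT : cauchy_prob R [set: _] = 1%E.
Proof. exact: integral_cauchy_pdf. Qed.

HB.instance Definition _ :=
  @Measure_isProbability.Build _ _ R (cauchy_prob R) cauchy_setT.

End cauchy_probability.

(* Main.v *)
(* Write x_i = y_{i-1} / sqrt(n kappa_n), Y = y_0 / sqrt(kappa_n) and S = n^(-1/2) sum_i sg(eps_i), and put
   u^ = sqrt(n kappa_n) (rho^ - rho).  Since n / kappa_n -> 0, the initial value dominates: every
   sqrt(n) x_i is L2-close to Y.  The LAD loss is convex, and minus its subgradient
   M(u) = sum_i x_i sg(eps_i - u x_i) satisfies M(u) = Y S - 2 f(0) u Y^2 + o_P(1) for each fixed u:
   E sg(eps - a) is linear in a up to O(a^2), and the fluctuations are sums of martingale differences.
   As (u^ - u) M(u) >= 0 for all u, a finite grid of values of u traps u^ near the zero S / (2 f(0) Y) of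
   the linear approximation, and sqrt(sum y_{i-1}^2) (rho^ - rho) is then close to sg(Y) S / (2 f(0)).
   Y and S are independent, with limits N(0, sigma^2) and N(0, 1) by Lindeberg replacement; S / Y gives a
   ratio of independent normals, hence a Cauchy law, and sg(Y) S gives a normal law. *)

(* Only second moments of the innovations are available, and this shapes the estimates. The error
   [O(a^2)] in the mean sign, taken at [a = u x_i] and multiplied by [x_i], is cubic in [x_i] and
   may have no expectation. So each [x_i] is traded for [x_0], at a cost linear in [|x_i - x_0|],
   and [x_0] is then truncated at a multiple of [1 / sqrt n], which changes it only on an event of
   small probability. For the same reason the test functions have Taylor remainder [e^2 min(1, |e|)]
   rather than [|e|^3]; enough of them are built from logistic steps.

   The maps [1 / y] and [sg y] are discontinuous at 0, so weak convergence of [Y] does not pass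
   through them directly. The weight [c^2 / (c^2 + y^2)] is a continuous test function that measures
   how much of a law sits near 0; it gives both the lower bound on [|Y|] and the limits of [S / Y]
   and [sg(Y) S].

   Conditional expectations are avoided: what depends on the past is measurable for the
   sigma-algebra of a set of coordinates, hence independent of the next innovation, which is
   integrated out by Fubini. *)
Require Import Defs.
From HB Require Import structures.
From mathcomp Require Import all_boot all_order all_algebra finmap.
From mathcomp Require Import all_classical all_reals all_analysis.
From mathcomp Require Import measurable_realfun.
From mathcomp Require Import ring lra.

Import Order.TTheory GRing.Theory Num.Theory.
Import numFieldNormedType.Exports.

Local Open Scope classical_set_scope.
Local Open Scope ring_scope.

Set Implicit Arguments.
Unset Strict Implicit.
Unset Printing Implicit Defensive.

(** * Expectations of real random variables *)

Section real_expectation.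
Context d (T : measurableType d) (R : realType) (P : probability T R).
Implicit Types X Y : T -> R.

Definition integ X := P.-integrable [set: T] (EFin \o X).

(** Real-valued, so that [lra] and [nra] apply. Since [fine] sends infinite values to 0, a bound on
    [Ex] carries information only together with [integ]; this is why many lemmas below return
    both. *)
Definition Ex X : R := fine (\int[P]_w (X w)%:E)%E.

Lemma integ_meas X : integ X -> measurable_fun [set: T] X.
Proof. by move=> /measurable_int /measurable_EFinP. Qed.

Lemma integ_fin X : integ X -> (\int[P]_w (X w)%:E)%E = (Ex X)%:E.
Proof. by move=> iX; rewrite fineK//; exact: integrable_fin_num. Qed.

Lemma integ_ext X Y : X =1 Y -> integ X -> integ Y.
Proof. by move=> /funext ->. Qed.

Lemma Ex_ext X Y : X =1 Y -> Ex X = Ex Y.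
Proof. by move=> /funext ->. Qed.

Lemma integ_le X Y : measurable_fun [set: T] X ->
  (forall w, `|X w| <= Y w) -> integ Y -> integ X.
Proof.
move=> mX XY iY; apply: (le_integrable _ _ _ iY) => //.
  exact/measurable_EFinP.
by move=> w _ /=; rewrite lee_fin; apply: (le_trans (XY w)); exact: ler_norm.
Qed.

Lemma integ_cst (c : R) : integ (fun=> c).
Proof. exact: finite_measure_integrable_cst. Qed.

Lemma integ_bounded X (M : R) : measurable_fun [set: T] X ->
  (forall w, `|X w| <= M) -> integ X.
Proof. by move=> mX XM; exact: integ_le mX XM (integ_cst M). Qed.

Lemma integD X Y : integ X -> integ Y -> integ (fun w => X w + Y w).
Proof. by move=> iX iY; exact: (integrableD measurableT iX iY). Qed.

Lemma integZ (k : R) X : integ X -> integ (fun w => k * X w).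
Proof. by move=> iX; exact: (integrableZl measurableT k iX). Qed.

Lemma integN X : integ X -> integ (fun w => - X w).
Proof. by move=> iX; exact: (integrableN iX). Qed.

Lemma integB X Y : integ X -> integ Y -> integ (fun w => X w - Y w).
Proof. by move=> iX iY; apply: integD => //; exact: integN. Qed.

Lemma integ_norm X : integ X -> integ (fun w => `|X w|).
Proof. exact: integrable_norm. Qed.

Lemma integ_sum (I : Type) (s : seq I) (Q : pred I) (X : I -> T -> R) :
  (forall i, Q i -> integ (X i)) -> integ (fun w => \sum_(i <- s | Q i) X i w).
Proof.
move=> iX; apply: (eq_integrable measurableT) (integrable_sum measurableT s iX).
by move=> w _; rewrite sumEFin.
Qed.

(** The crude bound [|X Y| <= X^2 + Y^2] does the work of Cauchy-Schwarz, as only integrability is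
    at stake. *)
Lemma integM X Y : measurable_fun [set: T] X -> measurable_fun [set: T] Y ->
  integ (fun w => X w ^+ 2) -> integ (fun w => Y w ^+ 2) ->
  integ (fun w => X w * Y w).
Proof.
move=> mX mY iX iY; apply: (@integ_le _ (fun w => X w ^+ 2 + Y w ^+ 2)).
- exact: measurable_funM.
- move=> w; rewrite ler_norml; apply/andP.
  by split; have := sqr_ge0 (X w + Y w); have := sqr_ge0 (X w - Y w); nra.
- exact: integD.
Qed.

Lemma integ_sqr X : measurable_fun [set: T] X ->
  integ (fun w => X w ^+ 2) -> integ X.
Proof.
move=> mX iX; apply: (@integ_le _ (fun w => 1 + X w ^+ 2)) => //.
- by move=> w; rewrite ler_norml; apply/andP; split; nra.
- by apply: integD => //; exact: integ_cst.
Qed.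

Lemma integ_sqrD X Y : measurable_fun [set: T] X -> measurable_fun [set: T] Y ->
  integ (fun w => X w ^+ 2) -> integ (fun w => Y w ^+ 2) ->
  integ (fun w => (X w + Y w) ^+ 2).
Proof.
move=> mX mY iX iY.
apply: (@integ_ext (fun w => X w ^+ 2 + 2 * (X w * Y w) + Y w ^+ 2)).
  by move=> w; ring.
by apply: integD => //; apply: integD => //; apply: integZ; exact: integM.
Qed.

Lemma Ex_cst (c : R) : Ex (fun=> c) = c.
Proof.
rewrite /Ex integral_cst//=; set m := (X in (_ * X)%E).
have -> : m = 1%E by exact: probability_setT.
by rewrite mule1.
Qed.

Lemma ExD X Y : integ X -> integ Y -> Ex (fun w => X w + Y w) = Ex X + Ex Y.
Proof.
move=> iX iY; rewrite /Ex; under eq_integral do rewrite EFinD.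
by rewrite integralD// fineD//; exact: integrable_fin_num.
Qed.

Lemma ExZ (k : R) X : integ X -> Ex (fun w => k * X w) = k * Ex X.
Proof.
move=> iX; rewrite /Ex; under eq_integral do rewrite EFinM.
by rewrite integralZl// fineM//; exact: integrable_fin_num.
Qed.

Lemma ExN X : integ X -> Ex (fun w => - X w) = - Ex X.
Proof.
by move=> iX; rewrite -mulN1r -ExZ//; apply: Ex_ext => w; rewrite mulN1r.
Qed.

Lemma ExB X Y : integ X -> integ Y -> Ex (fun w => X w - Y w) = Ex X - Ex Y.
Proof. by move=> iX iY; rewrite ExD ?ExN//; exact: integN. Qed.

Lemma Ex_sum (I : Type) (s : seq I) (Q : pred I) (X : I -> T -> R) :
  (forall i, Q i -> integ (X i)) ->
  Ex (fun w => \sum_(i <- s | Q i) X i w) = \sum_(i <- s | Q i) Ex (X i).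
Proof.
move=> iX; elim: s => [|i s IH].
  rewrite big_nil (@Ex_ext _ (fun=> 0)) ?Ex_cst// => w.
  by rewrite big_nil.
rewrite big_cons; case: (boolP (Q i)) => Qi; last first.
  by rewrite -IH; apply: Ex_ext => w; rewrite big_cons (negbTE Qi).
rewrite -IH -ExD ?iX//; last exact: integ_sum.
by apply: Ex_ext => w; rewrite big_cons Qi.
Qed.

Lemma Ex_le X Y : integ X -> integ Y -> (forall w, X w <= Y w) -> Ex X <= Ex Y.
Proof.
move=> iX iY XY; rewrite -lee_fin -!integ_fin//.
by apply: le_integral => // w _; rewrite lee_fin.
Qed.

Lemma Ex_ge0 X : (forall w, 0 <= X w) -> 0 <= Ex X.
Proof.
by move=> X0; apply: fine_ge0; apply: integral_ge0 => w _; rewrite lee_fin.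
Qed.

Lemma Ex_norm X : integ X -> `|Ex X| <= Ex (fun w => `|X w|).
Proof.
move=> iX; rewrite ler_norml -ExN ?Ex_le//; try exact: integ_norm.
- by move=> w; exact: ler_norm.
- exact/integN/integ_norm.
- by move=> w; rewrite lerNl -normrN ler_norm.
Qed.

Lemma Ex_norm_le X Y : integ X -> integ Y -> (forall w, `|X w| <= Y w) ->
  `|Ex X| <= Ex Y.
Proof.
move=> iX iY XY; apply: (le_trans (Ex_norm iX)).
by apply: Ex_le => //; exact: integ_norm.
Qed.

Lemma Ex_bound X (M : R) : measurable_fun [set: T] X ->
  (forall w, `|X w| <= M) -> `|Ex X| <= M.
Proof.
move=> mX XM; rewrite -(Ex_cst M); apply: Ex_norm_le => //.
  exact: integ_bounded XM.
exact: integ_cst.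
Qed.

Lemma Ex_indic (A : set T) : measurable A -> Ex \1_A = fine (P A).
Proof. by move=> mA; rewrite /Ex integral_indic// setIT. Qed.

Lemma Ex_dct (X_ : nat -> T -> R) X Y :
  (forall n, measurable_fun [set: T] (X_ n)) -> measurable_fun [set: T] X ->
  (forall w, X_ n w @[n --> \oo] --> X w) -> integ Y ->
  (forall n w, `|X_ n w| <= Y w) ->
  integ X /\ Ex (X_ n) @[n --> \oo] --> Ex X.
Proof.
move=> mX_ mX XX iY XY.
have cvE w : setT w -> (fun n => (X_ n w)%:E) @ \oo --> (X w)%:E.
  by move=> _; apply: cvg_EFin; [exact: nearW | exact: XX].
have leE w n : setT w -> (`|(X_ n w)%:E| <= (Y w)%:E)%E.
  by move=> _; rewrite lee_fin.
have [iX _ cX] := @dominated_convergence _ _ _ P setT measurableT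
  (fun n => EFin \o X_ n) (EFin \o X) (EFin \o Y)
  (fun n => (measurable_EFinP setT _).2 (mX_ n)) ((measurable_EFinP setT _).2 mX)
  (aeW _ cvE) iY (aeW _ leE).
split => //.
apply: fine_cvg; rewrite -integ_fin//.
Qed.

(** Bridge from integrals of nonnegative functions, where Tonelli asks for no prior integrability,
    to the pair [integ] and [Ex]. *)
Lemma ge0_integ X (Y : R) : measurable_fun [set: T] X -> (forall w, 0 <= X w) ->
  (\int[P]_w (X w)%:E <= Y%:E)%E -> integ X /\ Ex X <= Y.
Proof.
move=> mX X0 XY; have iX : integ X.
  apply/integrableP; split; first exact/measurable_EFinP.
  under eq_integral do rewrite /= ger0_norm//.
  by rewrite (le_lt_trans XY)// ltry.
by split=> //; rewrite -lee_fin -integ_fin.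
Qed.

End real_expectation.

Section pushforward_expectation.
Context d (T : measurableType d) (R : realType) (P : probability T R).
Context d' (T' : measurableType d').

Lemma integ_distribution (X : {mfun T >-> T'}) (g : T' -> R) :
  measurable_fun [set: T'] g -> integ P (g \o X) -> integ (distribution P X) g.
Proof.
move=> mg ig; rewrite /integ; have mX : measurable_fun setT X by [].
have mg' : measurable_fun setT (EFin \o g) by apply/measurable_EFinP.
exact: (integrable_pushforward mX mg' ig measurableT).
Qed.

Lemma Ex_distribution (X : {mfun T >-> T'}) (g : T' -> R) :
  measurable_fun [set: T'] g -> integ P (g \o X) ->
  Ex (distribution P X) g = Ex P (g \o X).
Proof.
move=> mg ig; rewrite /Ex; congr fine.
by rewrite integral_distribution//; exact/measurable_EFinP.
Qed.

Lemma Ex_law (Q Q' : probability T' R) (g : T' -> R) :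
  (forall A, measurable A -> Q A = Q' A) -> Ex Q g = Ex Q' g.
Proof. 
move=> QQ; rewrite /Ex; congr fine; apply: eq_measure_integral => A mA _.
exact: QQ.
Qed.

End pushforward_expectation.

(** * Independence *)

Section block_independence.
Context d (T : measurableType d) (R : realType) (P : probability T R).
Variables (I : choiceType) (X : I -> {RV P >-> R}).
Hypothesis indX : mutually_independent X.

Definition cylinder (J : set I) : set (set T) :=
  [set U | exists (F : {fset I}) (A : I -> set R),
    [/\ (forall i, measurable (A i)), [set` F] `<=` J &
        U = \bigcap_(i in [set` F]) (X i @^-1` A i)]].

(** The carrier [T] with the sigma-algebra generated by the coordinates in [J]. As a measurable type
    of its own it lets the ordinary [measurable_fun] express measurability with respect to these
    coordinates. *)
Definition block (J : set I) := g_sigma_algebraType (cylinder J).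

Lemma cylinderT J : cylinder J setT.
Proof.
exists fset0, (fun=> setT); split => //.
by apply/seteqP; split => // w _ i.
Qed.

Lemma cylinder_measurable J : cylinder J `<=` @measurable _ T.
Proof.
move=> _ [F [A [mA _ ->]]]; apply: fin_bigcap_measurable => //.
by move=> i _; rewrite -[X in measurable X]setTI; exact: measurable_funPT.
Qed.

(** Both cylinders are written over the union of their index sets, with the constraint [setT] where
    an index is missing. This gives the pi-system property, and for disjoint [J] and [K] no index
    carries two constraints, so the product of probabilities splits. *)
Lemma cylinderI_prod J K U V : cylinder J U -> cylinder K V ->
  cylinder (J `|` K) (U `&` V) /\
  (J `&` K = set0 -> P (U `&` V) = (P U * P V)%E).
Proof.
move=> [F [A [mA FJ ->]]] [G [B [mB GK ->]]].
pose C i := (if i \in F then A i else setT) `&` (if i \in G then B i else setT).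
have mC i : measurable (C i) by apply: measurableI; case: ifP.
have E : \bigcap_(i in [set` F]) (X i @^-1` A i) `&`
    \bigcap_(i in [set` G]) (X i @^-1` B i) =
    \bigcap_(i in [set` (F `|` G)%fset]) (X i @^-1` C i).
  apply/seteqP; split=> [w [wA wB] i /=|w wC].
    move=> _; rewrite /C; split; case: ifP => // iF; [exact: wA|exact: wB].
  split=> i /= iF.
    have /= := wC i; rewrite inE iF => /(_ isT) [].
    by rewrite iF.
  have /= := wC i; rewrite inE iF orbT => /(_ isT) [_].
  by rewrite iF.
split; last first.
  move=> JK; have FGN i : i \in F -> i \in G -> False.
    move=> iF iG; suff : (J `&` K) i by rewrite JK.
    by split; [exact: FJ|exact: GK].
  rewrite E !indX// (big_fsetID _ (mem F))/=; congr (_ * _)%E.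
    rewrite (_ : [fset x | x in (F `|` G)%fset & x \in F]%fset = F); last first.
      by apply/fsetP => i; rewrite !inE; case: (i \in F); rewrite ?andbF.
    rewrite big_seq [RHS]big_seq; apply: eq_bigr => i iF.
    rewrite /C iF; case: ifPn => [iG|]; last by rewrite setIT.
    by have := FGN i iF iG.
  rewrite (_ : [fset x | x in (F `|` G)%fset & x \notin F]%fset = G); last first.
    apply/fsetP => i; rewrite !inE; case: (boolP (i \in F)) => //= iF.
      apply/esym/negbTE/negP => iG.
      by have := FGN i iF iG.
    by rewrite andbT.
  rewrite big_seq [RHS]big_seq; apply: eq_bigr => i iG.
  rewrite /C iG; case: ifPn => [iF|]; last by rewrite setTI.
  by have := FGN i iF iG.
exists (F `|` G)%fset, C; split => // i /=; rewrite inE => /orP[iF|iG].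
  by left; exact: FJ.
by right; exact: GK.
Qed.

Lemma cylinderI J : setI_closed (cylinder J).
Proof. by move=> U V cU cV; have [] := cylinderI_prod cU cV; rewrite setUid. Qed.

Lemma block_measurable J : <<s cylinder J >> `<=` @measurable _ T.
Proof.
by apply: smallest_sub; [exact: sigma_algebra_measurable|exact: cylinder_measurable].
Qed.

(** One half of the pi-lambda argument: with [H] fixed, the events that satisfy the product formula
    form a Dynkin class. [block_indep2] applies it once for each of the two blocks. *)
Lemma block_indep J (H : set T) : measurable H ->
  (forall U, cylinder J U -> P (U `&` H) = (P U * P H)%E) ->
  forall U, <<s cylinder J >> U -> P (U `&` H) = (P U * P H)%E.
Proof.
move=> mH UH.
have fP A : measurable A -> P A \is a fin_num by move=> mA; exact: fin_num_measure.
have indC (U : set T) : measurable U -> P (U `&` H) = (P U * P H)%E ->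
    P (~` U `&` H) = (P (~` U) * P H)%E.
  move=> mU PU; rewrite setIC -setDE.
  have -> : P (H `\` U) = (P H - P (U `&` H))%E.
    by rewrite [U `&` H]setIC; apply: measureD => //; rewrite ltey_eq fP.
  rewrite PU probability_setC// muleBl ?mul1e//; exact: fP.
have indU (F : (set T)^nat) : (forall n, measurable (F n)) ->
    trivIset [set: nat] F -> (forall n, P (F n `&` H) = (P (F n) * P H)%E) ->
    P (\bigcup_k F k `&` H) = (P (\bigcup_k F k) * P H)%E.
  move=> mF tF PF; rewrite setI_bigcupl measure_bigcup//=; last 2 first.
  + by move=> n _; exact: measurableI.
  + by apply: trivIset_setIr.
  rewrite (eq_eseriesr (fun n _ => PF n)) -(fineK (fP H mH)).
  rewrite measure_bigcup//; under eq_eseriesr do rewrite muleC.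
  by rewrite nneseriesZl// 1?muleC.
apply: (@dynkin_induction _ (block J) (cylinder J)) => //.
- exact: cylinderI.
- by apply: UH; exact: cylinderT.
- by move=> U /block_measurable mU; exact: indC.
- by move=> F mF; apply: indU => n; exact: (block_measurable (mF n)).
Qed.

Lemma block_indep2 J K U V : J `&` K = set0 ->
  <<s cylinder J >> U -> <<s cylinder K >> V -> P (U `&` V) = (P U * P V)%E.
Proof.
move=> JK sU sV; apply: (block_indep (block_measurable sV) _ sU) => U' cU'.
rewrite setIC muleC; apply: (block_indep (cylinder_measurable cU') _ sV).
by move=> V' cV'; rewrite setIC muleC; exact: (cylinderI_prod cU' cV').2 JK.
Qed.

(** This is how dependence on the coordinates in [J] alone is expressed; with [J] the indices up to
    a given time it is adaptedness. *)
Definition block_fun d' (U : measurableType d') (J : set I) (A : T -> U) :=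
  measurable_fun [set: block J] (A : block J -> U).

Lemma block_funS d' (U : measurableType d') (J K : set I) (A : T -> U) :
  J `<=` K -> block_fun J A -> block_fun K A.
Proof.
move=> JK mA _ B mB; have := mA measurableT B mB; rewrite !setTI.
have JKc : cylinder J `<=` cylinder K.
  move=> _ [F [C [mC FJ ->]]]; exists F, C; split => //.
  exact: subset_trans JK.
apply: (smallest_sub (smallest_sigma_algebra _ _)).
by move=> U' /JKc cU; exact: sub_sigma_algebra.
Qed.

Lemma block_fun_measurable d' (U : measurableType d') (J : set I) (A : T -> U) :
  block_fun J A -> measurable_fun [set: T] A.
Proof.
move=> mA _ B mB; have := mA measurableT B mB; rewrite !setTI.
exact: block_measurable.
Qed.

Lemma block_fun_coord J i : J i -> block_fun J (X i).
Proof.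
move=> Ji _ B mB; rewrite setTI; apply: sub_gen_smallest.
exists [fset i]%fset, (fun=> B); split => //.
  by move=> j /=; rewrite inE => /eqP ->.
apply/seteqP; split => [w wB j /=|w /(_ i) /=]; first by rewrite inE => /eqP ->.
by rewrite inE eqxx; apply.
Qed.

End block_independence.

(** * Fubini for independent pairs *)

Section independent_pair.
Context d (T : measurableType d) (R : realType) (P : probability T R).
Context dU dV (U : measurableType dU) (V : measurableType dV).
Variables (A : T -> U) (B : T -> V).

Definition independent_pair := forall S S', measurable S -> measurable S' ->
  P (A @^-1` S `&` B @^-1` S') = (P (A @^-1` S) * P (B @^-1` S'))%E.

Hypotheses (mA : measurable_fun [set: T] A) (mB : measurable_fun [set: T] B).
Hypothesis iAB : independent_pair.

Let mA_pack : {mfun T >-> U} :=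
  MeasurableFun.Pack (MeasurableFun.Class (isMeasurableFun.Build _ _ _ _ _ mA)).
Let mB_pack : {mfun T >-> V} :=
  MeasurableFun.Pack (MeasurableFun.Class (isMeasurableFun.Build _ _ _ _ _ mB)).
Let mAB : measurable_fun [set: T] (fun w => (A w, B w)).
Proof. exact: measurable_fun_pair. Qed.
Let mAB_pack : {mfun T >-> (U * V)%type} :=
  MeasurableFun.Pack (MeasurableFun.Class (isMeasurableFun.Build _ _ _ _ _ mAB)).

Let PA := distribution P mA_pack.
Let PB := distribution P mB_pack.

Lemma joint_lawE S : measurable S ->
  distribution P mAB_pack S = (PA \x PB)%E S.
Proof.
move=> mS; apply/esym; apply: product_measure_unique => //.

Qed.

Lemma ge0_indep_integral (psi : U * V -> R) :
  measurable_fun [set: U * V] psi -> (forall z, 0 <= psi z) ->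
  (\int[P]_w (psi (A w, B w))%:E =
   \int[P]_w \int[P]_w' (psi (A w, B w'))%:E)%E.
Proof.
move=> mpsi psi0.
have mpsiE : measurable_fun [set: U * V] (EFin \o psi) by exact/measurable_EFinP.
transitivity (\int[distribution P mAB_pack]_z (psi z)%:E)%E.
  by rewrite ge0_integral_distribution// => z; rewrite lee_fin.
transitivity (\int[PA \x PB]_z (psi z)%:E)%E.
  by apply: eq_measure_integral => S mS _; exact: joint_lawE.
rewrite (@fubini_tonelli1 _ _ _ _ _ PA PB (EFin \o psi))//.
rewrite /PA ge0_integral_distribution//; last 2 first.
- by apply: measurable_fun_fubini_tonelli_F => // z; rewrite lee_fin.
- by move=> y; apply: integral_ge0 => x _; rewrite lee_fin.
apply: eq_integral => w _ /=; rewrite /fubini_F /PB ge0_integral_distribution//.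
- by apply/measurable_EFinP; exact: measurableT_comp.
- by move=> y; rewrite lee_fin.
Qed.

(** Fubini for the joint law, pulled back to [T]. The inner expectation, with [A w] frozen, plays
    the part of the conditional expectation given [A]. *)
Lemma indep_Ex (psi : U * V -> R) : measurable_fun [set: U * V] psi ->
  integ P (fun w => psi (A w, B w)) -> (forall w, integ P (fun w' => psi (A w, B w'))) ->
  integ P (fun w => Ex P (fun w' => psi (A w, B w'))) /\
  Ex P (fun w => psi (A w, B w)) = Ex P (fun w => Ex P (fun w' => psi (A w, B w'))).
Proof.
move=> mpsi ipsi ipsi'.
have mpsiE : measurable_fun [set: U * V] (EFin \o psi) by exact/measurable_EFinP.
have ipair : (PA \x PB)%E.-integrable setT (EFin \o psi).
  have iJ : (distribution P mAB_pack).-integrable setT (EFin \o psi).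
    exact: integ_distribution.
  move/integrableP : iJ => [_ iJ]; apply/integrableP; split => //.
  rewrite (eq_measure_integral (distribution P mAB_pack))// => S mS _.
  by apply/esym; exact: joint_lawE.
have inner w : (\int[PB]_y (psi (A w, y))%:E = (Ex P (fun w' => psi (A w, B w')))%:E)%E.
  rewrite -integ_fin// /PB integral_distribution//.
    by apply/measurable_EFinP; exact: measurableT_comp.
  exact: ipsi'.
have iF := integrable_fubini_F ipair.
have mF := measurable_int _ iF.
have E : (fubini_F PB (EFin \o psi)) \o A =
    EFin \o (fun w => Ex P (fun w' => psi (A w, B w'))).
  by apply/funext => w /=; rewrite -inner.
have iFA : P.-integrable setT (fubini_F PB (EFin \o psi) \o A).
  apply/integrableP; split; first exact: measurableT_comp.
  move/integrableP : (iF) => [_]; rewrite /PA ge0_integral_distribution//.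
  exact: measurableT_comp.
split; first by rewrite /integ -E.
rewrite /Ex; congr fine.
transitivity (\int[distribution P mAB_pack]_z (psi z)%:E)%E.
  by rewrite integral_distribution.
transitivity (\int[PA \x PB]_z (psi z)%:E)%E.
  by apply: eq_measure_integral => S mS _; exact: joint_lawE.
rewrite -(integral12_prod_meas1 ipair) /PA integral_distribution//.
by apply: eq_integral => w _; have := congr1 (@^~ w) E.
Qed.

(** For nonnegative [psi], Tonelli turns bounds on the sections into integrability on the pair
    together with the bound. *)
Lemma indep_Ex_le (psi : U * V -> R) (m : U -> R) :
  measurable_fun [set: U * V] psi -> (forall z, 0 <= psi z) ->
  integ P (m \o A) ->
  (forall a, integ P (fun w => psi (a, B w)) /\ Ex P (fun w => psi (a, B w)) <= m a) ->
  integ P (fun w => psi (A w, B w)) /\ Ex P (fun w => psi (A w, B w)) <= Ex P (m \o A).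
Proof.
move=> mpsi psi0 im psim; apply: ge0_integ => //.
  by apply: measurableT_comp.
rewrite ge0_indep_integral// -integ_fin//; apply: ge0_le_integral => //.
- by move=> w _; apply: integral_ge0 => w' _; rewrite lee_fin.
- pose F := fubini_F PB (EFin \o psi).
  have mF : measurable_fun setT F.
    apply: measurable_fun_fubini_tonelli_F => //.
    exact/measurable_EFinP.
  apply: (eq_measurable_fun (F \o A)); last exact: measurableT_comp.
  move=> w _; rewrite /F /fubini_F /= /PB ge0_integral_distribution//.
    by apply/measurable_EFinP; exact: measurableT_comp.
  by move=> b; rewrite lee_fin.
- exact: measurable_int im.
- by move=> w _; have [i le] := psim (A w); rewrite integ_fin// lee_fin.
Qed.

End independent_pair.

Section independent_product.
Context d (T : measurableType d) (R : realType) (P : probability T R).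
Variables A B : T -> R.
Hypotheses (mA : measurable_fun [set: T] A) (mB : measurable_fun [set: T] B).
Hypothesis iAB : independent_pair P A B.

Lemma indep_integM : integ P A -> integ P B -> integ P (fun w => A w * B w).
Proof.
move=> iA iB; pose psi (z : R * R) := `|z.1| * `|z.2|.
have mpsi : measurable_fun setT psi.
  by apply: measurable_funM; apply: measurableT_comp.
have [|||i _] := @indep_Ex_le _ _ _ P _ _ _ _ A B mA mB iAB psi
  (fun a => `|a| * Ex P (fun w => `|B w|)) mpsi.
- by move=> z; rewrite mulr_ge0.
- apply: (@integ_ext _ _ _ P (fun w => Ex P (fun w => `|B w|) * `|A w|)).
    by move=> w; rewrite mulrC.
  exact/integZ/integ_norm.
- move=> a; rewrite /psi /=; split; first exact/integZ/integ_norm.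
  by rewrite ExZ//; exact: integ_norm.
apply: (integ_le _ _ i); first exact: measurable_funM.
by move=> w; rewrite normrM.
Qed.

Lemma indep_ExM : integ P A -> integ P B ->
  Ex P (fun w => A w * B w) = Ex P A * Ex P B.
Proof.
move=> iA iB; pose psi (z : R * R) := z.1 * z.2.
have mpsi : measurable_fun setT psi by apply: measurable_funM.
have [||_ ->] := @indep_Ex _ _ _ P _ _ _ _ A B mA mB iAB psi mpsi.
- exact: indep_integM.
- by move=> w; rewrite /psi /=; exact: integZ.
rewrite mulrC -ExZ//; apply: Ex_ext => w.
by rewrite /psi /= ExZ// mulrC.
Qed.

End independent_product.

(** * Densities and the standard normal law *)

Import HBNNSimple.
Section density_integral.
Context d (T : measurableType d) (R : realType).
Variables (mu Q : {measure set T -> \bar R}) (f : T -> R).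
Hypotheses (mf : measurable_fun [set: T] f) (f0 : forall x, 0 <= f x).
Hypothesis Qf : forall A, measurable A -> Q A = (\int[mu]_(x in A) (f x)%:E)%E.

(** The standard machine: [Qf] settles indicators, linearity settles simple functions, and monotone
    convergence along an increasing approximation settles the rest. *)
Lemma ge0_integral_density (phi : T -> R) :
  measurable_fun [set: T] phi -> (forall x, 0 <= phi x) ->
  (\int[Q]_x (phi x)%:E = \int[mu]_x (phi x * f x)%:E)%E.
Proof.
move=> mphi phi0.
have mphiE : measurable_fun setT (EFin \o phi) by exact/measurable_EFinP.
have phiE0 x : setT x -> (0 <= (EFin \o phi) x)%E by rewrite lee_fin.
pose g := nnsfun_approx measurableT mphiE.
have gphi (x : T) : (fun n => (g n x)%:E) @ \oo --> (phi x)%:E.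
  exact: cvg_nnsfun_approx.
have ndg (x : T) : {homo (fun n => (g n x)%:E) : n m / (n <= m)%N >-> (n <= m)%E}.
  by move=> n m nm; rewrite lee_fin; exact/lefP/nd_nnsfun_approx.
have mg n : measurable_fun setT (g n) by [].
have sf (h : {nnsfun T >-> R}) :
    (\int[Q]_x (h x)%:E = \int[mu]_x (h x * f x)%:E)%E.
  under eq_integral do rewrite fimfunE -fsumEFin//.
  rewrite ge0_integral_fsum//; last 2 first.
  - by move=> r; exact/measurable_EFinP/measurableT_comp.
  - by move=> r x _; rewrite nnfun_muleindic_ge0.
  under [RHS]eq_integral.
    move=> x _; rewrite fimfunE mulrC mulr_fsumr//=.
    rewrite -fsumEFin//; over.
  rewrite ge0_integral_fsum//; last 2 first.
  - move=> r; apply/measurable_EFinP; apply: measurable_funM => //.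
    exact/measurableT_comp.
  - move=> r x _; rewrite EFinM; apply: mule_ge0; first by rewrite lee_fin.
    rewrite EFinM; exact: nnfun_muleindic_ge0.
  apply: eq_fsbigr => r rh.
  have r0 : 0 <= r by move: rh; rewrite inE /= => -[x _ <-].
  rewrite integralZl_indic_nnsfun//.
  under [RHS]eq_integral.
    move=> x _; rewrite mulrCA EFinM; over.
  rewrite ge0_integralZl//.
  - rewrite integral_indic// setIT Qf//; congr (_ * _)%E.
    rewrite [LHS]integral_mkcond; apply: eq_integral => x _.
    rewrite patchE indicE; case: ifP => _; first by rewrite mulr1.
    by rewrite mulr0.
  - by apply/measurable_EFinP; apply: measurable_funM.
  - by move=> x _; rewrite lee_fin mulr_ge0.
transitivity (limn (fun n => \int[Q]_x (g n x)%:E)%E).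
  have -> : (\int[Q]_x (phi x)%:E = \int[Q]_x limn (fun n => (g n x)%:E))%E.
    by apply: eq_integral => x _; apply/esym/cvg_lim => //; exact: gphi.
  apply: monotone_convergence => //.
  - by move=> n; exact/measurable_EFinP.
  - by move=> n x _; rewrite lee_fin.
under eq_fun do rewrite sf.
have -> : (\int[mu]_x (phi x * f x)%:E = \int[mu]_x limn (fun n => (g n x * f x)%:E))%E.
  apply: eq_integral => x _; apply/esym/cvg_lim => //.
  rewrite [X in _ --> X]EFinM.
  under eq_fun do rewrite EFinM.
  by apply: cvgeZr => //; exact: gphi.
apply/esym/monotone_convergence => //.
- by move=> n; apply/measurable_EFinP; exact: measurable_funM.
- by move=> n x _; rewrite lee_fin mulr_ge0.
- by move=> x _ n m nm; rewrite lee_fin ler_wpM2r// -lee_fin; exact: ndg.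
Qed.

End density_integral.

Section density_law.
Context d (T : measurableType d) (R : realType) (P : probability T R).
Notation mu := (@lebesgue_measure R).

Lemma ge0_law_density (X : {RV P >-> R}) (f phi : R -> R) :
  measurable_fun [set: R] f -> (forall x, 0 <= f x) ->
  has_law X (fun A => \int[mu]_(x in A) (f x)%:E)%E ->
  measurable_fun [set: R] phi -> (forall x, 0 <= phi x) ->
  (\int[P]_w (phi (X w))%:E = \int[mu]_x (phi x * f x)%:E)%E.
Proof.
move=> mf f0 lX mphi phi0.
(* Lebesgue measure lives on an alias of R with another display. *)
have mX : measurable_fun [set: T] (X : T -> measurableTypeR R).
  move=> _ A mA; rewrite setTI -[X in measurable X]setTI.
  exact: (measurable_funPT X).
pose X' : {mfun T >-> measurableTypeR R} :=
  MeasurableFun.Pack (MeasurableFun.Class (isMeasurableFun.Build _ _ _ _ _ mX)).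
transitivity (\int[distribution P X']_x (phi x)%:E)%E.
  by rewrite ge0_integral_distribution//; exact/measurable_EFinP.
apply: ge0_integral_density => //.
Qed.

End density_law.

Section standard_normal.
Context (R : realType).
Notation mu := (@lebesgue_measure R).
Notation gamma := (normal_prob (0 : R) 1).
Notation p := (normal_pdf (0 : R) 1).
Implicit Types (phi : R -> R) (a b c x y z : R).

Lemma affine_substitution phi a b : 0 < a -> continuous phi -> (forall x, 0 <= phi x) ->
  (\int[mu]_x (phi x)%:E = \int[mu]_x (phi ((x + b) * a) * a)%:E)%E.
Proof.
move=> a0 cphi phi0; pose F (x : R^o) := (x + b) * a.
have F'E : F^`()%classic = cst a.
  apply/funext => x; rewrite /F derive1E deriveM// deriveD// derive_cst scaler0.
  by rewrite add0r derive_id derive_cst addr0 scaler1.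
rewrite (@increasing_ge0_integration_by_substitutionT _ F phi)//.
- by apply: eq_integral => x _; rewrite F'E /= fctE.
- by move=> x y xy; rewrite /F ltr_pM2r// ltrD2r.
- by rewrite F'E => x; exact: cvg_cst.
- by rewrite F'E; exact: is_cvg_cst.
- by rewrite F'E; exact: is_cvg_cst.
- by apply/gt0_cvgMlNy => //; exact: cvg_addrr_Ny.
- by apply/gt0_cvgMly => //; exact: cvg_addrr.
Qed.

Lemma reflection_substitution phi : continuous phi -> (forall x, 0 <= phi x) ->
  (\int[mu]_x (phi x)%:E = \int[mu]_x (phi (- x))%:E)%E.
Proof.
move=> cphi phi0.
have mphi : measurable_fun setT (EFin \o phi).
  by apply/measurable_EFinP; exact: continuous_measurable_fun.
have cphiN : continuous (phi \o -%R).
  by move=> x; apply: continuous_comp; [exact: opp_continuous|exact: cphi].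
have mphiN : measurable_fun setT (EFin \o (phi \o -%R)).
  by apply/measurable_EFinP; exact: continuous_measurable_fun.
have split_int (h : R -> R) : measurable_fun setT (EFin \o h) -> (forall x, 0 <= h x) ->
   (\int[mu]_x (h x)%:E = \int[mu]_(x in `]-oo, 0%R]) (h x)%:E +
     \int[mu]_(x in `[0%R, +oo[) (h x)%:E)%E.
  move=> mh h0; rewrite -(@integral_itv_obnd_cbnd _ 0); last exact: measurable_funTS.
  rewrite -ge0_integral_setU//=.
  - congr (integral _ _ _); apply/esym/seteqP; split => // x _ /=.
    by rewrite !in_itv/= andbT; apply/orP; case: leP.
  - exact: measurable_funTS.
  - by move=> x _; rewrite lee_fin.
  - apply/disj_setPS => x /= []; rewrite !in_itv/= andbT => x0 x1.
    by move: (le_lt_trans x0 x1); rewrite ltxx.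
rewrite (split_int phi)// (split_int (phi \o -%R))//; last first.
  by move=> x; exact: phi0.
rewrite [RHS]addeC; congr (_ + _)%E.
  have := @ge0_integration_by_substitutionNy R phi 0; rewrite oppr0; apply.
  - by apply: continuous_subspaceT.
  - by move=> x _.
have := @ge0_integration_by_substitutionNy R (phi \o -%R) 0; rewrite oppr0 => ->.
- by apply: eq_integral => x _; rewrite /= opprK.
- by apply: continuous_subspaceT.
- by move=> x _; exact: phi0.
Qed.

Local Notation c0 := (normal_peak (1 : R)).

Lemma std_pdfE x : p x = c0 * expR (- (x ^+ 2 / 2)).
Proof.
by rewrite normal_pdfE ?oner_neq0//= /normal_fun subr0 expr1n mulNr.
Qed.

Lemma std_peak_sqr : c0 ^+ 2 = (2 * pi)^-1.
Proof.
rewrite /normal_peak exprVn expr1n mul1r sqr_sqrtr ?mulr_natl//.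
by rewrite mulrn_wge0// pi_ge0.
Qed.

Lemma std_pdf_continuous : continuous p.
Proof. exact/continuous_normal_pdf/oner_neq0. Qed.

Lemma std_pdf_measurable : measurable_fun [set: R] p.
Proof. exact: measurable_normal_pdf. Qed.

Lemma std_pdf_ge0 x : 0 <= p x. Proof. exact: normal_pdf_ge0. Qed.

Lemma std_pdfN x : p (- x) = p x.
Proof. by rewrite !std_pdfE sqrrN. Qed.

Lemma ge0_gauss_integral phi : measurable_fun [set: R] phi -> (forall x, 0 <= phi x) ->
  (\int[gamma]_x (phi x)%:E = \int[mu]_x (phi x * p x)%:E)%E.
Proof.
move=> mphi phi0; apply: ge0_integral_density => //.
- exact: std_pdf_measurable.
- exact: std_pdf_ge0.
Qed.

Lemma is_derive_std_pdf x : is_derive x 1 p (- x * p x).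
Proof.
rewrite (_ : p = fun x => c0 * expR (- (x ^+ 2 / 2))); last first.
  by apply/funext => z; rewrite std_pdfE.
by apply: is_derive_eq; rewrite /GRing.scale /=; field.
Qed.

End standard_normal.

Section standard_normal_moments.
Context (R : realType).
Notation mu := (@lebesgue_measure R).
Notation gamma := (normal_prob (0 : R) 1).
Notation p := (normal_pdf (0 : R) 1).
Implicit Types (phi : R -> R) (a b c x y z : R).

Lemma continuous_FTC2_derive (f F : R -> R) a b : a < b -> continuous f ->
  (forall x, is_derive x 1 F (f x)) ->
  (\int[mu]_(x in `[a, b]) (f x)%:E = (F b - F a)%:E)%E.
Proof.
move=> ab cf dF; have cF x : {for x, continuous F}.
  apply: differentiable_continuous; apply/derivable1_diffP.
  by have [] := dF x.
rewrite EFinB; apply: (@continuous_FTC2 _ f F) => //.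
- exact: continuous_subspaceT.
- split.
  + by move=> x _; have [] := dF x.
  + by apply: cvg_at_right_filter; exact: cF.
  + by apply: cvg_at_left_filter; exact: cF.
- by move=> x _; rewrite derive1E; have [_ ->] := dF x.
Qed.

Lemma even_ge0_integral phi : continuous phi -> (forall x, 0 <= phi x) ->
  (forall x, phi (- x) = phi x) ->
  (\int[mu]_x (phi x)%:E = 2%:E * \int[mu]_(x in `[0%R, +oo[) (phi x)%:E)%E.
Proof.
move=> cphi phi0 phiN; rewrite ge0_symfun_integralT//; last first.
  by move=> x /=; rewrite phiN.
congr (_ * integral _ _ _)%E.
by apply/seteqP; split => x /=; rewrite in_itv /= andbT.
Qed.

Lemma std_pdf_tail : (n%:R * p n%:R) @[n --> \oo] --> (0 : R).
Proof.
apply: (@squeeze_cvgr _ _ _ _ (cst 0) (fun n => (4 * normal_peak 1) * n.+1%:R^-1)).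
- near=> n; rewrite mulr_ge0 ?std_pdf_ge0//=.
  have nE : 0 <= n%:R :> R by [].
  (* From [e^t >= 1 + t] at [t = n^2 / 2]; the constant 4 works because [n (n + 1) <= 4 + 2 n^2]. *)
  have key : n%:R * expR (- (n%:R ^+ 2 / 2)) <= 4 * n.+1%:R^-1 :> R.
    rewrite expRN ler_pdivrMr ?expR_gt0// mulrAC ler_pdivlMr//.
    have := expR_ge1Dx ((n%:R : R) ^+ 2 / 2).
    have := sqr_ge0 ((n%:R : R) - 1).
    by rewrite -[n.+1%:R]natr1; nra.
  rewrite std_pdfE mulrCA (_ : 4 * _ / _ = normal_peak 1 * (4 * n.+1%:R^-1)).
    by rewrite ler_wpM2l// normal_peak_ge0.
  by ring.
- exact: cvg_cst.
- rewrite -[X in _ --> X](mulr0 (4 * normal_peak 1)); apply: cvgMr.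
  exact: cvg_harmonic.
Unshelve. all: by end_near. Qed.

(** Integration by parts: [(x^2 - 1) p(x)] is the derivative of [- x p(x)], whose value at the right
    end of [[0, n + 1]] vanishes in the limit by [std_pdf_tail]. *)
Lemma half_second_moment :
  (\int[mu]_(x in `[0%R, +oo[) (x ^+ 2 * p x)%:E =
   \int[mu]_(x in `[0%R, +oo[) (p x)%:E)%E.
Proof.
have cp := @std_pdf_continuous R.
have cx2 : continuous (fun x => x ^+ 2 * p x).
  by move=> x; apply: cvgM; [exact: exprn_continuous|exact: cp].
have cq : continuous (fun x => (x ^+ 2 - 1) * p x).
  move=> x; apply: cvgM; last exact: cp.
  by apply: cvgB; [exact: exprn_continuous|exact: cvg_cst].
have step n : (\int[mu]_(x in `[0%R, n.+1%:R]) (x ^+ 2 * p x)%:E =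
    (- (n.+1%:R * p n.+1%:R))%:E + \int[mu]_(x in `[0%R, n.+1%:R]) (p x)%:E)%E.
  have ab : 0 < n.+1%:R :> R by [].
  have dF x : is_derive x 1 (fun x => - (x * p x)) ((x ^+ 2 - 1) * p x).
    have := is_derive_std_pdf x => dp.
    by apply: is_derive_eq; rewrite /GRing.scale /=; ring.
  have := continuous_FTC2_derive ab cq dF; rewrite mul0r oppr0 subr0 => <-.
  have ip (f : R -> R) : continuous f -> mu.-integrable `[0, n.+1%:R] (EFin \o f).
    move=> cf; apply: continuous_compact_integrable; first exact: segment_compact.
    exact: continuous_subspaceT.
  rewrite -(integralD_EFin _ (ip _ cq) (ip _ cp))//.
  by apply: eq_integral => x _ /=; rewrite -EFinD; congr EFin; ring.
have x2p0 x : 0 <= x ^+ 2 * p x by rewrite mulr_ge0 ?sqr_ge0 ?std_pdf_ge0.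
have := @ge0_cvgn_integral R mu _ x2p0 (continuous_measurable_fun cx2).
rewrite -cvg_shiftS => c1.
have := @ge0_cvgn_integral R mu _ (@std_pdf_ge0 R) (continuous_measurable_fun cp).
rewrite -cvg_shiftS => c2.
apply: (cvg_unique _ c1); first exact: ereal_hausdorff.
pose r n := ((- (n.+1%:R * p n.+1%:R))%:E +
  \int[mu]_(x in `[0%R, n.+1%:R]) (p x)%:E)%E.
suff : r @ \oo --> (\int[mu]_(x in `[0%R, +oo[) (p x)%:E)%E.
  by apply: cvg_trans; apply: near_eq_cvg; apply: nearW => n; exact/esym/step.
rewrite -[X in _ --> X]add0e; apply: cvgeD => //.
apply: cvg_EFin; first exact: nearW.
rewrite -[X in _ --> X]oppr0; apply: cvgN.
by have := std_pdf_tail; rewrite -cvg_shiftS.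
Qed.

Lemma gauss_sqr : integ gamma (fun x => x ^+ 2) /\ Ex gamma (fun x => x ^+ 2) = 1.
Proof.
have mx2 : measurable_fun setT (fun x : R => x ^+ 2) by exact: measurable_funX.
have E : (\int[gamma]_x (x ^+ 2)%:E = 1%:E)%E.
  rewrite ge0_gauss_integral//; last by move=> x; exact: sqr_ge0.
  rewrite even_ge0_integral; last 3 first.
  - by move=> x; apply: cvgM; [exact: exprn_continuous|exact: std_pdf_continuous].
  - by move=> x; rewrite mulr_ge0 ?sqr_ge0 ?std_pdf_ge0.
  - by move=> x; rewrite sqrrN std_pdfN.
  rewrite half_second_moment -even_ge0_integral.
  - exact: integral_normal_pdf.
  - exact: std_pdf_continuous.
  - exact: std_pdf_ge0.
  - exact: std_pdfN.
split; last by rewrite /Ex E.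
by have [] := @ge0_integ _ _ _ gamma (fun x => x ^+ 2) 1 mx2 (@sqr_ge0 _); rewrite ?E.
Qed.

Lemma gauss_id : integ gamma id.
Proof. by apply: integ_sqr => //; have [] := gauss_sqr. Qed.

Lemma gauss_reflect phi : continuous phi -> (forall x, 0 <= phi x) ->
  (\int[gamma]_x (phi x)%:E = \int[gamma]_x (phi (- x))%:E)%E.
Proof.
move=> cphi phi0.
have cphiN : continuous (phi \o -%R).
  by move=> x; apply: continuous_comp; [exact: opp_continuous|exact: cphi].
rewrite ge0_gauss_integral//; last exact: continuous_measurable_fun.
rewrite (@ge0_gauss_integral _ (phi \o -%R))//; last 2 first.
- exact: continuous_measurable_fun.
- by move=> x; exact: phi0.
rewrite reflection_substitution.
- by apply: eq_integral => x _; rewrite std_pdfN.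
- by move=> x; apply: cvgM; [exact: cphi|exact: std_pdf_continuous].
- by move=> x; rewrite mulr_ge0 ?std_pdf_ge0.
Qed.

(** Reflection exchanges the positive and the negative part of the identity; the split is needed
    because [gauss_reflect] concerns nonnegative functions. *)
Lemma gauss_mean : Ex gamma id = 0.
Proof.
have cmax : continuous (fun x : R => Num.max x 0).
  by move=> x; apply: continuous_max; [exact: cvg_id|exact: cvg_cst].
have i1 : integ gamma (fun x => Num.max x 0).
  apply: (@integ_le _ _ _ gamma _ (fun x : R => `|x|)).
  - exact: continuous_measurable_fun.
  - by move=> x; rewrite /Num.max; case: ltP => h; rewrite ?normr0.
  - exact/integ_norm/gauss_id.
have i2 : integ gamma (fun x => Num.max (- x) 0).
  apply: (@integ_le _ _ _ gamma _ (fun x : R => `|x|)).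
  - apply: continuous_measurable_fun => x.
    apply: (@continuous_comp _ _ _ -%R (fun x : R => Num.max x 0)).
      exact: opp_continuous.
    exact: cmax.
  - by move=> x; rewrite /Num.max; case: ltP => h; rewrite ?normr0 ?normrN.
  - exact/integ_norm/gauss_id.
have -> : Ex gamma id = Ex gamma (fun x => Num.max x 0 - Num.max (- x) 0).
  by apply: Ex_ext => x /=; rewrite /Num.max; case: (ltP x 0) => h1; case: (ltP (- x) 0) => h2; lra.
rewrite ExB//; apply/eqP; rewrite subr_eq0; apply/eqP.
rewrite /Ex; congr fine; apply: gauss_reflect => //.
by move=> x; rewrite le_max lexx orbT.
Qed.

End standard_normal_moments.

Section parametric_expectation.
Context d1 d2 (T1 : measurableType d1) (T2 : measurableType d2) (R : realType).
Variable Q : probability T2 R.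

Lemma measurable_Ex (psi : T1 * T2 -> R) (M : R) :
  measurable_fun [set: T1 * T2] psi -> (forall z, `|psi z| <= M) ->
  measurable_fun [set: T1] (fun a => Ex Q (fun b => psi (a, b))).
Proof.
move=> mpsi psiM.
have i a : integ Q (fun b => psi (a, b)).
  by apply: (@integ_bounded _ _ _ _ _ M) => //; exact: measurableT_comp.
(* Shifting by the bound makes the function nonnegative, so that measurability of its section
   integrals comes from Tonelli. *)
pose h z := psi z + M.
have h0 z : 0 <= h z by have := psiM z; rewrite ler_norml /h => /andP[]; lra.
have mh : measurable_fun setT h by apply: measurable_funD.
have mF : measurable_fun setT (fubini_F Q (EFin \o h)).
  by apply: measurable_fun_fubini_tonelli_F => //; exact/measurable_EFinP.
have E : (fun a => Ex Q (fun b => psi (a, b))) =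
    (fun a => fine (fubini_F Q (EFin \o h) a) - M).
  apply/funext => a; rewrite /fubini_F -[fine _]/(Ex Q (fun b => h (a, b))).
  by rewrite /h ExD ?Ex_cst ?addrK//; exact: integ_cst.
rewrite E; apply: measurable_funB => //.
exact: measurableT_comp.
Qed.

End parametric_expectation.

(** * Sums of independent normal variables *)

Section standard_normal_convolution.
Context (R : realType).
Notation mu := (@lebesgue_measure R).
Notation gamma := (normal_prob (0 : R) 1).
Notation p := (normal_pdf (0 : R) 1).
Implicit Types (phi : R -> R) (a b c x y z : R).

(* completing the square in the joint density of two independent normals *)
Lemma std_pdf_rotation a b c v z : b != 0 -> c ^+ 2 = a ^+ 2 + b ^+ 2 -> c != 0 ->
  p ((v - a / c * z) * (c / b)) * p z = p ((z - a / c * v) * (c / b)) * p v.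
Proof.
move=> b0 cE c0; rewrite !std_pdfE.
rewrite mulrACA -expRD [RHS]mulrACA -expRD; congr (_ * expR _).
apply/eqP; rewrite -subr_eq0; apply/eqP.
transitivity ((c ^+ 2 - a ^+ 2 - b ^+ 2) * (z ^+ 2 - v ^+ 2) / (2 * b ^+ 2)).
  by field; rewrite b0 c0.
by rewrite cE; ring.
Qed.

(** The inner variable is changed to [v] with [c v = a z + b w] and the integrals are exchanged. By
    [std_pdf_rotation] the density factors as [p v] times an affine image of [p] in [z], which has
    total mass 1. *)
Lemma ge0_gauss_convolution phi M a b c : 0 < a -> 0 < b -> 0 < c ->
  c ^+ 2 = a ^+ 2 + b ^+ 2 -> continuous phi -> (forall x, 0 <= phi x <= M) ->
  Ex gamma (fun z => Ex gamma (fun w => phi (a * z + b * w))) =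
  Ex gamma (fun v => phi (c * v)).
Proof.
move=> a0 b0 c0 cE cphi phiM.
have phi0 x : 0 <= phi x by have /andP[] := phiM x.
have phiM' x : `|phi x| <= M by rewrite ger0_norm//; have /andP[] := phiM x.
have mphi : measurable_fun setT phi by exact: continuous_measurable_fun.
have mp : measurable_fun [set: R] p by exact: std_pdf_measurable.
have p0 := @std_pdf_ge0 R.
have mab : measurable_fun [set: R * R] (fun zw => phi (a * zw.1 + b * zw.2)).
  by apply: measurableT_comp => //; apply: measurable_funD; apply: measurable_funM.
have i z : integ gamma (fun w => phi (a * z + b * w)).
  apply: (@integ_bounded _ _ _ _ _ M) => //.
  exact: (measurableT_comp mab (measurable_pair1 z)).
have mEx : measurable_fun setT (fun z => Ex gamma (fun w => phi (a * z + b * w))).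
  by apply: (measurable_Ex (M := M) gamma mab) => zw; exact: phiM'.
have b0' : b != 0 by rewrite gt_eqF. have c0' : c != 0 by rewrite gt_eqF.
have cb0 : 0 < c / b by rewrite divr_gt0.
suff E : (\int[gamma]_z (Ex gamma (fun w => phi (a * z + b * w)))%:E =
    \int[gamma]_v (phi (c * v))%:E)%E by have := congr1 (@fine R) E.
rewrite ge0_gauss_integral//; last by move=> z; exact: Ex_ge0.
rewrite ge0_gauss_integral//; last first.
  by apply: measurableT_comp => //; exact: measurable_funM.
(* The integrand after the substitution [w = (v - a z / c) c / b]; the last factor [c / b] is its
   Jacobian. *)
pose psi (zv : R * R) := phi (c * zv.2) * (p ((zv.2 - a / c * zv.1) * (c / b)) * p zv.1 * (c / b)).
have mpsi : measurable_fun setT psi.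
  apply: measurable_funM.
    by apply: measurableT_comp => //; exact: measurable_funM.
  apply: measurable_funM => //; apply: measurable_funM; last exact: measurableT_comp.
  apply: measurableT_comp => //; apply: measurable_funM => //.
  by apply: measurable_funB => //; exact: measurable_funM.
have psi0 zv : 0 <= psi zv.
  by apply: mulr_ge0 => //; apply: mulr_ge0; [exact: mulr_ge0|exact: ltW].
transitivity (\int[mu]_z \int[mu]_v (psi (z, v))%:E)%E.
  apply: eq_integral => z _.
  rewrite EFinM -integ_fin// ge0_gauss_integral//; last first.
    by have := integ_meas (i z).
  rewrite (@affine_substitution _ _ (c / b) (- (a / c * z)))//; last 2 first.
  - move=> x; apply: cvgM; last exact: std_pdf_continuous.
    apply: continuous_comp; last exact: cphi.
    by apply: cvgD; [exact: cvg_cst|apply: cvgMr; exact: cvg_id].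
  - by move=> x; rewrite mulr_ge0.
  rewrite -ge0_integralZr//; last 3 first.
  - apply/measurable_EFinP; apply: measurable_funM => //; apply: measurable_funM.
      apply: measurableT_comp => //; apply: measurable_funD => //.
      by apply: measurable_funM => //; apply: measurable_funM => //; exact: measurable_funD.
    apply: measurableT_comp => //.
    by apply: measurable_funM => //; exact: measurable_funD.
  - by move=> x _; rewrite lee_fin; apply: mulr_ge0; [exact: mulr_ge0|exact: ltW].
  - by rewrite lee_fin.
  apply: eq_integral => v _; rewrite -EFinM /psi /=; congr EFin.
  rewrite (_ : a * z + _ = c * v); last by field; rewrite b0' c0'.
  by ring.
transitivity (\int[mu]_v \int[mu]_z (psi (z, v))%:E)%E.
  by apply: (@fubini_tonelli _ _ _ _ _ mu mu (EFin \o psi)) => //; exact/measurable_EFinP.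
apply: eq_integral => v _.
have mq : measurable_fun setT (fun z => p ((z - a / c * v) * (c / b)) * (c / b)).
  apply: measurable_funM => //; apply: measurableT_comp => //.
  by apply: measurable_funM => //; exact: measurable_funB.
transitivity (\int[mu]_z ((phi (c * v) * p v)%:E * (p ((z - a / c * v) * (c / b)) * (c / b))%:E))%E.
  apply: eq_integral => z _; rewrite /psi /= std_pdf_rotation// -EFinM.
  by congr EFin; ring.
rewrite ge0_integralZl//; last 3 first.
- exact/measurable_EFinP.
- by move=> x _; rewrite lee_fin; apply: mulr_ge0 => //; exact: ltW.
- by rewrite lee_fin; exact: mulr_ge0.
rewrite -(@affine_substitution _ p (c / b))//; last exact: std_pdf_continuous.
by rewrite integral_normal_pdf mule1.
Qed.

Lemma gauss_convolution phi M a b : 0 <= a -> 0 <= b ->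
  continuous phi -> (forall x, `|phi x| <= M) ->
  Ex gamma (fun z => Ex gamma (fun w => phi (a * z + b * w))) =
  Ex gamma (fun v => phi (Num.sqrt (a ^+ 2 + b ^+ 2) * v)).
Proof.
move=> a0 b0 cphi phiM.
have mphi : measurable_fun setT phi by exact: continuous_measurable_fun.
have i c z : integ gamma (fun w => phi (z + c * w)).
  apply: (@integ_bounded _ _ _ _ _ M) => //.
  by apply: measurableT_comp => //; apply: measurable_funD => //; apply: measurable_funM.
move: a0; rewrite le_eqVlt => /predU1P[<-|a0].
  rewrite expr0n/= add0r sqrtr_sqr ger0_norm// -[RHS](Ex_cst gamma).
  apply: Ex_ext => z; apply: Ex_ext => w; by rewrite mul0r add0r.
move: b0; rewrite le_eqVlt => /predU1P[<-|b0].
  rewrite expr0n/= addr0 sqrtr_sqr ger0_norm; last exact: ltW.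
  apply: Ex_ext => z; rewrite -[RHS](Ex_cst gamma).
  by apply: Ex_ext => w; rewrite mul0r addr0.
set c := Num.sqrt _.
have ab0 : 0 < a ^+ 2 + b ^+ 2 by rewrite addr_gt0// exprn_gt0.
have c0 : 0 < c by rewrite sqrtr_gt0.
have cE : c ^+ 2 = a ^+ 2 + b ^+ 2 by rewrite sqr_sqrtr// ltW.
have h x : 0 <= phi x + M <= M + M.
  by have := phiM x; rewrite ler_norml => /andP[]; lra.
have := @ge0_gauss_convolution (fun x => phi x + M) _ a b c a0 b0 c0 cE _ h.
have i2 : integ gamma (fun z => Ex gamma (fun w => phi (a * z + b * w))).
  apply: (@integ_bounded _ _ _ _ _ M).
    apply: (@measurable_Ex _ _ _ _ R gamma (fun zw => phi (a * zw.1 + b * zw.2)) M) => //.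
    by apply: measurableT_comp => //; apply: measurable_funD; apply: measurable_funM.
  by move=> z; apply: Ex_bound => //; exact: integ_meas (i _ _).
have i3 : integ gamma (fun v => phi (c * v)).
  by apply: (integ_ext _ (i c 0)) => v; rewrite add0r.
rewrite ExD//; last exact: integ_cst.
rewrite (@Ex_ext _ _ _ gamma _ (fun z => Ex gamma (fun w => phi (a * z + b * w)) + M)); last first.
  by move=> z; rewrite ExD ?Ex_cst//; exact: integ_cst.
rewrite ExD ?Ex_cst//; last exact: integ_cst.
move=> E; apply: (addIr M); apply: E => x.
by apply: cvgD; [exact: cphi|exact: cvg_cst].
Qed.

End standard_normal_convolution.

(** * Scaled normal laws, and the Cauchy law as a ratio of normals *)

Section normal_scale_and_ratio.
Context (R : realType).
Notation mu := (@lebesgue_measure R).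
Notation gamma := (normal_prob (0 : R) 1).
Notation p := (normal_pdf (0 : R) 1).
Implicit Types (g : R -> R) (a b c x y z k s M : R).

(* It suffices to treat nonnegative functions, since constants integrate to themselves. *)
Lemma ge0_bounded_ind (L1 L2 : (R -> R) -> R) :
  (forall g M, continuous g -> (forall x, `|g x| <= M) ->
     L1 (fun x => g x + M) = L1 g + M /\ L2 (fun x => g x + M) = L2 g + M) ->
  (forall g M, continuous g -> (forall x, 0 <= g x <= M) -> L1 g = L2 g) ->
  forall g M, continuous g -> (forall x, `|g x| <= M) -> L1 g = L2 g.
Proof.
move=> LD L0 g M cg gM; have [E1 E2] := LD g M cg gM.
apply: (addIr M); rewrite -E1 -E2; apply: (L0 _ (M + M)).
  by move=> x; apply: cvgD; [exact: cg|exact: cvg_cst].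
by move=> x; have := gM x; rewrite ler_norml => /andP[]; lra.
Qed.

(** The second argument of [normal_prob] is the standard deviation, so [N] has the law of [s z] with
    [z] standard; the substitution [x = s z] turns one density into the other. *)
Lemma normal_law_scale d (T : measurableType d) (P : probability T R)
    (N : {RV P >-> R}) g M s :
  0 < s -> has_law N (normal_prob 0 s) -> continuous g -> (forall x, `|g x| <= M) ->
  Ex P (fun w => g (N w)) = Ex gamma (fun z => g (s * z)).
Proof.
move=> s0 lawN; move: g M; apply: ge0_bounded_ind => [g M cg gM|g M cg gM].
  have mg : measurable_fun setT g by exact: continuous_measurable_fun.
  split; rewrite ExD ?Ex_cst//; try exact: integ_cst.
    by apply: (@integ_bounded _ _ _ P _ M) => //; exact: measurableT_comp.
  apply: (@integ_bounded _ _ _ _ _ M) => //.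
  by apply: measurableT_comp => //; exact: measurable_funM.
have mg : measurable_fun setT g by exact: continuous_measurable_fun.
have g0 x : 0 <= g x by have /andP[] := gM x.
have s0' : s != 0 by rewrite gt_eqF.
have E : (\int[P]_w (g (N w))%:E = \int[gamma]_x (g (s * x))%:E)%E.
  rewrite (ge0_law_density _ _ lawN)//; last 2 first.
  - exact: measurable_normal_pdf.
  - exact: normal_pdf_ge0.
  transitivity (\int[mu]_x (g (s * x) * p x)%:E)%E; last first.
    apply/esym/ge0_gauss_integral => //.
    by apply: measurableT_comp => //; exact: measurable_funM.
  rewrite (@affine_substitution _ _ s 0)//; last 2 first.
  - by move=> x; apply: cvgM; [exact: cg|exact: continuous_normal_pdf].
  - by move=> x; rewrite mulr_ge0// normal_pdf_ge0.
  apply: eq_integral => x _; rewrite addr0 [x * s]mulrC -mulrA; congr (_ * _)%:E.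
  rewrite std_pdfE normal_pdfE//= /normal_fun subr0 mulrAC; congr (_ * expR _).
    rewrite /normal_peak expr1n mul1r -mulrnAr sqrtrM ?sqr_ge0// sqrtr_sqr.
    by rewrite gtr0_norm// invfM mulrAC mulVf// mul1r.
  rewrite -mulr_natr exprMn; field; exact/s0'.
by have := congr1 (@fine R) E.
Qed.

(** The left side is the classical formula for the density at [c] of the ratio of two independent
    standard normals. With [k = 1 + c^2] the integrand is a multiple of [|y| exp(- k y^2 / 2)],
    which has an explicit antiderivative on the half-line. *)
Lemma abs_std_pdf_integral c :
  (\int[mu]_y (`|y| * (p (y * c) * p y))%:E = (cauchy_pdf c)%:E)%E.
Proof.
set k := 1 + c ^+ 2; have k0 : 0 < k by rewrite /k ltr_pwDl// sqr_ge0.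
have [q qE] : exists q : R, q = (2 * pi)^-1 by exists (2 * pi)^-1.
have q0 : 0 <= q by rewrite qE invr_ge0 mulr_ge0// pi_ge0.
have pp y : p (y * c) * p y = q * expR (- (k * y ^+ 2 / 2)).
  rewrite !std_pdfE mulrACA -expRD qE -std_peak_sqr expr2; congr (_ * expR _).
  by rewrite /k; field.
under eq_integral do rewrite pp.
have cE : continuous (fun y : R => expR (- (k * y ^+ 2 / 2))).
  move=> y; apply: continuous_comp; last exact: continuous_expR.
  apply: cvgN; apply: cvgMl; apply: cvgMr; exact: exprn_continuous.
rewrite even_ge0_integral; last 3 first.
- move=> y; apply: cvgM; first exact: norm_continuous.
  by apply: cvgMr; exact: cE.
- by move=> y; rewrite !mulr_ge0// ?expR_ge0.
- by move=> y; rewrite normrN sqrrN.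
pose F (y : R) := - (q * k^-1) * expR (- (k * y ^+ 2 / 2)).
have dF y : is_derive y 1 F (y * (q * expR (- (k * y ^+ 2 / 2)))).
  rewrite /F; apply: is_derive_eq; rewrite /GRing.scale /=.
  by field; rewrite gt_eqF.
have FE : (\int[mu]_(y in `[0%R, +oo[) (`|y| * (q * expR (- (k * y ^+ 2 / 2))))%:E
    = 0%:E - (F 0)%:E)%E.
  rewrite -(@ge0_continuous_FTC2y R (fun y => y * (q * expR (- (k * y ^+ 2 / 2)))) F).
  - apply: eq_integral => t; rewrite inE /= in_itv/= andbT => t0.
    by rewrite ger0_norm.
  - by move=> y y0; rewrite !mulr_ge0// ?expR_ge0.
  - apply: continuous_subspaceT => y; apply: cvgM; first exact: cvg_id.
    by apply: cvgMr; exact: cE.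
  - rewrite -(mulr0 (- (q * k^-1))); apply: cvgMr.
    apply: (@squeeze_cvgr _ _ _ _ (cst 0) (fun y : R => (2 / k) * y^-1)).
    + near=> y; have y0 : 0 < y by near: y; exact: nbhs_pinfty_gt.
      have y1 : 1 < y by near: y; exact: nbhs_pinfty_gt.
      rewrite expR_ge0/= expRN -[leRHS]invrK lef_pV2 ?posrE ?expR_gt0 ?invr_gt0//; last first.
        by rewrite mulr_gt0 ?invr_gt0 ?divr_gt0.
      have := expR_ge1Dx (k * y ^+ 2 / 2); apply: le_trans.
      rewrite invfM invrK invf_div.
      rewrite (_ : k / 2 * y = k * y / 2); last by field.
      have : k * y <= k * y ^+ 2 by rewrite ler_pM2l// expr2 ler_pMr// ltW.
      by lra.
    + exact: cvg_cst.
    + rewrite -[X in _ --> X](mulr0 (2 / k)); apply: cvgMr.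
      apply/gtr0_cvgV0; last exact: cvg_id.
      by near=> y; near: y; exact: nbhs_pinfty_gt.
  - by move=> y _; have [] := dF y.
  - apply: cvg_at_right_filter; apply: cvgMr; exact: cE.
  - by move=> y _; rewrite derive1E; have [_ ->] := dF y.
rewrite FE -EFinB -EFinM /cauchy_pdf -/k; congr EFin.
rewrite /F expr0n/= mulr0 mul0r oppr0 expR0 qE invfM.
move: (pi^-1) => P; by field; rewrite gt_eqF.
Unshelve. all: by end_near. Qed.

End normal_scale_and_ratio.

Section normal_ratio.
Context (R : realType).
Notation mu := (@lebesgue_measure R).
Notation gamma := (normal_prob (0 : R) 1).
Notation p := (normal_pdf (0 : R) 1).
Implicit Types (g : R -> R) (a b c x y z k s M : R).

(** Continuity gives measurability off 0; the point 0, where the inverse is 0 by convention, is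
    treated as a separate piece. *)
Lemma measurable_invr : measurable_fun [set: R] (@GRing.inv R).
Proof.
rewrite -(setvU [set (0 : R)]); apply/measurable_funU => //.
  exact: measurableC.
split; last exact: measurable_fun_set1.
apply: open_continuous_measurable_fun => [|x]; first exact/closed_openC/closed_eq.
by rewrite inE /= => /eqP x0; exact: inv_continuous.
Qed.

(** The substitution [z = y c]. For negative [y] a reflection comes first, because
    [affine_substitution] requires a positive slope. *)
Lemma std_pdf_ratio_substitution g k y : y != 0 -> continuous g -> (forall x, 0 <= g x) ->
  (\int[mu]_z (g (k * z / y) * p z)%:E =
   \int[mu]_c (g (k * c) * p (y * c) * `|y|)%:E)%E.
Proof.
move=> y0 cg g0.
have ch a : continuous (fun z => g (k * z / a) * p z).
  move=> z; apply: cvgM; last exact: std_pdf_continuous.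
  apply: continuous_comp; last exact: cg.
  by apply: cvgMl; apply: cvgMr; exact: cvg_id.
have h0 a z : 0 <= g (k * z / a) * p z by rewrite mulr_ge0 ?std_pdf_ge0.
move: y0; have [y1 y0|y1 y0|->] := ltrgt0P y; last by [].
  have := @affine_substitution R (fun z => g (k * z / y) * p z) y 0 y1 (ch y) (h0 y).
  move=> ->; apply: eq_integral => c _; rewrite addr0 [y * c]mulrC.
  by congr (g _ * _ * _)%:E; rewrite mulrA mulfK// gt_eqF.
have chN : continuous (fun z => g (k * - z / y) * p (- z)).
  move=> x; apply: (@continuous_comp _ _ _ -%R (fun z => g (k * z / y) * p z)).
    exact: opp_continuous.
  exact: ch.
have y2 : 0 < - y by rewrite oppr_gt0.
have := @reflection_substitution R (fun z => g (k * z / y) * p z) (ch y) (h0 y).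
have := @affine_substitution R (fun z => g (k * - z / y) * p (- z)) (- y) 0 y2 chN
  (fun z => h0 y (- z)).
move=> -> ->; apply: eq_integral => c _; rewrite addr0.
rewrite (_ : - (c * - y) = c * y); last by ring.
by rewrite [y * c]mulrC; congr (g _ * _ * _)%:E; rewrite mulrA mulfK// lt_eqF.
Qed.

Context d (T : measurableType d) (P : probability T R) (C : {RV P >-> R}).
Hypothesis lawC : has_law C (cauchy_prob R).

(** With [c = z / y] the joint density becomes [|y| p(y c) p(y)]; after the integrals are exchanged,
    [abs_std_pdf_integral] integrates out [y] and leaves the Cauchy density. *)
Lemma ge0_normal_ratio g M k : continuous g -> (forall x, 0 <= g x <= M) ->
  Ex gamma (fun y => Ex gamma (fun z => g (k * z / y))) =
  Ex P (fun w => g (k * C w)).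
Proof.
move=> cg gM.
have g0 x : 0 <= g x by have /andP[] := gM x.
have gM' x : `|g x| <= M by rewrite ger0_norm//; have /andP[] := gM x.
have mg : measurable_fun setT g by exact: continuous_measurable_fun.
have mp : measurable_fun [set: R] p by exact: std_pdf_measurable.
have p0 := @std_pdf_ge0 R.
have mV : measurable_fun [set: R] (@GRing.inv R) by exact: measurable_invr.
have mratio : measurable_fun [set: R * R] (fun yz => g (k * yz.2 / yz.1)).
  apply: measurableT_comp => //; apply: measurable_funM; last exact: measurableT_comp.
  exact: measurable_funM.
have i y : integ gamma (fun z => g (k * z / y)).
  apply: (@integ_bounded _ _ _ gamma (fun z => g (k * z / y)) M) => //.
  exact: (measurableT_comp mratio (measurable_pair1 y)).
have mEx : measurable_fun setT (fun y => Ex gamma (fun z => g (k * z / y))).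
  by apply: (measurable_Ex (M := M) gamma mratio) => zw; exact: gM'.
have mgk : measurable_fun setT (fun c : R => g (k * c)).
  by apply: measurableT_comp => //; exact: measurable_funM.
suff E : (\int[gamma]_y (Ex gamma (fun z => g (k * z / y)))%:E =
    \int[P]_w (g (k * C w))%:E)%E.
  by have := congr1 (@fine R) E.
transitivity (\int[mu]_y (Ex gamma (fun z => g (k * z / y)) * p y)%:E)%E.
  by apply: ge0_gauss_integral => // z; exact: Ex_ge0.
transitivity (\int[mu]_c (g (k * c) * cauchy_pdf c)%:E)%E; last first.
  apply/esym; apply: (ge0_law_density (phi := fun c => g (k * c)) _ _ lawC) => //.
  - exact: measurable_cauchy_pdf.
  - exact: cauchy_pdf_ge0.
pose psi (yc : R * R) := g (k * yc.2) * (`|yc.1| * (p (yc.1 * yc.2) * p yc.1)).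
have mpsi : measurable_fun setT psi.
  apply: measurable_funM; first exact: measurableT_comp mgk _.
  apply: measurable_funM; first exact: measurableT_comp.
  apply: measurable_funM; last exact: measurableT_comp.
  by apply: measurableT_comp => //; exact: measurable_funM.
have psi0 yc : 0 <= psi yc by rewrite /psi mulr_ge0// mulr_ge0// mulr_ge0.
have mpsiE : measurable_fun setT (EFin \o psi) by exact/measurable_EFinP.
transitivity (\int[mu]_y \int[mu]_c (psi (y, c))%:E)%E.
  apply: ae_eq_integral => //.
  - by apply/measurable_EFinP; exact: measurable_funM.
  - have : measurable_fun setT (fubini_F mu (EFin \o psi)); last by [].
    by apply: measurable_fun_fubini_tonelli_F => // z; rewrite lee_fin.
  (* At [y = 0] the quotient takes its default value 0 and the substitution breaks down; this single
     point is a null set. *)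
  exists [set 0]; split => //; first exact: lebesgue_measure_set1.
  move=> y /= H; apply: contrapT => /eqP y0; apply: H => _.
  rewrite EFinM -integ_fin//.
  rewrite ge0_gauss_integral//; last exact: integ_meas (i y).
  rewrite std_pdf_ratio_substitution//.
  rewrite -ge0_integralZr//.
  - by apply: eq_integral => c _; rewrite -EFinM /psi /=; congr EFin; ring.
  - apply/measurable_EFinP; apply: measurable_funM => //; apply: measurable_funM => //.
    by apply: measurableT_comp => //; exact: measurable_funM.
  - by move=> c _; rewrite lee_fin mulr_ge0// mulr_ge0.
  - by rewrite lee_fin.
transitivity (\int[mu]_c \int[mu]_y (psi (y, c))%:E)%E.
  by apply: (@fubini_tonelli _ _ _ _ _ mu mu (EFin \o psi)).
apply: eq_integral => c _.
rewrite [RHS]EFinM -abs_std_pdf_integral -ge0_integralZl//.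
- by apply/measurable_EFinP; apply: measurable_funM => //; apply: measurable_funM => //;
    apply: measurableT_comp => //; exact: measurable_funM.
- by move=> y _; rewrite lee_fin mulr_ge0// mulr_ge0.
- by rewrite lee_fin.
Qed.

Lemma normal_ratio_cauchy g M k : continuous g -> (forall x, `|g x| <= M) ->
  Ex gamma (fun y => Ex gamma (fun z => g (k * z / y))) =
  Ex P (fun w => g (k * C w)).
Proof.
move: g M; apply: ge0_bounded_ind => [g M cg gM|g M]; last exact: ge0_normal_ratio.
have mg : measurable_fun setT g by exact: continuous_measurable_fun.
have mV : measurable_fun [set: R] (@GRing.inv R) by exact: measurable_invr.
have mratio : measurable_fun [set: R * R] (fun yz => g (k * yz.2 / yz.1)).
  apply: measurableT_comp => //; apply: measurable_funM; last exact: measurableT_comp.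
  exact: measurable_funM.
have i y : integ gamma (fun z => g (k * z / y)).
  apply: (@integ_bounded _ _ _ gamma (fun z => g (k * z / y)) M) => //.
  exact: (measurableT_comp mratio (measurable_pair1 y)).
have iEx : integ gamma (fun y => Ex gamma (fun z => g (k * z / y))).
  apply: (@integ_bounded _ _ _ gamma _ M).
    by apply: (measurable_Ex (M := M) gamma mratio) => zw; exact: gM.
  by move=> y; apply: Ex_bound => //; exact: integ_meas (i y).
split; last first.
  rewrite ExD ?Ex_cst//; last exact: integ_cst.
  apply: (@integ_bounded _ _ _ P _ M) => //.
  by apply: measurableT_comp => //; exact: measurable_funM.
rewrite -[RHS](_ : Ex gamma (fun y => Ex gamma (fun z => g (k * z / y)) + M) = _).
  by apply: Ex_ext => y; rewrite ExD ?Ex_cst//; exact: integ_cst.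
by rewrite ExD ?Ex_cst//; exact: integ_cst.
Qed.

End normal_ratio.

(** * Smooth bounded test functions *)

Section taylor.
Context (R : realType).
Implicit Types (phi g F : R -> R) (a b c x y z e t L M : R).

(** The remainder is cubic for small [e] but only quadratic for large [e], so it is integrable under
    a finite second moment. The coefficients are arbitrary functions rather than derivatives, which
    makes closure under sums and affine changes of variable purely algebraic. *)
Definition taylor2_bound phi L := exists a b : R -> R, forall x e,
  `|phi (x + e) - phi x - a x * e - b x * e ^+ 2| <= L * (e ^+ 2 * Num.min 1 `|e|).

Definition smooth_bounded phi := [/\ continuous phi,
  exists M, forall x, `|phi x| <= M & exists L, taylor2_bound phi L].

Lemma is_derive_continuous F (f : R -> R) : (forall x, is_derive x 1 F (f x)) -> continuous F.
Proof.
move=> dF x; apply: differentiable_continuous; apply/derivable1_diffP.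
by have [] := dF x.
Qed.

(** By the mean value theorem one integration raises the exponent by one. Iterated, it yields Taylor
    bounds with a common constant; factorials are not tracked. *)
Lemma derive_bound_pow F (f : R -> R) C k : 0 <= C -> (forall x, is_derive x 1 F (f x)) ->
  F 0 = 0 -> (forall t, `|f t| <= C * `|t| ^+ k) ->
  forall t, `|F t| <= C * `|t| ^+ k.+1.
Proof.
move=> C0 dF F0 fC t.
have cF : continuous F := is_derive_continuous dF.
have key c : `|c| <= `|t| -> `|f c * t| <= C * `|t| ^+ k.+1.
  move=> ct; rewrite normrM exprSr mulrA ler_wpM2r//.
  by rewrite (le_trans (fC c))// ler_wpM2l// lerXn2r// nnegrE.
have [t0|t0|->] := ltrgt0P t; last by rewrite F0 normr0 mulr_ge0.
- have [|c /[!in_itv]/= /andP[c0 ct] E] := @MVT _ F f 0 t t0 (fun x _ => dF x).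
    exact: continuous_subspaceT.
  move: E; rewrite F0 !subr0 => ->; rewrite -[in leRHS](gtr0_norm t0).
  by apply: key; rewrite !gtr0_norm// ltW.
- have [|c /[!in_itv]/= /andP[c0 ct] E] := @MVT _ F f t 0 t0 (fun x _ => dF x).
    exact: continuous_subspaceT.
  move: E; rewrite F0 sub0r => /eqP; rewrite eqr_oppLR => /eqP ->.
  rewrite sub0r mulrN opprK -[in leRHS](ltr0_norm t0); apply: key.
  by rewrite !ltr0_norm// lerN2 ltW.
Qed.

Lemma derive3_taylor2_bound phi (p1 p2 p3 : R -> R) C : 0 <= C ->
  (forall x, is_derive x 1 phi (p1 x)) -> (forall x, is_derive x 1 p1 (p2 x)) ->
  (forall x, is_derive x 1 p2 (p3 x)) ->
  (forall x, `|p2 x| <= C) -> (forall x, `|p3 x| <= C) ->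
  taylor2_bound phi (2 * C).
Proof.
move=> C0 d1 d2 d3 p2C p3C.
have shift (F f : R -> R) x : (forall x, is_derive x 1 F (f x)) ->
    forall t, is_derive t 1 (fun t => F (x + t)) (f (x + t)).
  move=> dF t; have := dF (x + t) => dFx.
  have dxt : is_derive t 1 (fun t => x + t) 1.
    by apply: is_derive_eq; rewrite add0r mulr1.
  by have := @is_derive1_comp R F (fun t => x + t) t _ _ dFx dxt; rewrite mulr1.
have B2 x t : `|p2 (x + t) - p2 x| <= C * `|t|.
  rewrite -[X in _ <= _ * X]expr1.
  apply: (@derive_bound_pow (fun t => p2 (x + t) - p2 x) (fun t => p3 (x + t)) C 0%N) => //.
  - move=> u; have := shift _ _ x d3 u => H.
    by apply: is_derive_eq; rewrite subr0.
  - by rewrite addr0 subrr.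
  - by move=> u; rewrite expr0 mulr1.
have A1 x t : `|p1 (x + t) - p1 x| <= C * `|t|.
  rewrite -[X in _ <= _ * X]expr1.
  apply: (@derive_bound_pow (fun t => p1 (x + t) - p1 x) (fun t => p2 (x + t)) C 0%N) => //.
  - move=> u; have := shift _ _ x d2 u => H.
    by apply: is_derive_eq; rewrite subr0.
  - by rewrite addr0 subrr.
  - by move=> u; rewrite expr0 mulr1.
have A2 x t : `|p1 (x + t) - p1 x - p2 x * t| <= C * `|t| ^+ 2.
  apply: (@derive_bound_pow (fun t => p1 (x + t) - p1 x - p2 x * t)
    (fun t => p2 (x + t) - p2 x) C 1%N) => //.
  - move=> u; have := shift _ _ x d2 u => H.
    by apply: is_derive_eq; rewrite /GRing.scale /=; ring.
  - by rewrite addr0 mulr0 !subrr.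
have F1 x t : `|phi (x + t) - phi x - p1 x * t| <= C * `|t| ^+ 2.
  apply: (@derive_bound_pow (fun t => phi (x + t) - phi x - p1 x * t)
    (fun t => p1 (x + t) - p1 x) C 1%N) => //.
  - move=> u; have := shift _ _ x d1 u => H.
    by apply: is_derive_eq; rewrite /GRing.scale /=; ring.
  - by rewrite addr0 mulr0 !subrr.
have F2 x t : `|phi (x + t) - phi x - p1 x * t - 2^-1 * p2 x * t ^+ 2| <= C * `|t| ^+ 3.
  apply: (@derive_bound_pow (fun t => phi (x + t) - phi x - p1 x * t - 2^-1 * p2 x * t ^+ 2)
    (fun t => p1 (x + t) - p1 x - p2 x * t) C 2%N) => //.
  - move=> u; have := shift _ _ x d1 u => H.
    by apply: is_derive_eq; rewrite /GRing.scale /=; field.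
  - by rewrite addr0 expr0n/= !mulr0 !subrr.
exists p1, (fun x => 2^-1 * p2 x) => x e.
have e0 : 0 <= `|e| by [].
rewrite -[e ^+ 2]real_normK ?num_real//.
have := F2 x e; rewrite -[e ^+ 2]real_normK ?num_real// => H2.
(* For [|e| > 1] the first-order bound [F1] and the size of the quadratic term together give
   [3 C / 2]; for [|e| <= 1] the cubic bound [F2] applies. *)
have H1 := F1 x e; rewrite /Num.min; case: ltP => h.
  rewrite mulr1; apply: (le_trans (ler_normB _ _)).
  rewrite [X in _ + X]normrM [X in _ + _ * X]ger0_norm ?sqr_ge0//.
  rewrite normrM ger0_norm ?invr_ge0//.
  by have := p2C x; nra.
apply: (le_trans H2); rewrite exprSr.
have h2 : 0 <= `|e| ^+ 2 * `|e| by rewrite mulr_ge0// sqr_ge0.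

by nra.
Qed.

Lemma smooth_bounded_cst c : smooth_bounded (fun=> c).
Proof.
split; first by move=> x; exact: cvg_cst.
  by exists `|c|.
exists 0, (fun=> 0), (fun=> 0) => x e.
by rewrite subrr !mul0r !subr0 normr0.
Qed.

Lemma smooth_boundedD phi g : smooth_bounded phi -> smooth_bounded g ->
  smooth_bounded (fun x => phi x + g x).
Proof.
move=> [c1 [M1 b1] [L1 [a1 [b1' t1]]]] [c2 [M2 b2] [L2 [a2 [b2' t2]]]]; split.
- by move=> x; apply: cvgD; [exact: c1|exact: c2].
- by exists (M1 + M2) => x; rewrite (le_trans (ler_normD _ _))// lerD.
- exists (L1 + L2), (fun x => a1 x + a2 x), (fun x => b1' x + b2' x) => x e.
  rewrite [leRHS]mulrDl; apply: (le_trans _ (lerD (t1 x e) (t2 x e))).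
  apply: (le_trans _ (ler_normD _ _)); rewrite le_eqVlt; apply/orP; left.
  by apply/eqP; congr `|_|; ring.
Qed.

Lemma smooth_boundedZ k phi : smooth_bounded phi -> smooth_bounded (fun x => k * phi x).
Proof.
move=> [c1 [M1 b1] [L1 [a1 [b1' t1]]]]; split.
- by move=> x; apply: cvgMr; exact: c1.
- by exists (`|k| * M1) => x; rewrite normrM ler_wpM2l.
- exists (`|k| * L1), (fun x => k * a1 x), (fun x => k * b1' x) => x e.
  rewrite -[leRHS]mulrA; apply: (le_trans _ (ler_wpM2l (normr_ge0 k) (t1 x e))).
  rewrite -normrM le_eqVlt; apply/orP; left.
  by apply/eqP; congr `|_|; ring.
Qed.

Lemma smooth_bounded_affine l m phi : smooth_bounded phi ->
  smooth_bounded (fun x => phi (l * x + m)).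
Proof.
move=> [c1 [M1 b1] [L1 [a1 [b1' t1]]]]; split.
- move=> x; apply: (@continuous_comp _ _ _ (fun x => l * x + m) phi); last exact: c1.
  by apply: cvgD; [apply: cvgMr; exact: cvg_id|exact: cvg_cst].
- by exists M1.
- have L10 : 0 <= L1.
    by have := le_trans (normr_ge0 _) (t1 0 1); rewrite expr1n mul1r normr1 minxx mulr1.
  (* The constant comes from [min(1, |l e|) <= (1 + |l|) min(1, |e|)]. *)
  exists (L1 * (l ^+ 2 * (1 + `|l|))), (fun x => l * a1 (l * x + m)),
    (fun x => l ^+ 2 * b1' (l * x + m)) => x e.
  have := t1 (l * x + m) (l * e).
  rewrite (_ : l * x + m + l * e = l * (x + e) + m); last by ring.
  rewrite (_ : _ - _ - _ - _ = phi (l * (x + e) + m) - phi (l * x + m) -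
    l * a1 (l * x + m) * e - l ^+ 2 * b1' (l * x + m) * e ^+ 2); last by ring.
  move/le_trans; apply; rewrite -[leRHS]mulrA ler_wpM2l// exprMn.
  rewrite (_ : l ^+ 2 * (1 + `|l|) * _ = l ^+ 2 * e ^+ 2 * ((1 + `|l|) * Num.min 1 `|e|)); last by ring.
  have le0 : 0 <= l ^+ 2 * e ^+ 2 by apply: mulr_ge0; exact: sqr_ge0.
  rewrite ler_wpM2l// normrM; have e0 := normr_ge0 e; have l0 := normr_ge0 l.
  have le0' : 0 <= `|l| * `|e| by rewrite mulr_ge0.
  rewrite /Num.min; case: (ltP 1 (`|l| * `|e|)) => h1;
    by case: (ltP 1 `|e|) => h2; nra.
Qed.

End taylor.

Section uniform_continuity.
Context (R : realType).
Implicit Types (g phi : R -> R).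

(** Compactness of the segment makes [del] uniform in [x], while [y] may fall outside the
    segment. *)
Lemma continuous_uniform_segment g (K e : R) : continuous g -> 0 < e ->
  exists2 del, 0 < del & forall x y, `|x| <= K -> `|x - y| <= del -> `|g x - g y| <= e.
Proof.
move=> cg e0.
pose Q (del x : R) := forall y, `|x - y| <= del -> `|g x - g y| <= e.
have cK : compact `[- K, K] by exact: segment_compact.
have H : \forall del \near 0^'+, forall x, `[- K, K]%classic x -> Q del x.
  move/compact_near_coveringP : cK; apply => x _.
  have /cvgrPdist_le/(_ (e / 2)) : g z @[z --> x] --> g x by exact: cg.
  rewrite divr_gt0// => /(_ isT) /nbhs_ballP [r /= r0 Br].
  have r20 : 0 < r / 2 by rewrite divr_gt0.
  exists (ball x (r / 2), [set del | del < r / 2]).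
    split; first exact: nbhsx_ballx.
    exact: nbhs_right_lt.
  move=> [x' del] [/= xx' dr] y x'y.
  have hr : r / 2 <= r by lra.
  have b1 : ball x r x' by exact: (le_ball hr xx').
  have b2 : ball x r y.
    move: xx' x'y; rewrite /ball /= => xx' x'y.
    rewrite (_ : x - y = (x - x') + (x' - y)); last by ring.
    rewrite (le_lt_trans (ler_normD _ _))//; lra.
  have := Br _ b1; have := Br _ b2 => /= H1 H2.
  rewrite (_ : g x' - g y = (g x - g y) - (g x - g x')); last by ring.
  by rewrite (le_trans (ler_normB _ _))//; lra.
have [del [del0 Hd]] : exists del, 0 < del /\ forall x, `[- K, K]%classic x -> Q del x.
  near (0 : R)^'+ => del; exists del; split => //.
  by near: del.
by exists del => // x y xK xy; apply: Hd => //=; rewrite in_itv/= -ler_norml.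
Unshelve. all: by end_near. Qed.

End uniform_continuity.

Section logistic.
Context (R : realType).
Implicit Types (x y l e : R).

(** The smooth step from 0 to 1 out of which all test functions are assembled. *)
Definition logistic x : R := (1 + expR (- x))^-1.

Lemma logistic_gt0 x : 0 < logistic x.
Proof. by rewrite invr_gt0 addr_gt0// expR_gt0. Qed.

Lemma logisticN x : logistic (- x) = 1 - logistic x.
Proof.
rewrite /logistic opprK expRN.
have e0 := expR_gt0 x; field; rewrite !gt_eqF//= addr_gt0//.
Qed.

Lemma logistic_lt1 x : logistic x < 1.
Proof. by have := logistic_gt0 (- x); rewrite logisticN subr_gt0. Qed.

Lemma is_derive_logistic x : is_derive x 1 logistic (logistic x - logistic x ^+ 2).
Proof.
have e0 := expR_gt0 (- x); have h : 1 + expR (- x) != 0 by rewrite gt_eqF// addr_gt0.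
have H := @is_deriveV R (fun x => 1 + expR (- x)) x 1 _ h.
rewrite /logistic.
apply: is_derive_eq; rewrite /GRing.scale /=; field => //.
Qed.

(** Since [s' = s - s^2], every derivative is a polynomial in [s], and [s] takes values between 0
    and 1; the third derivative stays below 3 in absolute value. *)
Lemma logistic_smooth : smooth_bounded logistic.
Proof.
have d1 := is_derive_logistic.
have B x : 0 < logistic x < 1 by rewrite logistic_gt0 logistic_lt1.
split.
- exact: is_derive_continuous d1.
- by exists 1 => x; rewrite ger0_norm ?ltW// ?logistic_gt0 ?logistic_lt1.
pose s := logistic.
pose p2 x := (s x - s x ^+ 2) * (1 - 2 * s x).
pose p3 x := p2 x * (1 - 2 * s x) - 2 * (s x - s x ^+ 2) ^+ 2.
have d2 x : is_derive x 1 (fun x => s x - s x ^+ 2) (p2 x).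
  by have := d1 x => H; apply: is_derive_eq; rewrite /GRing.scale /= /p2 /s; ring.
have d3 x : is_derive x 1 p2 (p3 x).
  have := d1 x => H; have := d2 x => H2; rewrite /p2.
  by apply: is_derive_eq; rewrite /GRing.scale /= /p3 /p2 /s; ring.
exists (2 * 3); apply: (derive3_taylor2_bound _ d1 d2 d3) => //.
- move=> x; rewrite /p2 /s; have /andP[] := B x; set t := logistic x => t0 t1.
  by rewrite ler_norml; apply/andP; split; nra.
- move=> x; rewrite /p3 /p2 /s; have /andP[] := B x; set t := logistic x => t0 t1.
  have h0 : 0 <= t - t ^+ 2 <= 1 by apply/andP; split; nra.
  move: h0; set q := t - t ^+ 2 => /andP[q0 q1].
  have h1 : 0 <= (1 - 2 * t) ^+ 2 <= 1.
    rewrite sqr_ge0 (_ : (1 - 2 * t) ^+ 2 = 1 - 4 * (t * (1 - t))); last by ring.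
    by rewrite gerBl mulr_ge0// mulr_ge0// ?subr_ge0 ltW.
  rewrite -mulrA -expr2; move: h1; set r := _ ^+ 2 => /andP[r0 r1].
  by rewrite ler_norml; apply/andP; split; nra.
Qed.

Lemma logistic_tail l e : 0 < l -> 0 < e -> exists2 k, 0 < k &
  forall x, (l <= x -> `|1 - logistic (k * x)| <= e) /\ (x <= - l -> `|logistic (k * x)| <= e).
Proof.
move=> l0 e0; exists ((l * e)^-1); first by rewrite invr_gt0 mulr_gt0.
have key x : l <= x -> `|logistic (- ((l * e)^-1 * x))| <= e.
  move=> lx; rewrite ger0_norm; last exact/ltW/logistic_gt0.
  rewrite /logistic opprK.
  have u0 : 0 < 1 + expR ((l * e)^-1 * x) by rewrite addr_gt0// expR_gt0.
  rewrite invf_ple ?posrE//.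
  have := expR_ge1Dx ((l * e)^-1 * x).
  have : e^-1 <= (l * e)^-1 * x.
    rewrite invfM -mulrA mulrCA ler_peMr ?invr_ge0 ?(ltW e0)//.
    by rewrite mulrC ler_pdivlMr// mul1r.
  by lra.
move=> x; split => h; first by rewrite -logisticN; exact: key.
by rewrite -[x]opprK mulrN; apply: key; rewrite lerNr.
Qed.

End logistic.

Section smooth_approximation.
Context (R : realType).
Implicit Types (g phi : R -> R) (x y z : R).

Definition clamp a b x := Num.max a (Num.min x b).

(* [t] controls the error to the right of the last step, [2 * e + t] the error on the steps already built. *)
Lemma smooth_staircase g (a del e : R) (N : nat) : 0 < del -> 0 < e ->
  (forall k y, (k < N)%N -> a + k%:R * del <= y <= a + k.+1%:R * del ->
     `|g y - g (a + k%:R * del)| <= e) ->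
  forall k t, (k <= N)%N -> 0 < t -> exists phi, [/\ smooth_bounded phi,
    forall y, `|phi y - g (clamp a (a + k%:R * del) y)| <= 2 * e + t &
    forall y, a + k%:R * del <= y -> `|phi y - g (a + k%:R * del)| <= t].
Proof.
move=> del0 e0 osc; elim=> [|k IH] t kN t0.
  exists (fun=> g a); split; first exact: smooth_bounded_cst.
    move=> y; rewrite mul0r addr0 /clamp (_ : Num.max _ _ = a).
      by rewrite subrr normr0; lra.
    by rewrite /Num.max /Num.min; case: (ltP y a) => h1; case: ltP => h2; lra.
  by move=> y; rewrite mul0r addr0 subrr normr0 => _; exact: ltW.
have t20 : 0 < t / 2 by rewrite divr_gt0.
have [phi [sphi phi1 phi2]] := IH (t / 2) (ltnW kN) t20.
set xk := a + k%:R * del in phi1 phi2; set xk1 := a + k.+1%:R * del.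
have xk1E : xk1 = xk + del by rewrite /xk1 /xk -natr1; ring.
have axk : a <= xk by rewrite lerDl mulr_ge0// ltW.
have Dle : `|g xk1 - g xk| <= e.
  by apply: osc => //; rewrite -/xk -/xk1 xk1E lexx lerDl ltW.
have del20 : 0 < del / 2 by rewrite divr_gt0.
have te : 0 < t / (2 * e) by rewrite divr_gt0// mulr_gt0.
(* The new step is centred in the middle of its cell and so steep that outside the cell it is within
   [t / (2 e)] of 0 or 1. As the jump of [g] is at most [e], the disturbance there is at most
   [t / 2]. *)
have [l l0 Hl] := logistic_tail del20 te.
pose psi y := logistic (l * y + - (l * (xk + del / 2))).
have psiE y : psi y = logistic (l * (y - (xk + del / 2))).
  by rewrite /psi mulrBr.
have small u : `|u| <= t / (2 * e) -> `|(g xk1 - g xk) * u| <= t / 2.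
  move=> ut; rewrite normrM (_ : t / 2 = e * (t / (2 * e))); last first.
    by field; rewrite gt_eqF.
  by rewrite ler_pM.
exists (fun y => phi y + (g xk1 - g xk) * psi y); split.
- apply: smooth_boundedD => //; apply: smooth_boundedZ.
  exact: (smooth_bounded_affine _ _ (logistic_smooth R)).
- move=> y; have [yk|yk] := leP y xk.
    rewrite (_ : clamp a xk1 y = clamp a xk y); last first.
      by rewrite /clamp !min_l//; lra.
    rewrite (_ : _ - _ = (phi y - g (clamp a xk y)) + (g xk1 - g xk) * psi y); last by ring.
    rewrite (le_trans (ler_normD _ _))// (_ : 2 * e + t = (2 * e + t / 2) + t / 2); last by field.
    apply: lerD => //; apply: small; rewrite psiE.
    by apply: (Hl _).2; lra.
  have [yk1|yk1] := leP y xk1.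
    rewrite (_ : clamp a xk1 y = y); last first.
      by rewrite /clamp min_l// max_r//; lra.
    have := phi2 y (ltW yk) => H1.
    have : `|g y - g xk| <= e by apply: osc => //; rewrite -/xk -/xk1 yk1 ltW.
    move=> H2.
    have H3 : `|(g xk1 - g xk) * psi y| <= e.
      rewrite normrM -[leRHS]mulr1 ler_pM// ger0_norm; first exact/ltW/logistic_lt1.
      exact/ltW/logistic_gt0.
    rewrite (_ : _ - _ = (phi y - g xk) - (g y - g xk) + (g xk1 - g xk) * psi y); last by ring.
    rewrite (le_trans (ler_normD _ _))//.
    have := ler_normB (phi y - g xk) (g y - g xk).
    by move: H1 H2 H3; lra.
  rewrite (_ : clamp a xk1 y = xk1); last first.
    by rewrite /clamp min_r ?max_r//; lra.
  have : `|phi y + (g xk1 - g xk) * psi y - g xk1| <= t; last by lra.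
  rewrite (_ : _ - _ = (phi y - g xk) - (g xk1 - g xk) * (1 - psi y)); last by ring.
  rewrite (le_trans (ler_normB _ _))// (_ : t = t / 2 + t / 2); last by field.
  apply: lerD; first by apply: phi2; exact: ltW.
  by apply: small; rewrite psiE; apply: (Hl _).1; lra.
- move=> y yk1.
  rewrite (_ : _ - _ = (phi y - g xk) - (g xk1 - g xk) * (1 - psi y)); last by ring.
  rewrite (le_trans (ler_normB _ _))// (_ : t = t / 2 + t / 2); last by field.
  apply: lerD; first by apply: phi2; lra.
  by apply: small; rewrite psiE; apply: (Hl _).1; lra.
Qed.

Lemma smooth_approx g (K e : R) : continuous g -> 0 < K -> 0 < e ->
  exists2 phi, smooth_bounded phi & forall y, `|phi y - g (clamp (- K) K y)| <= e.
Proof.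
move=> cg K0 e0; have e30 : 0 < e / 3 by rewrite divr_gt0.
have [del del0 Hd] := continuous_uniform_segment K cg e30.
pose N := (Num.truncn (2 * K / del)).+1.
have N0 : 0 < N%:R :> R by rewrite ltr0n.
have NE : 2 * K / del < N%:R by exact: truncnS_gt.
pose del' := 2 * K / N%:R.
have del'0 : 0 < del' by rewrite divr_gt0// mulr_gt0.
have del'E : del' <= del.
  by rewrite ler_pdivrMr// [del * _]mulrC -ler_pdivrMr//; exact: ltW.
(* Thirds, because the staircase built with oscillation [e / 3] and slack [e / 3] has total error
   [2 (e / 3) + e / 3]. *)
have [|phi [sphi phi1 _]] := @smooth_staircase g (- K) del' (e / 3) N del'0 e30 _ N (e / 3) (leqnn N) e30.
  move=> k y kN /andP[y1 y2]; rewrite distrC; apply: Hd; last first.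
    move: y2; rewrite -natr1 mulrDl mul1r => y2.
    by rewrite ler_norml; apply/andP; split; lra.
  have kN' : k%:R <= N%:R :> R by rewrite ler_nat ltnW.
  have : k%:R * del' <= 2 * K.
    by rewrite /del' mulrCA -[leRHS]mulr1 ler_wpM2l ?mulr_ge0 ?(ltW K0)// ler_pdivrMr// mul1r.
  have : 0 <= k%:R * del' by rewrite mulr_ge0// ltW.
  by move=> h1 h2; rewrite ler_norml; apply/andP; split; lra.
exists phi => // y; have := phi1 y.
rewrite (_ : - K + N%:R * del' = K).
  by move=> h; apply: (le_trans h); lra.
by rewrite /del'; field; rewrite gt_eqF.
Qed.

End smooth_approximation.

Section smooth_bounded_lipschitz.
Context (R : realType).

Lemma smooth_bounded_measurable (phi : R -> R) :
  smooth_bounded phi -> measurable_fun [set: R] phi.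
Proof. by move=> [c _ _]; exact: continuous_measurable_fun. Qed.

(** Comparing the Taylor bound at [e = 1] and [e = -1] with the bound on [phi] shows that the
    coefficients [a] and [b] are bounded. Increments shorter than 1 then follow from the expansion,
    longer ones from boundedness. *)
Lemma smooth_bounded_lipschitz (phi : R -> R) : smooth_bounded phi ->
  exists2 l, 0 < l & forall x y, `|phi x - phi y| <= l * `|x - y|.
Proof.
move=> [_ [M phiM] [L [a [b t]]]].
have M0 : 0 <= M := le_trans (normr_ge0 _) (phiM 0).
have L0 : 0 <= L.
  by have := le_trans (normr_ge0 _) (t 0 1); rewrite expr1n mul1r normr1 minxx mulr1.
pose B := 2 * M + L.
have aB x : `|a x| <= B /\ `|b x| <= B.
  have := t x 1; have := t x (-1).
  have := phiM (x + 1); have := phiM (x + -1); have := phiM x.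
  rewrite normrN1 normr1 minxx sqrrN expr1n /B !ler_norml.
  move=> /andP[? ?] /andP[? ?] /andP[? ?] /andP[? ?] /andP[? ?].
  by split; apply/andP; split; lra.
exists (2 * B + L + 2 * M + 1); first by rewrite /B; lra.
move=> x y; have [h|h] := leP 1 `|x - y|.
  apply: (@le_trans _ _ (2 * M)); last by rewrite /B; nra.
  by rewrite (le_trans (ler_normB _ _))//; have := phiM x; have := phiM y; lra.
have := t y (x - y); rewrite (_ : y + (x - y) = x); last by ring.
move=> H.
have [a1 b1] := aB y.
have e0 := normr_ge0 (x - y).
rewrite (_ : phi x - phi y = (phi x - phi y - a y * (x - y) - b y * (x - y) ^+ 2) +
  a y * (x - y) + b y * (x - y) ^+ 2); last by ring.
have A1 : `|a y * (x - y)| <= B * `|x - y| by rewrite normrM ler_wpM2r.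
have A2 : `|b y * (x - y) ^+ 2| <= B * `|x - y|.
  rewrite normrM normrX; apply: ler_pM => //.
  by rewrite expr2; nra.
have A3 : L * ((x - y) ^+ 2 * Num.min 1 `|x - y|) <= L * `|x - y|.
  rewrite ler_wpM2l// min_r; last exact: ltW.
  by rewrite -[_ ^+ 2]real_normK ?num_real//; rewrite expr2; nra.
rewrite (le_trans (ler_normD _ _))//.
have := ler_normD (phi x - phi y - a y * (x - y) - b y * (x - y) ^+ 2) (a y * (x - y)).
by move: A1 A2 (le_trans H A3); nra.
Qed.

End smooth_bounded_lipschitz.

(** * Smooth test functions determine weak convergence *)

Section smooth_test_functions.
Context (R : realType) d (T : measurableType d) (P : probability T R).
Context d' (T' : measurableType d') (P' : probability T' R).
Variables (X_ : nat -> T -> R) (Z : T' -> R).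
Hypotheses (mX : forall n, measurable_fun [set: T] (X_ n))
  (mZ : measurable_fun [set: T'] Z).
Hypothesis smooth_cvg : forall phi, smooth_bounded phi ->
  Ex P (phi \o X_ n) @[n --> \oo] --> Ex P' (phi \o Z).

(** A smooth majorant of the indicator of [|x| > n]: one of the two logistic terms is at least one
    half there. Being itself a smooth test function, it turns tightness of the limit into tightness
    of the sequence. *)
Let tail (n : nat) (x : R) := 2 * (logistic (x - n%:R) + logistic (- x - n%:R)).

Let tail_smooth n : smooth_bounded (tail n).
Proof.
apply: smooth_boundedZ; apply: smooth_boundedD.
  have := smooth_bounded_affine 1 (- n%:R) (logistic_smooth R).
  by under eq_fun do rewrite mul1r.
have := smooth_bounded_affine (-1) (- n%:R) (logistic_smooth R).
by under eq_fun do rewrite mulN1r.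
Qed.

Let tail_ge0 n x : 0 <= tail n x.
Proof. by rewrite mulr_ge0// addr_ge0// ltW// logistic_gt0. Qed.

Let logistic_half (x : R) : 0 <= x -> 2^-1 <= logistic x.
Proof.
move=> x0; rewrite lef_pV2 ?posrE ?addr_gt0 ?expR_gt0//.
by have : expR (- x) <= 1; [rewrite -expR0 ler_expR oppr_le0|lra].
Qed.

Let tail_ge1 n x : ~~ (`|x| <= n%:R) -> 1 <= tail n x.
Proof.
rewrite -ltNge => h; have := logistic_gt0 (x - n%:R); have := logistic_gt0 (- x - n%:R).
rewrite /tail; have [x0|x0] := leP 0 x.
  by move: h; rewrite ger0_norm// => h; have : 2^-1 <= logistic (x - n%:R);
    [apply: logistic_half; lra|lra].
by move: h; rewrite ltr0_norm// => h; have : 2^-1 <= logistic (- x - n%:R);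
  [apply: logistic_half; lra|lra].
Qed.

Let logistic_le (u : R) : 0 < u -> logistic (- u) <= u^-1.
Proof.
move=> u0; rewrite lef_pV2 ?posrE ?addr_gt0 ?expR_gt0// opprK.
by have := expR_ge1Dx u; lra.
Qed.

Let tail_cvg x : tail n x @[n --> \oo] --> 0.
Proof.
apply: (@squeeze_cvgr _ _ _ _ (cst 0) (fun n => 16 * n.+1%:R^-1)); last 2 first.
- exact: cvg_cst.
- rewrite -[X in _ --> X](mulr0 16); apply: cvgMr; exact: cvg_harmonic.
near=> n; rewrite tail_ge0/=.
have n0 : 1 <= n%:R :> R by near: n; exact: nbhs_infty_ger.
have nx : 2 * `|x| + 1 <= n%:R by near: n; exact: nbhs_infty_ger.
have key u : u <= `|x| -> logistic (u - n%:R) <= 4 * n.+1%:R^-1.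
  move=> ux; rewrite -opprB; have h : n.+1%:R / 4 <= n%:R - u.
    by rewrite -[n.+1%:R]natr1; lra.
  have h0 : 0 < n.+1%:R / 4 :> R by rewrite divr_gt0.
  have h1 : 0 < n%:R - u by exact: lt_le_trans h.
  apply: (le_trans (logistic_le h1)).
  by rewrite -[4 * _]invrK lef_pV2 ?posrE ?invr_gt0 ?mulr_gt0 ?invr_gt0// invfM invrK mulrC.
have := key x (ler_norm _); have : - x <= `|x| by rewrite -normrN ler_norm.
by move/key; rewrite /tail; move: (n.+1%:R^-1) => v; lra.
Unshelve. all: by end_near. Qed.

(** [g] is replaced by a smooth [phi] close to [g] on [[-K, K]]; outside, the error is paid by [2 M]
    times [tail K]. [K] is chosen for [Z] alone, and the convergence of the mean of [tail K] extends
    the choice to large [n]. *)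
Lemma smooth_test_functions g M : continuous g -> (forall x, `|g x| <= M) ->
  Ex P (g \o X_ n) @[n --> \oo] --> Ex P' (g \o Z).
Proof.
move=> cg gM.
have M0 : 0 <= M := le_trans (normr_ge0 _) (gM 0).
have mg : measurable_fun setT g by exact: continuous_measurable_fun.
apply/cvgrPdist_le => e0 e00.
(* The budget: [e + 2 M e] for [Z], [e] for the smooth function, [e + 4 M e] for [X_ n], whose tail
   mean is at most [2 e]. *)
pose e := e0 / (4 + 6 * M); have e1 : 0 < e by rewrite divr_gt0//; lra.
have [K [K0 KZ]] : exists K : nat, (0 < K)%N /\ Ex P' (tail K \o Z) <= e.
  have mt n : measurable_fun setT (tail n \o Z).
    exact: measurableT_comp (smooth_bounded_measurable (tail_smooth n)) mZ.
  have tb n w : `|(tail n \o Z) w| <= 4.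
    rewrite ger0_norm ?tail_ge0//= /tail.
    have := logistic_lt1 (Z w - n%:R); have := logistic_lt1 (- Z w - n%:R); lra.
  have [_] := @Ex_dct _ _ _ P' (fun n => tail n \o Z) (fun=> 0) (fun=> 4)
    mt (measurable_cst _) (fun w => tail_cvg (Z w)) (integ_cst P' 4) tb.
  rewrite Ex_cst => /cvgrPdist_le /(_ e e1) h.
  near \oo => n; exists n; split; first by near: n; exact: nbhs_infty_gt.
  have : `|0 - Ex P' (tail n \o Z)| <= e by near: n; exact: h.
  by rewrite sub0r normrN; apply: le_trans; exact: ler_norm.
have K0' : 0 < K%:R :> R by rewrite ltr0n.
have [phi sphi phig] := smooth_approx cg K0' e1.
have pt x : `|g x - phi x| <= e + 2 * M * tail K x.
  have := phig x; have [xK|xK] := boolP (`|x| <= K%:R).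
    rewrite /clamp; move: xK; rewrite ler_norml => /andP[x1 x2].
    rewrite min_l// max_r// distrC => /le_trans; apply.
    by rewrite lerDl mulr_ge0// mulr_ge0.
  have := tail_ge1 xK => t1 h.
  rewrite (_ : g x - phi x = g x - g (clamp (- K%:R) K%:R x) - (phi x - g (clamp (- K%:R) K%:R x))); last by ring.
  rewrite (le_trans (ler_normB _ _))//.
  have := ler_normB (g x) (g (clamp (- K%:R) K%:R x)).
  have := gM x; have := gM (clamp (- K%:R) K%:R x).
  have : 2 * M <= 2 * M * tail K x by rewrite ler_peMr// mulr_ge0.
  by lra.
have [cphi [Mphi phiM] _] := sphi.
have [ctail [Mt tM] _] := tail_smooth K.
have bd d0 (T0 : measurableType d0) (P0 : probability T0 R) (V : T0 -> R) :
    measurable_fun setT V ->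
    `|Ex P0 (g \o V) - Ex P0 (phi \o V)| <= e + 2 * M * Ex P0 (tail K \o V).
  move=> mV.
  have ig : integ P0 (g \o V).
    apply: (@integ_bounded _ _ _ _ _ M) => [|w]; last exact: gM.
    exact: measurableT_comp mg mV.
  have ip : integ P0 (phi \o V).
    apply: (@integ_bounded _ _ _ _ _ Mphi) => [|w]; last exact: phiM.
    exact: measurableT_comp (smooth_bounded_measurable sphi) mV.
  have it : integ P0 (tail K \o V).
    apply: (@integ_bounded _ _ _ _ _ Mt) => [|w]; last exact: tM.
    exact: measurableT_comp (smooth_bounded_measurable (tail_smooth K)) mV.
  rewrite -ExB// -ExZ// -[X in _ <= X + _](Ex_cst P0) -ExD//; last 2 first.
  - exact: integ_cst.
  - exact: integZ.
  apply: Ex_norm_le.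
  - exact: integB.
  - by apply: integD; [exact: integ_cst|exact: integZ].
  - by move=> w; exact: pt.
have c1 := (cvgrPdist_le _ _).1 (smooth_cvg (tail_smooth K)) e e1.
have c2 := (cvgrPdist_le _ _).1 (smooth_cvg sphi) e e1.
near=> n.
have h1 : `|Ex P' (tail K \o Z) - Ex P (tail K \o X_ n)| <= e by near: n; exact: c1.
have h2 : `|Ex P' (phi \o Z) - Ex P (phi \o X_ n)| <= e by near: n; exact: c2.
have b1 := bd _ _ P _ (mX n); have b2 := bd _ _ P' _ mZ.
have eE : (4 + 6 * M) * e = e0.
  by rewrite /e mulrC divfK//; apply: lt0r_neq0; lra.
rewrite -eE.
move: h1; rewrite ler_norml => /andP[h1 _].
have h3 : 2 * M * Ex P' (tail K \o Z) <= 2 * M * e by rewrite ler_wpM2l// mulr_ge0.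
have h4 : 2 * M * Ex P (tail K \o X_ n) <= 2 * M * (2 * e).
  by rewrite ler_wpM2l ?mulr_ge0//; lra.
move: h2 b1 b2; rewrite !ler_norml => /andP[? ?] /andP[? ?] /andP[? ?].
by apply/andP; split; lra.
Unshelve. all: by end_near. Qed.

End smooth_test_functions.

(** * Lindeberg replacement *)

Section expectation_swap.
Context d1 d2 (T1 : measurableType d1) (T2 : measurableType d2) (R : realType).
Variables (P : probability T1 R) (Q : probability T2 R).

Lemma Ex_swap (psi : T1 * T2 -> R) (M : R) :
  measurable_fun [set: T1 * T2] psi -> (forall z, `|psi z| <= M) ->
  Ex P (fun w => Ex Q (fun z => psi (w, z))) = Ex Q (fun z => Ex P (fun w => psi (w, z))).
Proof.
move=> mpsi psiM.
have m1 w : measurable_fun setT (fun z => psi (w, z)) by exact: measurableT_comp.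
have m2 z : measurable_fun setT (fun w => psi (w, z)) by exact: measurableT_comp.
have i1 w : integ Q (fun z => psi (w, z)) by apply: (@integ_bounded _ _ _ _ _ M).
have i2 z : integ P (fun w => psi (w, z)) by apply: (@integ_bounded _ _ _ _ _ M).
have j1 : integ P (fun w => Ex Q (fun z => psi (w, z))).
  apply: (@integ_bounded _ _ _ _ _ M) => [|w]; last exact: Ex_bound.
  by apply: (@measurable_Ex _ _ _ _ _ Q psi M).
have j2 : integ Q (fun z => Ex P (fun w => psi (w, z))).
  apply: (@integ_bounded _ _ _ _ _ M) => [|w]; last exact: Ex_bound.
  apply: (@measurable_Ex _ _ _ _ _ P (fun zw => psi (zw.2, zw.1)) M) => //.
  by apply: measurableT_comp => //; exact: measurable_fun_pair.
pose h z := psi z + M.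
have h0 z : 0 <= h z by have := psiM z; rewrite ler_norml /h => /andP[]; lra.
have mh : measurable_fun setT (EFin \o h).
  by apply/measurable_EFinP; exact: measurable_funD.
have h0E z : (0 <= (EFin \o h) z)%E by rewrite lee_fin.
have E := @fubini_tonelli _ _ _ _ _ P Q (EFin \o h) mh h0E.
apply: (addIr M).
have -> : Ex P (fun w => Ex Q (fun z => psi (w, z))) + M =
    fine (\int[P]_w \int[Q]_z (h (w, z))%:E)%E.
  rewrite -[X in _ + X](Ex_cst P) -ExD//; last exact: integ_cst.
  rewrite {1}/Ex; congr fine; apply: eq_integral => w _.
  have iM := integD (i1 w) (integ_cst Q M).
  by rewrite (integ_fin iM) ExD ?Ex_cst//; exact: integ_cst.
rewrite [X in fine X = _]E.
rewrite -[X in _ + X](Ex_cst Q) -ExD//; last exact: integ_cst.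
rewrite [RHS]/Ex; congr fine; apply: eq_integral => z _.
have iM := integD (i2 z) (integ_cst P M).
by rewrite [LHS](integ_fin iM) ExD ?Ex_cst//; exact: integ_cst.
Qed.

End expectation_swap.

Section truncated_second_moment.
Context d (T : measurableType d) (R : realType) (P : probability T R).

(** With [t = |c|], [c^2] times its mean bounds, up to a constant, the Taylor remainder for the
    increment [c X]. It tends to 0 with [t] under a finite second moment alone, which is the
    Lindeberg condition in this setting. *)
Definition trunc_sqr (X : T -> R) (t : R) (w : T) := X w ^+ 2 * Num.min 1 (t * `|X w|).

Variable X : T -> R.
Hypotheses (mX : measurable_fun [set: T] X) (iX2 : integ P (fun w => X w ^+ 2)).

Lemma trunc_sqr_meas t : measurable_fun [set: T] (trunc_sqr X t).
Proof.
apply: measurable_funM; first exact: measurable_funX.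
apply: measurable_minr => //; apply: measurable_funM => //.
exact: measurableT_comp.
Qed.

Lemma trunc_sqr_ge0 t w : 0 <= t -> 0 <= trunc_sqr X t w.
Proof. by move=> t0; rewrite mulr_ge0 ?sqr_ge0// le_min ler01 mulr_ge0. Qed.

Lemma trunc_sqr_le t w : 0 <= t -> trunc_sqr X t w <= X w ^+ 2.
Proof. by move=> t0; rewrite ler_piMr ?sqr_ge0// ge_min lexx. Qed.

Lemma trunc_sqr_integ t : 0 <= t -> integ P (trunc_sqr X t).
Proof.
move=> t0; apply: (integ_le (trunc_sqr_meas t) _ iX2) => w.
by rewrite ger0_norm ?trunc_sqr_ge0// trunc_sqr_le.
Qed.

Lemma trunc_sqr_mono t t' : 0 <= t -> t <= t' ->
  Ex P (trunc_sqr X t) <= Ex P (trunc_sqr X t').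
Proof.
move=> t0 tt'; have t'0 := le_trans t0 tt'.
apply: Ex_le; [exact: trunc_sqr_integ|exact: trunc_sqr_integ|] => w.
rewrite /trunc_sqr ler_wpM2l ?sqr_ge0// le_min ge_min lexx/= ge_min.
by apply/orP; right; rewrite ler_wpM2r.
Qed.

Lemma trunc_sqr_cvg (t : nat -> R) : (forall n, 0 <= t n) -> t n @[n --> \oo] --> 0 ->
  Ex P (trunc_sqr X (t n)) @[n --> \oo] --> 0.
Proof.
move=> t0 tc; rewrite -[X in _ --> X](Ex_cst P).
apply: (@Ex_dct _ _ _ P (fun n => trunc_sqr X (t n)) (fun=> 0) _ _ _ _ iX2 _).2 => //.
- by move=> n; exact: trunc_sqr_meas.
- move=> w; apply: (@squeeze_cvgr _ _ _ _ (cst 0) (fun n => (X w ^+ 2 * `|X w|) * t n)).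
  + apply: nearW => n; rewrite trunc_sqr_ge0//= /trunc_sqr -mulrA.
    by rewrite ler_wpM2l ?sqr_ge0// ge_min mulrC lexx orbT.
  + exact: cvg_cst.
  + by rewrite -[X in _ --> X](mulr0 (X w ^+ 2 * `|X w|)); apply: cvgMr.
- by move=> n w; rewrite ger0_norm ?trunc_sqr_ge0// trunc_sqr_le.
Qed.

End truncated_second_moment.

Section lindeberg.
Context (R : realType).
Notation gamma := (normal_prob (0 : R) 1).
Variables (phi : R -> R) (M L : R) (a b : R -> R).
Hypotheses (cphi : continuous phi) (phiM : forall x, `|phi x| <= M).
Hypothesis taylor : forall x e,
  `|phi (x + e) - phi x - a x * e - b x * e ^+ 2| <= L * (e ^+ 2 * Num.min 1 `|e|).

Let mphi : measurable_fun [set: R] phi.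
Proof. exact: continuous_measurable_fun. Qed.

(** Up to the remainder, the mean of [phi (x + c X)] depends on [X] only through its mean 0 and
    variance [v]. Two variables with the same variance can therefore be exchanged. *)
Lemma taylor_Ex d (T : measurableType d) (P : probability T R) (X : T -> R) (c v x : R) :
  measurable_fun [set: T] X -> integ P (fun w => X w ^+ 2) -> Ex P X = 0 ->
  Ex P (fun w => X w ^+ 2) = v ->
  `|Ex P (fun w => phi (x + c * X w)) - (phi x + b x * (c ^+ 2 * v))| <=
  L * (c ^+ 2 * Ex P (trunc_sqr X `|c|)).
Proof.
move=> mX iX2 X0 Xv; have iX := integ_sqr mX iX2.
have ip : integ P (fun w => phi (x + c * X w)).
  apply: (@integ_bounded _ _ _ _ _ M) => //.
  by apply: measurableT_comp => //; apply: measurable_funD => //; exact: measurable_funM.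
have ic2 : integ P (fun w => b x * c ^+ 2 * X w ^+ 2) by exact: integZ.
have ic1 : integ P (fun w => a x * c * X w) by exact: integZ.
have i1 : integ P (fun w => phi x + a x * c * X w + b x * c ^+ 2 * X w ^+ 2).
  by apply: integD => //; apply: integD => //; exact: integ_cst.
have -> : phi x + b x * (c ^+ 2 * v) =
    Ex P (fun w => phi x + a x * c * X w + b x * c ^+ 2 * X w ^+ 2).
  rewrite ExD//; last by apply: integD => //; exact: integ_cst.
  rewrite ExD//; last exact: integ_cst.
  by rewrite Ex_cst !ExZ// X0 Xv; ring.
have it := trunc_sqr_integ mX iX2 (normr_ge0 c).
rewrite -ExB// mulrA -ExZ//; apply: Ex_norm_le.
- exact: integB.
- exact: integZ.
move=> w; have := taylor x (c * X w).
rewrite (_ : _ - _ - _ - _ = phi (x + c * X w) -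
   (phi x + a x * c * X w + b x * c ^+ 2 * X w ^+ 2)); last by ring.
by move/le_trans; apply; rewrite /trunc_sqr normrM exprMn !mulrA.
Qed.

Context d (T : measurableType d) (P : probability T R).
Variables (X : nat -> T -> R) (c : nat -> R) (tau : R) (h : R -> R).
Hypotheses (tau0 : 0 <= tau) (mX : forall i, measurable_fun [set: T] (X i))
  (iX2 : forall i, integ P (fun w => X i w ^+ 2)) (EX : forall i, Ex P (X i) = 0)
  (EX2 : forall i, Ex P (fun w => X i w ^+ 2) = tau ^+ 2)
  (Xh : forall i t, 0 <= t -> Ex P (trunc_sqr (X i) t) = h t).
Hypothesis indX : forall m,
  independent_pair P (fun w => \sum_(j < m) c j * X j w) (X m).

Let hg (t : R) := Ex gamma (trunc_sqr (fun z => tau * z) t).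

(** Induction on [m], uniformly in the shift [x]. The last summand is exchanged for a normal
    variable, the order of integration is reversed so that the induction hypothesis applies at the
    shift [x + k' z], and [gauss_convolution] merges the two normal variables. The normals are thus
    integrated in one at a time, without enlarging [T]. *)
Lemma lindeberg_bound m x :
  `|Ex P (fun w => phi (x + \sum_(j < m) c j * X j w)) -
    Ex gamma (fun z => phi (x + tau * Num.sqrt (\sum_(j < m) c j ^+ 2) * z))| <=
  L * \sum_(j < m) c j ^+ 2 * (h `|c j| + hg `|c j|).
Proof.
elim: m x => [|m IH] x.
  rewrite !big_ord0 sqrtr0 !mulr0 normr_le0 subr_eq0.
  by apply/eqP; transitivity (phi x); [rewrite -[RHS](Ex_cst P)|rewrite -[LHS](Ex_cst gamma)];
    apply: Ex_ext => w; rewrite ?big_ord0 ?mul0r addr0.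
set S := fun w => \sum_(j < m) c j * X j w.
set s := Num.sqrt (\sum_(j < m) c j ^+ 2).
have mS : measurable_fun setT S.
  by apply: measurable_sum => j; exact: measurable_funM.
(* The normal replacement uses [|c m|], because [gauss_convolution] wants nonnegative scales; by
   symmetry of the normal law nothing is lost. *)
pose k := c m; pose k' := `|c m| * tau.
have mlin (u v : R) : measurable_fun [set: R] (fun z => phi (u + v * z)).
  by apply: measurableT_comp => //; apply: measurable_funD => //; exact: measurable_funM.
have ilin (u v : R) : integ gamma (fun z => phi (u + v * z)).
  by apply: (@integ_bounded _ _ _ gamma (fun z => phi (u + v * z)) M) => //; exact: mlin.
have [gi g2] := gauss_sqr R.
have E1 : Ex P (fun w => phi (x + \sum_(j < m.+1) c j * X j w)) =
    Ex P (fun w => Ex P (fun w' => phi (x + S w + k * X m w'))).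
  rewrite -(@indep_Ex _ _ _ P _ _ _ _ S (X m) mS (mX m) (indX m)
    (fun sv => phi (x + sv.1 + k * sv.2)) _ _ _).2.
  - by apply: Ex_ext => w; rewrite big_ord_recr /= addrA.
  - apply: measurableT_comp => //; apply: measurable_funD; first exact: measurable_funD.
    exact: measurable_funM.
  - apply: (@integ_bounded _ _ _ _ _ M) => //=.
    apply: measurableT_comp => //; apply: measurable_funD; first exact: measurable_funD.
    by apply: measurable_funM => //; exact: mX.
  - move=> w; apply: (@integ_bounded _ _ _ _ _ M) => //=.
    apply: measurableT_comp => //; apply: measurable_funD => //.
    by apply: measurable_funM => //; exact: mX.
set E2 := Ex P (fun w => Ex gamma (fun z => phi (x + S w + k' * z))).
have mpsi : measurable_fun [set: T * R] (fun wz => phi (x + S wz.1 + k' * wz.2)).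
  apply: measurableT_comp => //; apply: measurable_funD; last exact: measurable_funM.
  by apply: measurable_funD => //; exact: measurableT_comp.
have D12 : `|Ex P (fun w => phi (x + \sum_(j < m.+1) c j * X j w)) - E2| <=
    L * (c m ^+ 2 * (h `|c m| + hg `|c m|)).
  have mpsi' : measurable_fun [set: T * T] (fun ww => phi (x + S ww.1 + k * X m ww.2)).
    apply: measurableT_comp => //; apply: measurable_funD; last first.
      by apply: measurable_funM => //; exact: measurableT_comp.
    by apply: measurable_funD => //; exact: measurableT_comp.
  have j1 : integ P (fun w => Ex P (fun w' => phi (x + S w + k * X m w'))).
    apply: (@integ_bounded _ _ _ _ _ M) => [|w].
      by apply: (@measurable_Ex _ _ _ _ _ P _ M mpsi').
    by apply: Ex_bound => //; exact: (measurableT_comp mpsi' (measurable_pair1 w)).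
  have j2 : integ P (fun w => Ex gamma (fun z => phi (x + S w + k' * z))).
    apply: (@integ_bounded _ _ _ _ _ M) => [|w].
      by apply: (@measurable_Ex _ _ _ _ _ gamma _ M mpsi).
    by apply: Ex_bound => //; exact: mlin.
  rewrite E1 -ExB// -(Ex_cst P (L * _)); apply: Ex_norm_le.
  - exact: integB.
  - exact: integ_cst.
  move=> w; set y := x + S w.
  have A1 := taylor_Ex (c m) y (mX m) (iX2 m) (EX m) (EX2 m).
  have itz : integ gamma (fun z => (tau * z) ^+ 2).
    by apply: (integ_ext _ (integZ (tau ^+ 2) gi)) => z; rewrite exprMn.
  have A2 := @taylor_Ex _ _ gamma (fun z => tau * z) `|c m| (tau ^+ 2) y _ itz _ _.
  have {A2} : `|Ex gamma (fun z => phi (y + k' * z)) - (phi y + b y * (c m ^+ 2 * tau ^+ 2))| <=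
     L * (c m ^+ 2 * hg `|c m|).
    move: A2; rewrite real_normK ?num_real// normr_id => A2.
    have -> : Ex gamma (fun z => phi (y + k' * z)) =
        Ex gamma (fun z => phi (y + `|c m| * (tau * z))).
      by apply: Ex_ext => z; rewrite /k' mulrA.
    apply: A2.
    - exact: measurable_funM.
    - by rewrite ExZ ?gauss_mean ?mulr0//; exact: gauss_id.
    - have -> : Ex gamma (fun z => (tau * z) ^+ 2) = Ex gamma (fun z => tau ^+ 2 * z ^+ 2).
        by apply: Ex_ext => z; rewrite exprMn.
      by rewrite ExZ// g2 mulr1.
  rewrite Xh// in A1; move: A1; rewrite -/k => A1 A2.
  rewrite !mulrDr (_ : Ex P _ - _ = (Ex P (fun w' => phi (y + k * X m w')) -
      (phi y + b y * (k ^+ 2 * tau ^+ 2))) -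
    (Ex gamma (fun z => phi (y + k' * z)) - (phi y + b y * (c m ^+ 2 * tau ^+ 2)))); last first.
    by rewrite /k; ring.
  by rewrite (le_trans (ler_normB _ _))// lerD.
have E2s : E2 = Ex gamma (fun z => Ex P (fun w => phi ((x + k' * z) + S w))).
  transitivity (Ex gamma (fun z => Ex P (fun w => phi (x + S w + k' * z)))).
    exact: (@Ex_swap _ _ _ _ _ P gamma _ M mpsi (fun z => phiM _)).
  by apply: Ex_ext => z; apply: Ex_ext => w /=; rewrite addrAC.
have conv : Ex gamma (fun z => Ex gamma (fun u => phi ((x + k' * z) + tau * s * u))) =
    Ex gamma (fun z => phi (x + tau * Num.sqrt (\sum_(j < m.+1) c j ^+ 2) * z)).
  have cx : continuous (fun y => phi (x + y)).
    move=> y; apply: continuous_comp; last exact: cphi.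
    by apply: cvgD; [exact: cvg_cst|exact: cvg_id].
  have k'0 : 0 <= k' by rewrite mulr_ge0.
  have ts0 : 0 <= tau * s by rewrite mulr_ge0// sqrtr_ge0.
  have := @gauss_convolution R (fun y => phi (x + y)) M k' (tau * s) k'0 ts0 cx
    (fun y => phiM (x + y)).
  rewrite (_ : Num.sqrt (k' ^+ 2 + (tau * s) ^+ 2) =
     tau * Num.sqrt (\sum_(j < m.+1) c j ^+ 2)); last first.
    have s0 : 0 <= \sum_(j < m) c j ^+ 2 by apply: sumr_ge0 => j _; exact: sqr_ge0.
    rewrite big_ord_recr/= /k' /s !exprMn sqr_sqrtr// real_normK ?num_real//.
    rewrite [_ * tau ^+ 2]mulrC -mulrDr sqrtrM ?sqr_ge0// sqrtr_sqr ger0_norm//.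
    by rewrite addrC.
  apply: etrans; apply: Ex_ext => z; apply: Ex_ext => u.
  by rewrite addrA.
have D23 : `|E2 - Ex gamma (fun z => Ex gamma (fun u => phi ((x + k' * z) + tau * s * u)))| <=
    L * \sum_(j < m) c j ^+ 2 * (h `|c j| + hg `|c j|).
  have mp1 : measurable_fun [set: R * T] (fun zw => phi ((x + k' * zw.1) + S zw.2)).
    apply: measurableT_comp => //; apply: measurable_funD; last exact: measurableT_comp.
    by apply: measurable_funD => //; exact: measurable_funM.
  have mp2 : measurable_fun [set: R * R] (fun zu => phi ((x + k' * zu.1) + tau * s * zu.2)).
    apply: measurableT_comp => //; apply: measurable_funD; last exact: measurable_funM.
    by apply: measurable_funD => //; exact: measurable_funM.
  have j1 : integ gamma (fun z => Ex P (fun w => phi ((x + k' * z) + S w))).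
    apply: (@integ_bounded _ _ _ _ _ M) => [|z].
      by apply: (@measurable_Ex _ _ _ _ _ P _ M mp1).
    by apply: Ex_bound => //; exact: (measurableT_comp mp1 (measurable_pair1 z)).
  have j2 : integ gamma (fun z => Ex gamma (fun u => phi ((x + k' * z) + tau * s * u))).
    apply: (@integ_bounded _ _ _ _ _ M) => [|z].
      by apply: (@measurable_Ex _ _ _ _ _ gamma _ M mp2).
    by apply: Ex_bound => //; exact: mlin.
  rewrite E2s -ExB// -(Ex_cst gamma (L * _)); apply: Ex_norm_le.
  - exact: integB.
  - exact: integ_cst.
  - by move=> z; exact: IH.
rewrite -conv [in leRHS]big_ord_recr /= mulrDr; apply: (le_trans (ler_distD E2 _ _)).
by rewrite [leLHS]addrC; exact: lerD.
Qed.

End lindeberg.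

(** * Signs of a variable with a Lipschitz density *)

Section lipschitz_density.
Context (R : realType) (f : R -> R).
Notation mu := (@lebesgue_measure R).
Hypotheses (f_derivable : forall x, derivable f x 1)
  (f'_bounded : (ereal_sup [set (`|f^`()%classic x|)%:E | x in [set: R]] < +oo)%E).

(** The regularity of the density enters the later estimates through this Lipschitz constant. *)
Lemma derivable_lipschitz : exists2 L : R, 0 <= L &
  forall x y, `|f x - f y| <= L * `|x - y|.
Proof.
have [L L0 HL] : exists2 L : R, 0 <= L & forall x, `|f^`()%classic x| <= L.
  pose s := ereal_sup [set (`|f^`()%classic x|)%:E | x in [set: R]].
  have soo : (s < +oo)%E := f'_bounded.
  have ub x : ((`|f^`()%classic x|)%:E <= s)%E by apply: ereal_sup_ubound; exists x.
  exists (fine s).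
    by apply: fine_ge0; apply: le_trans (ub 0); rewrite lee_fin.
  move=> x; rewrite -lee_fin fineK// fin_numElt soo andbT.
  by apply: lt_le_trans (ub 0); rewrite ltNyr.
exists L => // x y.
have df (z : R) : is_derive z (1 : R) f (f^`()%classic z).
  by rewrite derive1E; apply/derivableP.
have d1 (t : R) : is_derive t (1 : R) (fun t => f (y + t) - f y) (f^`()%classic (y + t)).
  have dfx := df (y + t).
  have dxt : is_derive t (1 : R) (fun t => y + t) 1.
    by apply: is_derive_eq; rewrite add0r mulr1.
  have H := @is_derive1_comp R f (fun t => y + t) t _ _ dfx dxt.
  by rewrite mulr1 in H; apply: is_derive_eq; rewrite subr0.
have := @derive_bound_pow R (fun t => f (y + t) - f y) (fun t => f^`()%classic (y + t))
  L 0%N L0 d1 _ _ (x - y).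
rewrite addr0 subrr expr1 (_ : y + (x - y) = x); last by ring.
by apply => // t; rewrite expr0 mulr1.
Qed.

End lipschitz_density.

Section density_of_interval.
Context (R : realType) d (T : measurableType d) (P : probability T R).
Notation mu := (@lebesgue_measure R).
Variables (X : {RV P >-> R}) (f : R -> R).
Hypothesis denX : has_density X f.

Let mf : measurable_fun [set: R] f. Proof. by case: denX. Qed.
Let f0 x : 0 <= f x. Proof. by case: denX. Qed.

Definition prob (A : set R) : R := fine (P (X @^-1` A)).

Lemma prob_density (A : set R) : measurable A ->
  ((prob A)%:E = \int[mu]_(x in A) (f x)%:E)%E.
Proof.
move=> mA; have [_ _ lX] := denX; rewrite -(lX A mA) fineK//.
by apply: fin_num_measure; rewrite -[X in measurable X]setTI; exact: measurable_funPT.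
Qed.

Lemma prob_itv (b1 b2 : bool) (a b lo hi : R) : a <= b ->
  (forall x, a <= x <= b -> lo <= f x <= hi) ->
  lo * (b - a) <= prob [set` Interval (BSide b1 a) (BSide b2 b)] <= hi * (b - a).
Proof.
move=> ab lohi.
have Icc x : [set` Interval (BSide b1 a) (BSide b2 b)] x -> a <= x <= b.
  by case: b1; case: b2; rewrite /= in_itv/= => /andP[? ?]; apply/andP; split=> //; exact: ltW.
move: Icc; set I := [set` _] => Icc.
have mI : measurable I by exact: measurable_itv.
have muI : mu I = (b - a)%:E.
  rewrite lebesgue_measure_itv/= lte_fin; case: ltP => // ba.
  by rewrite (le_anti (introT andP (conj ab ba))) subrr.
have ic (c : R) : mu.-integrable I (fun=> c%:E).
  apply/integrableP; split; first exact: measurable_cst.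
  by rewrite integral_cst//= muI -EFinM ltry.
have iint (c : R) : (\int[mu]_(x in I) c%:E = (c * (b - a))%:E)%E.
  by rewrite integral_cst//= EFinM; congr (_ * _)%E.
have iF : mu.-integrable I (EFin \o f).
  apply/integrableP; split; first by apply/measurable_EFinP; exact: measurable_funTS.
  under eq_integral do rewrite /= ger0_norm//.
  by rewrite -prob_density// ltry.
rewrite -!lee_fin prob_density// -!iint; apply/andP; split; apply: le_integral => //.
- by move=> x; rewrite inE => /Icc /lohi /andP[? _]; rewrite lee_fin.
- by move=> x; rewrite inE => /Icc /lohi /andP[_ ?]; rewrite lee_fin.
Qed.

End density_of_interval.

Section sign_expectations.
Context (R : realType) d (T : measurableType d) (P : probability T R).
Variables (X : {RV P >-> R}) (f : R -> R) (L : R).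
Hypotheses (denX : has_density X f) (L0 : 0 <= L)
  (fL : forall x y, `|f x - f y| <= L * `|x - y|).

Lemma measurable_sgr : measurable_fun [set: R] (@Num.sg R).
Proof.
rewrite (_ : Num.sg = fun x : R => \1_`]0, +oo[%classic x - \1_`]-oo, 0[%classic x).
  by apply: measurable_funB; exact: measurable_indic.
apply/funext => x; rewrite !indicE !mem_setE !in_itv/= andbT.
by case: (ltrgt0P x) => [x0|x0|->]; rewrite ?(gtr0_sg x0) ?(ltr0_sg x0) ?sgr0 ?subr0 ?sub0r// subrr.
Qed.

Lemma measurable_sg_shift a : measurable_fun [set: T] (fun w => Num.sg (X w - a)).
Proof.
by apply: (measurableT_comp measurable_sgr); apply: measurable_funB.
Qed.

Lemma sg_le1 (x : R) : `|Num.sg x| <= 1.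
Proof. by rewrite normr_sg; case: (x != 0). Qed.

Lemma integ_sg_shift a : integ P (fun w => Num.sg (X w - a)).
Proof. by apply: (@integ_bounded _ _ _ _ _ 1); [exact: measurable_sg_shift|move=> w; exact: sg_le1]. Qed.

Lemma prob_Ex (A : set R) : measurable A -> integ P (fun w => \1_A (X w)) /\
  Ex P (fun w => \1_A (X w)) = prob X A.
Proof.
move=> mA; have mXA : measurable (X @^-1` A).
  by rewrite -[X in measurable X]setTI; exact: measurable_funPT.
have E : (fun w => \1_A (X w)) = \1_(X @^-1` A) :> (T -> R).
  by apply/funext => w; rewrite !indicE.
split; last by rewrite E Ex_indic.
rewrite E; apply: (@integ_bounded _ _ _ _ _ 1); first exact: measurable_indic.
by move=> w; rewrite indicE; case: (_ \in _); rewrite ?normr1 ?normr0.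
Qed.

Lemma prob_le1 (A : set R) : measurable A -> prob X A <= 1.
Proof.
move=> mA; have [i <-] := prob_Ex mA; rewrite -[leRHS](Ex_cst P); apply: Ex_le => //.
  exact: integ_cst.
Qed.

(** On [[x, x + 1]] the density is at least [f x - L], and the mass of this interval is at most
    1. *)
Lemma density_bounded x : f x <= 1 + L.
Proof.
have ab : x <= x + 1 by lra.
have h y : x <= y <= x + 1 -> f x - L <= f y <= f x + L.
  move=> /andP[h1 h2]; have := fL y x; rewrite (ger0_norm (_ : 0 <= y - x)) ?subr_ge0//.
  have : L * (y - x) <= L by rewrite -[leRHS]mulr1 ler_wpM2l//; lra.
  by move=> u v; have := le_trans v u; rewrite ler_norml => /andP[? ?]; apply/andP; split; lra.
have /andP[+ _] := prob_itv denX true false ab h.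
have := @prob_le1 `[x, x + 1]%classic (measurable_itv _).
by move=> h1 h2; have := le_trans h2 h1; rewrite addrAC subrr add0r mulr1; lra.
Qed.

(** For [a < b] the difference is 2 inside the interval and 1 at its endpoints, since [sg 0 = 0];
    hence the open interval below and the closed one above. *)
Lemma sg_diff_itv (a b e : R) : a <= b ->
  2 * \1_`]a, b[%classic e <= Num.sg (e - a) - Num.sg (e - b) <= 2 * \1_`[a, b]%classic e.
Proof.
move=> ab; rewrite !indicE !mem_setE !in_itv/=.
have [ea|ea|ea] := ltrgtP e a.
- rewrite ltr0_sg ?subr_lt0// ltr0_sg ?subr_lt0; last exact: lt_le_trans ab.
  by rewrite /= mulr0 subrr lexx.
- have [eb|eb|eb] := ltrgtP e b.
  + by rewrite gtr0_sg ?subr_gt0// ltr0_sg ?subr_lt0//= mulr1; apply/andP; split; lra.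
  + by rewrite !gtr0_sg ?subr_gt0//= mulr0 subrr lexx.
  + by rewrite eb subrr sgr0 gtr0_sg ?subr_gt0 -?eb//= mulr0 mulr1 subr0; apply/andP; split; lra.
- rewrite ea subrr sgr0 ab /= mulr0 mulr1 sub0r; apply/andP; split.
    by rewrite oppr_ge0 sgr_le0 subr_le0.
  by have := sg_le1 (a - b); rewrite ler_norml => /andP[? ?]; lra.
Qed.

Lemma Ex_sg_diff (a b lo hi : R) : a <= b ->
  (forall x, a <= x <= b -> lo <= f x <= hi) ->
  2 * lo * (b - a) <= Ex P (fun w => Num.sg (X w - a) - Num.sg (X w - b)) <= 2 * hi * (b - a).
Proof.
move=> ab h; have iD := integB (integ_sg_shift a) (integ_sg_shift b).
have [i1 E1] := @prob_Ex `]a, b[%classic (measurable_itv _).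
have [i2 E2] := @prob_Ex `[a, b]%classic (measurable_itv _).
have /andP[p1 _] := prob_itv denX false true ab h.
have /andP[_ p2] := prob_itv denX true false ab h.
apply/andP; split.
  rewrite -mulrA; apply: (@le_trans _ _ (2 * Ex P (fun w => \1_`]a, b[%classic (X w)))).
    by rewrite ler_wpM2l// E1.
  rewrite -ExZ//; apply: Ex_le => //; first exact: integZ.
  by move=> w; have /andP[] := sg_diff_itv (X w) ab.
rewrite -mulrA; apply: (@le_trans _ _ (2 * Ex P (fun w => \1_`[a, b]%classic (X w)))); last first.
  by rewrite ler_wpM2l// E2.
rewrite -ExZ//; apply: Ex_le => //; first exact: integZ.
by move=> w; have /andP[] := sg_diff_itv (X w) ab.
Qed.

Lemma Ex_abs_sg_diff (a b : R) :
  Ex P (fun w => `|Num.sg (X w - a) - Num.sg (X w - b)|) <= 2 * (1 + L) * `|a - b|.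
Proof.
have f0 x : 0 <= f x by case: denX.
have key a' b' : a' <= b' ->
    Ex P (fun w => `|Num.sg (X w - a') - Num.sg (X w - b')|) <= 2 * (1 + L) * (b' - a').
  move=> ab; rewrite (@Ex_ext _ _ _ _ _ (fun w => Num.sg (X w - a') - Num.sg (X w - b'))).
    have h x : a' <= x <= b' -> 0 <= f x <= 1 + L by rewrite f0 density_bounded.
    by have /andP[] := Ex_sg_diff ab h.
  move=> w; have /andP[+ _] := sg_diff_itv (X w) ab.
  rewrite indicE => h; rewrite ger0_norm//; apply: le_trans h.
  by rewrite mulr_ge0.
have [ab|/ltW ba] := leP a b.
  by rewrite distrC (ger0_norm (_ : 0 <= b - a)) ?subr_ge0//; exact: key.
rewrite (ger0_norm (_ : 0 <= a - b)) ?subr_ge0//.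
rewrite (@Ex_ext _ _ _ _ _ (fun w => `|Num.sg (X w - b) - Num.sg (X w - a)|)); first exact: key.
by move=> w; rewrite distrC.
Qed.

(** The mean is twice the signed mass of the interval between 0 and [a], on which [f] differs from
    [f 0] by at most [L |a|]. This is the origin of the slope [2 f(0)] in the score. *)
Lemma Ex_sg_increment a :
  `|Ex P (fun w => Num.sg (X w) - Num.sg (X w - a)) - 2 * f 0 * a| <= 2 * L * a ^+ 2.
Proof.
have E : (fun w => Num.sg (X w)) = (fun w => Num.sg (X w - 0)).
  by apply/funext => w; rewrite subr0.
rewrite (@Ex_ext _ _ _ _ _ (fun w => Num.sg (X w - 0) - Num.sg (X w - a))); last first.
  by move=> w; rewrite subr0.
have near0 m x : `|x| <= m -> f 0 - L * m <= f x <= f 0 + L * m.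
  move=> xm; have := fL x 0; rewrite subr0.
  have : L * `|x| <= L * m by rewrite ler_wpM2l.
  by move=> u v; have := le_trans v u; rewrite ler_norml => /andP[? ?]; apply/andP; split; lra.
have [a0|/ltW a0] := leP 0 a.
  have h x : 0 <= x <= a -> f 0 - L * a <= f x <= f 0 + L * a.
    by move=> /andP[x0 xa]; apply: near0; rewrite ger0_norm.
  have /andP[h1 h2] := Ex_sg_diff a0 h.
  by rewrite ler_norml; apply/andP; split; nra.
have h x : a <= x <= 0 -> f 0 - L * (- a) <= f x <= f 0 + L * (- a).
  by move=> /andP[x0 xa]; apply: near0; rewrite ler0_norm// lerN2.
have /andP[h1 h2] := Ex_sg_diff a0 h.
have -> : Ex P (fun w => Num.sg (X w - 0) - Num.sg (X w - a)) =
    - Ex P (fun w => Num.sg (X w - a) - Num.sg (X w - 0)).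
  rewrite -ExN; last exact: integB (integ_sg_shift _) (integ_sg_shift _).
  by apply: Ex_ext => w; rewrite opprB.
by rewrite ler_norml; apply/andP; split; nra.
Qed.

Lemma prob_set1 x : prob X [set x] = 0.
Proof.
have h y : x <= y <= x -> 0 <= f y <= 1 + L.
  by move=> _; rewrite density_bounded; case: denX => _ ->.
have := prob_itv denX true false (lexx x) h; rewrite subrr !mulr0 set_itv1.
by move=> /andP[? ?]; apply/eqP; rewrite eq_le; apply/andP.
Qed.

Let indic0 (x : R) : \1_[set (0 : R)] x = (x == 0)%:R :> R.
Proof. by rewrite indicE; congr (nat_of_bool _)%:R; apply/idP/eqP; rewrite inE. Qed.

Hypothesis med : is_median X 0.

(** Both closed half-lines have probability at least one half, and their probabilities add up to 1
    because the point 0 has no mass; so they are equal. *)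
Lemma Ex_sg_median : Ex P (fun w => Num.sg (X w)) = 0.
Proof.
have pos (x : R) : \1_`]0, +oo[%classic x = 1 - \1_`]-oo, 0]%classic x :> R.
  by rewrite !indicE !mem_setE !in_itv/= andbT; case: ltP => _; rewrite ?subr0 ?subrr.
have neg (x : R) : \1_`]-oo, 0[%classic x = 1 - \1_`[0, +oo[%classic x :> R.
  by rewrite !indicE !mem_setE !in_itv/= andbT; case: ltP => _; rewrite ?subr0 ?subrr.
have [j1 F1] := @prob_Ex `]-oo, 0]%classic (measurable_itv _).
have [j2 F2] := @prob_Ex `[0, +oo[%classic (measurable_itv _).
have [j3 F3] := @prob_Ex [set 0] (measurable_set1 _).
have fin (A : set R) : measurable A -> P (X @^-1` A) \is a fin_num.
  by move=> mA; apply: fin_num_measure; rewrite -[X in measurable X]setTI; exact: measurable_funPT.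
have m1 : 2^-1 <= prob X `]-oo, 0]%classic.
  have E : X @^-1` `]-oo, 0]%classic = [set w | X w <= 0].
    by apply/seteqP; split => w /=; rewrite in_itv/=.
  have [+ _] := med; rewrite -E => h; rewrite -lee_fin /prob fineK//; exact: fin.
have m2 : 2^-1 <= prob X `[0, +oo[%classic.
  have E : X @^-1` `[0, +oo[%classic = [set w | 0 <= X w].
    by apply/seteqP; split => w /=; rewrite in_itv/= andbT.
  have [_ +] := med; rewrite -E => h; rewrite -lee_fin /prob fineK//; exact: fin.
have S : prob X `]-oo, 0]%classic + prob X `[0, +oo[%classic = 1.
  transitivity (Ex P (fun w => 1 + \1_[set 0] (X w))); last first.
    by rewrite ExD// ?Ex_cst ?F3 ?prob_set1 ?addr0//; exact: integ_cst.
  rewrite -F1 -F2 -ExD//; apply: Ex_ext => w.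
  rewrite indic0 !indicE !mem_setE !in_itv/= andbT.
  by case: ltrgtP => _; rewrite ?addr0 ?add0r//=.
rewrite (@Ex_ext _ _ _ _ _ (fun w => \1_`[0, +oo[%classic (X w) - \1_`]-oo, 0]%classic (X w))).
  by rewrite ExB// F1 F2; lra.
move=> w; rewrite !indicE !mem_setE !in_itv/= andbT.
by case: (ltrgt0P (X w)) => [x0|x0|->]; rewrite ?(gtr0_sg x0) ?(ltr0_sg x0) ?sgr0 ?subr0 ?sub0r// subrr.
Qed.

Lemma Ex_sg_sqr : Ex P (fun w => Num.sg (X w) ^+ 2) = 1.
Proof.
have [j3 F3] := @prob_Ex [set 0] (measurable_set1 _).
rewrite (@Ex_ext _ _ _ _ _ (fun w => 1 - \1_[set 0] (X w))).
  by rewrite ExB// ?Ex_cst ?F3 ?prob_set1 ?subr0//; exact: integ_cst.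
move=> w; rewrite indic0 sqr_sg.
by case: eqVneq; rewrite ?subr0 ?subrr.
Qed.

End sign_expectations.

(** * Convergence in probability and the LAD subgradient *)

Lemma integ_indic d (T : measurableType d) (R : realType) (P : probability T R) (A : set T) :
  measurable A -> integ P (\1_A : T -> R).
Proof.
move=> mA; apply: (@integ_bounded _ _ _ _ _ 1); first exact: measurable_indic.
by move=> w; rewrite indicE; case: (_ \in _); rewrite ?normr1 ?normr0.
Qed.

Section mostly.
Context d (T : measurableType d) (R : realType) (P : probability T R).
Implicit Types (Q : nat -> T -> Prop) (X : nat -> T -> R).

(** The property is only required outside a measurable exceptional set, so [Q n] itself need not be
    measurable. *)
Definition mostly (e : R) Q := \forall n \near \oo, exists E : set T,
  [/\ measurable E, (P E <= e%:E)%E & forall w, ~ E w -> Q n w].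

Definition small X := forall e eta : R, 0 < e -> 0 < eta ->
  mostly e (fun n w => `|X n w| <= eta).

Lemma mostly_imp e Q Q' : mostly e Q ->
  (\forall n \near \oo, forall w, Q n w -> Q' n w) -> mostly e Q'.
Proof.
move=> mQ QQ'; near=> n.
have [E [mE PE EQ]] : exists E : set T,
    [/\ measurable E, (P E <= e%:E)%E & forall w, ~ E w -> Q n w] by near: n.
exists E; split => // w /EQ.
have : forall w, Q n w -> Q' n w by near: n.
exact.
Unshelve. all: by end_near. Qed.

Lemma mostlyT e Q : 0 <= e -> (\forall n \near \oo, forall w, Q n w) -> mostly e Q.
Proof.
move=> e0 aQ; near=> n; exists set0; split => //; first by rewrite measure0 lee_fin.
by move=> w _; move: w; near: n.
Unshelve. all: by end_near. Qed.

Lemma mostly_and e1 e2 Q1 Q2 : mostly e1 Q1 -> mostly e2 Q2 ->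
  mostly (e1 + e2) (fun n w => Q1 n w /\ Q2 n w).
Proof.
move=> m1 m2; near=> n.
have [E1 [mE1 PE1 EQ1]] : exists E : set T,
    [/\ measurable E, (P E <= e1%:E)%E & forall w, ~ E w -> Q1 n w] by near: n.
have [E2 [mE2 PE2 EQ2]] : exists E : set T,
    [/\ measurable E, (P E <= e2%:E)%E & forall w, ~ E w -> Q2 n w] by near: n.
exists (E1 `|` E2); split; first exact: measurableU.
  by rewrite EFinD (le_trans (measureU2 _ _ _))// leeD.
by move=> w /not_orP[/EQ1 ? /EQ2 ?].
Unshelve. all: by end_near. Qed.

Lemma mostly_forall (N : nat) (e : R) (Q : nat -> nat -> T -> Prop) : 0 <= e ->
  (forall k, (k < N)%N -> mostly e (Q k)) ->
  mostly (N%:R * e) (fun n w => forall k, (k < N)%N -> Q k n w).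
Proof.
move=> e0; elim: N => [|N IH] mQ.
  by apply: mostlyT; [rewrite mul0r|apply: nearW].
have := mostly_and (IH (fun k kN => mQ k (ltnW kN))) (mQ N (ltnSn N)).
have -> : N.+1%:R * e = N%:R * e + e by rewrite -natr1 mulrDl mul1r.
move=> h; apply: (mostly_imp h).
apply: nearW => n w [h1 h2] k; rewrite ltnS leq_eqVlt => /predU1P[->//|].
exact: h1.
Qed.

Lemma mostly_markov (X : nat -> T -> R) (e eta : R) : 0 < eta ->
  (forall n, measurable_fun [set: T] (X n)) ->
  (\forall n \near \oo, integ P (fun w => `|X n w|) /\ Ex P (fun w => `|X n w|) <= e * eta) ->
  mostly e (fun n w => `|X n w| <= eta).
Proof.
move=> eta0 mX bX; near=> n.
have [iX eX] : integ P (fun w => `|X n w|) /\ Ex P (fun w => `|X n w|) <= e * eta by near: n.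
have mE : measurable [set w | eta < `|X n w|].
  rewrite -[X in measurable X]setTI.
  have mA : measurable_fun setT (fun w => `|X n w|) by exact: measurableT_comp.
  have := mA measurableT `]eta, +oo[%classic (measurable_itv _).
  by congr measurable; apply/seteqP; split => w [_] /=; rewrite in_itv/= andbT.
exists [set w | eta < `|X n w|]; split => //; last by move=> w /= /negP; rewrite -leNgt.
have fP : P [set w | eta < `|X n w|] \is a fin_num by exact: fin_num_measure.
rewrite -(fineK fP) lee_fin -(ler_pM2r eta0); apply: le_trans eX.
rewrite -Ex_indic// mulrC -ExZ; last exact: integ_indic.
apply: Ex_le => //; first exact/integZ/integ_indic.
move=> w; rewrite indicE; case: (boolP (w \in _)) => [/set_mem /= h|_].
  by rewrite mulr1 ltW.
by rewrite mulr0.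
Unshelve. all: by end_near. Qed.

Lemma mostly_chebyshev (X : nat -> T -> R) (e eta : R) : 0 < eta ->
  (forall n, measurable_fun [set: T] (X n)) ->
  (\forall n \near \oo, integ P (fun w => X n w ^+ 2) /\
     Ex P (fun w => X n w ^+ 2) <= e * eta ^+ 2) ->
  mostly e (fun n w => `|X n w| <= eta).
Proof.
move=> eta0 mX bX.
have m2 : mostly e (fun n w => `|X n w ^+ 2| <= eta ^+ 2).
  apply: mostly_markov; first by rewrite exprn_gt0.
    by move=> n; exact: measurable_funX.
  move: bX; apply: filterS => n [i2 e2].
  have E : (fun w => `|X n w ^+ 2|) = (fun w => X n w ^+ 2).
    by apply/funext => w; rewrite ger0_norm// sqr_ge0.
  by rewrite E.
apply: (mostly_imp m2); apply: nearW => n w; rewrite normrX.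
by rewrite ler_sqr ?nnegrE// ltW.
Qed.

Lemma small_markov (X : nat -> T -> R) (b : nat -> R) :
  (forall n, measurable_fun [set: T] (X n)) ->
  (\forall n \near \oo, integ P (fun w => `|X n w|) /\ Ex P (fun w => `|X n w|) <= b n) ->
  b n @[n --> \oo] --> 0 -> small X.
Proof.
move=> mX bX b0 e eta e0 eta0; apply: mostly_markov => //.
have ee : 0 < e * eta by rewrite mulr_gt0.
near=> n.
have [i h] : integ P (fun w => `|X n w|) /\ Ex P (fun w => `|X n w|) <= b n by near: n.
split => //; apply: (le_trans h).
have : `|0 - b n| <= e * eta by near: n; exact: (cvgrPdist_le _ _).1 b0 _ ee.
by rewrite sub0r normrN; apply: le_trans; exact: ler_norm.
Unshelve. all: by end_near. Qed.

Lemma small_chebyshev (X : nat -> T -> R) (b : nat -> R) :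
  (forall n, measurable_fun [set: T] (X n)) ->
  (\forall n \near \oo, integ P (fun w => X n w ^+ 2) /\ Ex P (fun w => X n w ^+ 2) <= b n) ->
  b n @[n --> \oo] --> 0 -> small X.
Proof.
move=> mX bX b0 e eta e0 eta0; apply: mostly_chebyshev => //.
have ee : 0 < e * eta ^+ 2 by rewrite mulr_gt0// exprn_gt0.
near=> n.
have [i h] : integ P (fun w => X n w ^+ 2) /\ Ex P (fun w => X n w ^+ 2) <= b n by near: n.
split => //; apply: (le_trans h).
have : `|0 - b n| <= e * eta ^+ 2 by near: n; exact: (cvgrPdist_le _ _).1 b0 _ ee.
by rewrite sub0r normrN; apply: le_trans; exact: ler_norm.
Unshelve. all: by end_near. Qed.

Lemma mostly_bounded (X : nat -> T -> R) (V : R) : 0 <= V ->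
  (forall n, measurable_fun [set: T] (X n)) ->
  (\forall n \near \oo, integ P (fun w => X n w ^+ 2) /\ Ex P (fun w => X n w ^+ 2) <= V) ->
  forall e, 0 < e -> exists2 K, 0 < K & mostly e (fun n w => `|X n w| <= K).
Proof.
move=> V0 mX bX e e0; exists (V / e + 1); first by rewrite ltr_wpDl// divr_ge0// ltW.
have K1 : 0 < V / e + 1 by rewrite ltr_wpDl// divr_ge0// ltW.
apply: mostly_chebyshev => //; move: bX; apply: filterS => n [i h]; split => //.
apply: (le_trans h).
have VE : V = e * (V / e) by field; rewrite gt_eqF.
have v0 : 0 <= V / e by rewrite divr_ge0// ltW.
by rewrite {1}VE ler_pM2l//; nra.
Qed.

Lemma smallD X X' : small X -> small X' -> small (fun n w => X n w + X' n w).
Proof.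
move=> s1 s2 e eta e0 eta0.
have e2 : 0 < e / 2 by rewrite divr_gt0.
have eta2 : 0 < eta / 2 by rewrite divr_gt0.
have := mostly_and (s1 _ _ e2 eta2) (s2 _ _ e2 eta2).
rewrite -splitr => h; apply: (mostly_imp h); apply: nearW => n w [h1 h2].
by rewrite (le_trans (ler_normD _ _))// [leRHS]splitr lerD.
Qed.

Lemma smallN X : small X -> small (fun n w => - X n w).
Proof.
move=> s e eta e0 eta0; apply: (mostly_imp (s _ _ e0 eta0)).
by apply: nearW => n w; rewrite normrN.
Qed.

Lemma small_eq X X' : (\forall n \near \oo, forall w, X n w = X' n w) -> small X -> small X'.
Proof.
move=> XX s e eta e0 eta0; apply: (mostly_imp (s _ _ e0 eta0)).
by move: XX; apply: filterS => n + w => ->.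
Qed.

(** The Slutsky step: off the exceptional set [phi] moves little because it is Lipschitz, and on it
    the bound [2 M] is multiplied by a small probability. *)
Lemma small_Ex X X' (phi : R -> R) :
  (forall n, measurable_fun [set: T] (X n)) -> (forall n, measurable_fun [set: T] (X' n)) ->
  small (fun n w => X n w - X' n w) -> smooth_bounded phi ->
  Ex P (phi \o X n) - Ex P (phi \o X' n) @[n --> \oo] --> 0.
Proof.
move=> mX mX' sX sphi.
have mphi := smooth_bounded_measurable sphi.
have [l l0 lip] := smooth_bounded_lipschitz sphi.
have [cphi [M phiM] _] := sphi.
have M0 : 0 <= M := le_trans (normr_ge0 _) (phiM 0).
apply/cvgrPdist_le => e0 e00.
pose e := e0 / (1 + 2 * M); have e1 : 0 < e by rewrite divr_gt0//; lra.
have el : 0 < e / l by rewrite divr_gt0.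
have eE : (1 + 2 * M) * e = e0 by rewrite /e mulrC divfK//; apply: lt0r_neq0; lra.
have := sX e (e / l) e1 el; apply: filterS => n [E [mE PE EQ]].
have iE : integ P (\1_E : T -> R) by exact: integ_indic.
have i1 : integ P (phi \o X n).
  by apply: (@integ_bounded _ _ _ _ _ M) => [|w]; [exact: measurableT_comp|exact: phiM].
have i2 : integ P (phi \o X' n).
  by apply: (@integ_bounded _ _ _ _ _ M) => [|w]; [exact: measurableT_comp|exact: phiM].
rewrite sub0r normrN -ExB//.
have h : `|Ex P (fun w => (phi \o X n) w - (phi \o X' n) w)| <=
    Ex P (fun w => e + 2 * M * \1_E w).
  apply: Ex_norm_le; first exact: integB.
    by apply: integD; [exact: integ_cst|exact: integZ].
  move=> w /=; rewrite indicE; case: (boolP (w \in E)) => [_|].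
    rewrite mulr1 (le_trans (ler_normB _ _))//.
    by have := phiM (X n w); have := phiM (X' n w); lra.
  rewrite notin_setE => /EQ h; rewrite mulr0 addr0 (le_trans (lip _ _))//.
  by rewrite mulrC -ler_pdivlMr.
apply: (le_trans h); rewrite ExD ?Ex_cst; [|exact: integ_cst|exact: integZ].
rewrite ExZ// Ex_indic// -eE.
have fP : P E \is a fin_num by exact: fin_num_measure.
have PE' : fine (P E) <= e by rewrite -lee_fin fineK.
have : 2 * M * fine (P E) <= 2 * M * e by rewrite ler_wpM2l// mulr_ge0.
by lra.
Qed.

End mostly.

Section lad_subgradient.
Context (R : realType).

(* sg (e - u x) x is minus a subgradient of |e - u x| in u, so it orders any minimiser with respect to u. *)
Lemma lad_subgradient (n : nat) (e x : nat -> R) (v : R) :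
  (forall u, \sum_(i < n) `|e i - v * x i| <= \sum_(i < n) `|e i - u * x i|) ->
  forall u, 0 <= (v - u) * \sum_(i < n) x i * Num.sg (e i - u * x i).
Proof.
move=> vmin u; have := vmin u; rewrite -subr_ge0 -sumrB => h.
rewrite mulr_sumr; apply: (le_trans h); apply: ler_sum => i _.
set b := e i - u * x i.
have -> : e i - v * x i = b - (v - u) * x i by rewrite /b; ring.
rewrite (normrEsg b).
have sgle (s z : R) : Num.sg s * z <= `|z|.
  by apply: (le_trans (ler_norm _)); rewrite normrM normr_sg; case: (s != 0); rewrite ?mul1r ?mul0r.
by have := sgle b (b - (v - u) * x i); nra.
Qed.

End lad_subgradient.

(** * A central limit theorem for weighted sums *)

Section block_functions.
Context d (T : measurableType d) (R : realType) (P : probability T R).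
Variables (I : choiceType) (eps : I -> {RV P >-> R}).
Hypothesis ind : mutually_independent eps.

Lemma block_fun_indep d1 d2 (U : measurableType d1) (V : measurableType d2)
    (J K : set I) (A : T -> U) (B : T -> V) :
  J `&` K = set0 -> block_fun eps J A -> block_fun eps K B -> independent_pair P A B.
Proof.
move=> JK mA mB S S' mS mS'; apply: (block_indep2 ind JK).
  by have := mA measurableT S mS; rewrite setTI.
by have := mB measurableT S' mS'; rewrite setTI.
Qed.

Lemma block_fun_comp d1 d2 (U : measurableType d1) (V : measurableType d2)
    (J : set I) (A : T -> U) (g : U -> V) :
  measurable_fun [set: U] g -> block_fun eps J A -> block_fun eps J (fun w => g (A w)).
Proof. by move=> mg mA; exact: (measurableT_comp mg mA). Qed.

Lemma block_fun_pair d1 d2 (U : measurableType d1) (V : measurableType d2)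
    (J : set I) (A : T -> U) (B : T -> V) :
  block_fun eps J A -> block_fun eps J B -> block_fun eps J (fun w => (A w, B w)).
Proof. by move=> mA mB; exact: (measurable_fun_pair mA mB). Qed.

Lemma block_funD (J : set I) (A B : T -> R) :
  block_fun eps J A -> block_fun eps J B -> block_fun eps J (fun w => A w + B w).
Proof. by move=> mA mB; exact: (measurable_funD mA mB). Qed.

Lemma block_funM (J : set I) (A B : T -> R) :
  block_fun eps J A -> block_fun eps J B -> block_fun eps J (fun w => A w * B w).
Proof. by move=> mA mB; exact: (measurable_funM mA mB). Qed.

Lemma block_fun_cst (J : set I) (c : R) : block_fun eps J (fun=> c).
Proof. exact: (@measurable_cst _ _ (block eps J) _ setT c). Qed.

Lemma block_funZ (J : set I) (c : R) (A : T -> R) :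
  block_fun eps J A -> block_fun eps J (fun w => c * A w).
Proof. by move=> mA; apply: block_funM => //; exact: block_fun_cst. Qed.

Lemma block_fun_sum (J : set I) (K : Type) (s : seq K) (F : K -> T -> R) :
  (forall k, block_fun eps J (F k)) -> block_fun eps J (fun w => \sum_(k <- s) F k w).
Proof. by move=> mF; apply: (@measurable_sum _ (block eps J)). Qed.

Lemma indep_partial_sum (iota_ : nat -> I) (q : R -> R) (c : nat -> R) (m : nat) :
  injective iota_ -> measurable_fun [set: R] q ->
  independent_pair P (fun w => \sum_(j < m) c j * q (eps (iota_ j) w))
    (fun w => q (eps (iota_ m) w)).
Proof.
move=> inj mq; apply: (@block_fun_indep _ _ _ _ [set i | exists2 j, (j < m)%N & iota_ j = i] [set iota_ m]).
- by apply/seteqP; split => // i [[j jm <-] /= /inj E]; rewrite E ltnn in jm.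
- apply: (@block_fun_sum _ 'I_m) => j; apply: block_funZ; apply: block_fun_comp => //.
  by apply: block_fun_coord; exists j.
- by apply: block_fun_comp => //; exact: block_fun_coord.
Qed.

End block_functions.

Section same_law.
Context d (T : measurableType d) (R : realType) (P : probability T R).
Variables (X X' : {RV P >-> R}).
Hypothesis lXX : has_law X (distribution P X').

Lemma same_law_integ (q : R -> R) : measurable_fun [set: R] q ->
  integ P (fun w => q (X w)) -> integ P (fun w => q (X' w)).
Proof.
move=> mq iq; have iX : integ (distribution P X) q by exact: integ_distribution.
move/integrableP : iX => [_ iX]; apply/integrableP; split.
  by apply/measurable_EFinP; exact: measurableT_comp.
have mqE : measurable_fun setT (fun x => `|(q x)%:E|)%E.
  by apply: measurableT_comp => //; exact/measurable_EFinP.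
have := @ge0_integral_distribution _ _ _ _ _ P X' (fun x => `|(q x)%:E|)%E mqE (fun=> abse_ge0 _).
rewrite /comp => <-.
have -> : (\int[distribution P X']_x `|(q x)%:E| = \int[distribution P X]_x `|(q x)%:E|)%E.
  by apply: eq_measure_integral => A mA _; apply/esym/lXX.
exact: iX.
Qed.

Lemma same_law_Ex (q : R -> R) : measurable_fun [set: R] q ->
  integ P (fun w => q (X w)) -> Ex P (fun w => q (X w)) = Ex P (fun w => q (X' w)).
Proof.
move=> mq iq; have iq' := same_law_integ mq iq.
rewrite -[LHS](@Ex_distribution _ _ _ P _ _ X q mq iq).
by rewrite -[RHS](@Ex_distribution _ _ _ P _ _ X' q mq iq'); exact: Ex_law.
Qed.

End same_law.

Section lindeberg_limits.
Context (R : realType) d (T : measurableType d) (P : probability T R).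
Notation gamma := (normal_prob (0 : R) 1).
Variables (X : nat -> T -> R) (tau : R).
Hypotheses (tau0 : 0 <= tau) (mX : forall i, measurable_fun [set: T] (X i))
  (iX2 : forall i, integ P (fun w => X i w ^+ 2)) (EX : forall i, Ex P (X i) = 0)
  (EX2 : forall i, Ex P (fun w => X i w ^+ 2) = tau ^+ 2)
  (Xtrunc : forall i t, 0 <= t -> Ex P (trunc_sqr (X i) t) = Ex P (trunc_sqr (X 0%N) t))
  (indX : forall (c : nat -> R) m, independent_pair P (fun w => \sum_(j < m) c j * X j w) (X m)).

Definition lindeberg_modulus (t : R) : R :=
  Ex P (trunc_sqr (X 0%N) t) + Ex gamma (trunc_sqr (fun z => tau * z) t).

Let mtau : measurable_fun [set: R] (fun z : R => tau * z).
Proof. exact: measurable_funM. Qed.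

Let itau : integ gamma (fun z => (tau * z) ^+ 2).
Proof.
have [gi _] := gauss_sqr R.
by apply: (integ_ext _ (integZ (tau ^+ 2) gi)) => z; rewrite exprMn.
Qed.

Lemma lindeberg_modulus_mono t t' : 0 <= t -> t <= t' ->
  lindeberg_modulus t <= lindeberg_modulus t'.
Proof.
move=> t0 tt'; apply: lerD; first exact: trunc_sqr_mono.
exact: (@trunc_sqr_mono _ _ _ gamma _ mtau itau).
Qed.

Lemma lindeberg_modulus_ge0 t : 0 <= t -> 0 <= lindeberg_modulus t.
Proof. by move=> t0; apply: addr_ge0; apply: Ex_ge0 => w; exact: trunc_sqr_ge0. Qed.

Lemma lindeberg_modulus_cvg (t : nat -> R) : (forall n, 0 <= t n) ->
  t n @[n --> \oo] --> 0 -> lindeberg_modulus (t n) @[n --> \oo] --> 0.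
Proof.
move=> t0 tc; rewrite -[X in _ --> X]addr0; apply: cvgD.
  exact: trunc_sqr_cvg.
exact: (@trunc_sqr_cvg _ _ _ gamma _ mtau itau).
Qed.

Lemma lindeberg_uniform (phi : R -> R) : smooth_bounded phi -> exists2 L, 0 <= L &
  forall (c : nat -> R) (m : nat) (cmax : R),
  (forall j, (j < m)%N -> `|c j| <= cmax) ->
  `|Ex P (fun w => phi (\sum_(j < m) c j * X j w)) -
    Ex gamma (fun z => phi (tau * Num.sqrt (\sum_(j < m) c j ^+ 2) * z))| <=
  L * (\sum_(j < m) c j ^+ 2) * lindeberg_modulus cmax.
Proof.
move=> [cphi [M phiM] [L [a [b tay]]]].
have L0 : 0 <= L.
  by have := le_trans (normr_ge0 _) (tay 0 1); rewrite expr1n mul1r normr1 minxx mulr1.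
exists L => // c m cmax cm.
have := @lindeberg_bound R phi M L a b cphi phiM tay d T P X c tau _ tau0 mX iX2 EX EX2
   Xtrunc (indX c) m 0.
under [X in `|X - _|]Ex_ext do rewrite add0r.
under [X in `|_ - X|]Ex_ext do rewrite add0r.
move=> /le_trans; apply; rewrite -mulrA ler_wpM2l// mulr_suml.
apply: ler_sum => j _; rewrite ler_wpM2l ?sqr_ge0//.
by apply: lindeberg_modulus_mono => //; exact: cm.
Qed.

Lemma lindeberg_clt (c : nat -> nat -> R) (m : nat -> nat) (cmax : nat -> R)
    (g : R -> R) (M : R) :
  (forall n, 0 <= cmax n) ->
  (forall n j, (j < m n)%N -> `|c n j| <= cmax n) -> cmax n @[n --> \oo] --> 0 ->
  (\sum_(j < m n) c n j ^+ 2) @[n --> \oo] --> (1 : R) ->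
  continuous g -> (forall x, `|g x| <= M) ->
  Ex P (fun w => g (\sum_(j < m n) c n j * X j w)) @[n --> \oo] -->
  Ex gamma (fun z => g (tau * z)).
Proof.
move=> cmax0 ccmax cmaxc c2 cg gM.
apply: (@smooth_test_functions _ _ _ P _ _ gamma
  (fun n w => \sum_(j < m n) c n j * X j w) (fun z => tau * z) _ mtau _ g M cg gM) => [n|phi sphi].
  by apply: measurable_sum => j; exact: measurable_funM.
have [L L0 HL] := lindeberg_uniform sphi.
have [cphi [Mphi phiM] _] := sphi.
have mphi := smooth_bounded_measurable sphi.
pose s n := Num.sqrt (\sum_(j < m n) c n j ^+ 2).
have sc : s n @[n --> \oo] --> (1 : R).
  by rewrite -[X in _ --> X]sqrtr1; apply: continuous_cvg => //; exact: sqrt_continuous.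
have D1 : Ex P (fun w => phi (\sum_(j < m n) c n j * X j w)) -
    Ex gamma (fun z => phi (tau * s n * z)) @[n --> \oo] --> 0.
  apply/norm_cvg0P.
  apply: (@squeeze_cvgr _ _ _ _ (cst 0)
    (fun n => L * (\sum_(j < m n) c n j ^+ 2) * lindeberg_modulus (cmax n))).
  - by apply: nearW => n; rewrite normr_ge0/=; apply: HL => j; exact: ccmax.
  - exact: cvg_cst.
  - rewrite -[X in _ --> X](mulr0 (L * 1)); apply: cvgM.
      by apply: cvgM => //; exact: cvg_cst.
    exact: lindeberg_modulus_cvg.
have D2 : Ex gamma (fun z => phi (tau * s n * z)) @[n --> \oo] --> Ex gamma (fun z => phi (tau * z)).
  apply: (@Ex_dct _ _ _ gamma (fun n z => phi (tau * s n * z)) (fun z => phi (tau * z))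
    (fun=> Mphi) _ _ _ _ _).2 => //.
  - by move=> n; apply: measurableT_comp => //; exact: measurable_funM.
  - exact: measurableT_comp.
  - move=> z; apply: continuous_cvg; first exact: cphi.
    have : tau * s n * z @[n --> \oo] --> tau * 1 * z.
      by apply: cvgM; [apply: cvgM => //|]; exact: cvg_cst.
    by rewrite mulr1.
  - exact: integ_cst.
have D3 := cvgD D1 D2; rewrite add0r in D3.
have E : (fun n => Ex P (phi \o (fun w => \sum_(j < m n) c n j * X j w))) =
    (fun n => (Ex P (fun w => phi (\sum_(j < m n) c n j * X j w)) -
      Ex gamma (fun z => phi (tau * s n * z))) + Ex gamma (fun z => phi (tau * s n * z))).
  by apply/funext => n; rewrite subrK.
by rewrite E; exact: D3.
Qed.

End lindeberg_limits.

(** * Products of independent factors *)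

Section gaussian_average.
Context (R : realType).
Notation gamma := (normal_prob (0 : R) 1).
Variables (g : R -> R) (M : R).
Hypotheses (cg : continuous g) (gM : forall x, `|g x| <= M).

Let mg : measurable_fun [set: R] g.
Proof. exact: continuous_measurable_fun. Qed.

(** The limit of the mean of [g (t S)] at a fixed scale [t]; the scale later becomes [k / Y] or
    [k sg(Y)]. *)
Definition gauss_avg (t : R) : R := Ex gamma (fun z => g (t * z)).

Lemma gauss_avg_integ t : integ gamma (fun z => g (t * z)).
Proof.
apply: (@integ_bounded _ _ _ gamma (fun z => g (t * z)) M) => //.
by apply: measurableT_comp => //; exact: measurable_funM.
Qed.

Lemma gauss_avg_bound t : `|gauss_avg t| <= M.
Proof. by apply: Ex_bound => //; exact: integ_meas (gauss_avg_integ t). Qed.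

Lemma gauss_avgN t : gauss_avg (- t) = gauss_avg t.
Proof.
have cgt (u : R) : continuous (fun z : R => g (u * z) + M).
  move=> z; apply: cvgD; last exact: cvg_cst.
  by apply: continuous_comp; [apply: cvgMr; exact: cvg_id|exact: cg].
have p0 z : 0 <= g (t * z) + M by have := gM (t * z); rewrite ler_norml => /andP[]; lra.
have E := gauss_reflect (cgt t) p0.
have D u : gauss_avg u + M = Ex gamma (fun z => g (u * z) + M).
  by rewrite ExD ?Ex_cst//; [exact: gauss_avg_integ|exact: integ_cst].
apply: (addIr M); rewrite !D.
rewrite /Ex; congr fine; apply: etrans (esym E); apply: eq_integral => z _.
by rewrite mulrN mulNr.
Qed.

Lemma gauss_avg_norm t : gauss_avg `|t| = gauss_avg t.
Proof.
have [t0|t0] := leP 0 t; first by rewrite ger0_norm.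
by rewrite ltr0_norm// gauss_avgN.
Qed.

End gaussian_average.

Section gaussian_average_continuity.
Context (R : realType).
Notation gamma := (normal_prob (0 : R) 1).

Lemma gauss_avg_continuous (g : R -> R) : smooth_bounded g -> continuous (gauss_avg g).
Proof.
move=> sg t; have [l l0 lip] := smooth_bounded_lipschitz sg.
have [cg [M gM] _] := sg.
pose m := Ex gamma (fun z => `|z|).
have im : integ gamma (fun z => `|z|) by exact/integ_norm/gauss_id.
have m0 : 0 <= m by exact: Ex_ge0.
apply/cvgrPdist_le => e e0.
have d0 : 0 < e / (l * m + 1) by rewrite divr_gt0// ltr_wpDl// mulr_ge0// ltW.
near=> u.
have tu : `|t - u| <= e / (l * m + 1) by near: u; exact: cvgr_dist_le.
rewrite /gauss_avg -ExB; try exact: gauss_avg_integ gM _.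
apply: (@le_trans _ _ (Ex gamma (fun z => l * `|t - u| * `|z|))).
  apply: Ex_norm_le.
  - by apply: integB; exact: gauss_avg_integ gM _.
  - exact: integZ.
  - by move=> z; rewrite (le_trans (lip _ _))// -mulrBl normrM mulrA.
rewrite ExZ// -/m mulrAC; have lm0 : 0 <= l * m by rewrite mulr_ge0// ltW.
apply: (@le_trans _ _ ((l * m + 1) * (e / (l * m + 1)))).
  by rewrite ler_pM//; lra.
by rewrite mulrC divfK// gt_eqF// ltr_wpDl.
Unshelve. all: by end_near. Qed.

End gaussian_average_continuity.

(** * A continuous weight that detects closeness to 0 *)

Section mixture.
Context (R : realType) d (T : measurableType d) (P : probability T R).
Notation gamma := (normal_prob (0 : R) 1).

(** For [c > 0], a bounded continuous substitute for the indicator of [|y| < c]: it is 1 at 0, at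
    least one half for [|y| < c], and vanishes as [c] tends to 0 with [y != 0] fixed. *)
Definition near0_weight (c y : R) : R := c ^+ 2 / (c ^+ 2 + y ^+ 2).

Lemma near0_weight_itv c y : 0 <= near0_weight c y <= 1.
Proof.
have h : 0 <= c ^+ 2 <= c ^+ 2 + y ^+ 2 by rewrite sqr_ge0 lerDl sqr_ge0.
move: h; rewrite /near0_weight => /andP[h0 h1].
rewrite divr_ge0 ?(le_trans h0)//=.
have [->|n0] := eqVneq (c ^+ 2 + y ^+ 2) 0; first by rewrite invr0 mulr0.
by rewrite ler_pdivrMr ?mul1r// lt_def n0 (le_trans h0).
Qed.

Lemma near0_weight_norm c y : `|near0_weight c y| <= 1.
Proof. by have /andP[h0 h1] := near0_weight_itv c y; rewrite ger0_norm. Qed.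

Lemma near0_weight_ge c y : 0 < c -> `|y| < c -> 2^-1 <= near0_weight c y.
Proof.
move=> c0 yc; have c20 : 0 < c ^+ 2 by rewrite exprn_gt0.
have y2 : y ^+ 2 <= c ^+ 2.
  by rewrite -[y ^+ 2]real_normK ?num_real// ler_sqr ?nnegrE ?(ltW c0)// ltW.
by rewrite /near0_weight ler_pdivlMr ?ltr_pwDl ?sqr_ge0//; nra.
Qed.

Lemma near0_weight_continuous c : 0 < c -> continuous (near0_weight c).
Proof.
move=> c0 y; have c20 : 0 < c ^+ 2 by rewrite exprn_gt0.
apply: cvgMr; apply: cvgV.
  by rewrite gt_eqF// ltr_pwDl// sqr_ge0.
by apply: cvgD; [exact: cvg_cst|exact: exprn_continuous].
Qed.

Lemma near0_weight_cvg0 y : y != 0 -> near0_weight (n.+1%:R^-1) y @[n --> \oo] --> (0 : R).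
Proof.
move=> y0; have h : (fun n => (n.+1%:R^-1 : R) ^+ 2) @ \oo --> (0 : R).
  rewrite -[X in _ --> X](mulr0 0); under eq_fun do rewrite expr2.
  by apply: cvgM; exact: cvg_harmonic.
rewrite -[X in _ --> X](mul0r ((0 + y ^+ 2)^-1)).
apply: cvgM => //; apply: cvgV; first by rewrite add0r expf_neq0.
by apply: cvgD => //; exact: cvg_cst.
Qed.

(** As [c] decreases to 0 the weights converge to the indicator of the point 0, which the normal law
    does not charge. *)
Lemma gauss_near0_small (sigma e : R) : 0 < sigma -> 0 < e ->
  exists2 c, 0 < c & Ex gamma (fun z => near0_weight c (sigma * z)) <= e.
Proof.
move=> s0 e0.
have m0 : @measurable _ (measurableTypeR R) [set (0 : R)] by exact: (@measurable_set1 R).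
have g0 : Ex gamma (\1_[set 0] : R -> R) = 0.
  by rewrite (Ex_indic gamma m0) [X in fine X](_ : _ = 0%E)//; exact: integral_set1.
have mw c : 0 < c -> measurable_fun setT (fun z => near0_weight c (sigma * z)).
  move=> c0; apply: measurableT_comp; last exact: measurable_funM.
  by apply: continuous_measurable_fun; exact: near0_weight_continuous.
have mwn n : measurable_fun setT (fun z => near0_weight (n.+1%:R^-1) (sigma * z)).
  by apply: mw; rewrite invr_gt0.
have mi : measurable_fun [set: R] (\1_[set (0 : R)] : R -> R) by exact: measurable_indic.
have cw z : near0_weight (n.+1%:R^-1) (sigma * z) @[n --> \oo] --> (\1_[set 0] z : R).
  rewrite indicE; have [->|z0] := eqVneq z 0.
    rewrite mem_set// (_ : (fun n => _) = fun=> 1); first exact: cvg_cst.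
    apply/funext => n; rewrite /near0_weight mulr0 expr0n addr0.
    by apply: divff; rewrite expf_eq0 /= invr_eq0 pnatr_eq0.
  rewrite memNset; last by move=> /= zE; rewrite zE eqxx in z0.
  by apply: near0_weight_cvg0; rewrite mulf_neq0// gt_eqF.
have [_] := @Ex_dct _ _ _ gamma (fun n z => near0_weight (n.+1%:R^-1) (sigma * z))
  (\1_[set 0] : R -> R) (fun=> 1) mwn mi
  cw (integ_cst _ _) (fun n z => near0_weight_norm _ _).
rewrite g0 => /cvgrPdist_le /(_ e e0) H.
near \oo => n; exists (n.+1%:R^-1) => //.
have : `|0 - Ex gamma (fun z => near0_weight (n.+1%:R^-1) (sigma * z))| <= e by near: n; exact: H.
rewrite sub0r normrN => h; exact: (le_trans (ler_norm _) h).
Unshelve. all: by end_near. Qed.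

End mixture.

Lemma invr_sqrt_cvg0 (R : realType) : (Num.sqrt n%:R)^-1 @[n --> \oo] --> (0 : R).
Proof.
apply/cvgrPdist_le => e e0; near=> n.
have en : (e ^+ 2)^-1 <= n%:R by near: n; exact: nbhs_infty_ger.
rewrite sub0r normrN ger0_norm ?invr_ge0 ?sqrtr_ge0//.
have n0 : 0 < n%:R :> R by rewrite (lt_le_trans _ en)// invr_gt0 exprn_gt0.
rewrite invf_ple ?posrE ?sqrtr_gt0//.
rewrite -(@ler_sqr R) ?nnegrE ?sqrtr_ge0 ?invr_ge0 ?(ltW e0)//.
by rewrite exprVn sqr_sqrtr ?(ltW n0).
Unshelve. all: by end_near. Qed.

Section product_limits.
Context (R : realType) d (T : measurableType d) (P : probability T R).
Notation gamma := (normal_prob (0 : R) 1).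
Variables (X : nat -> T -> R).
Hypotheses (mX : forall i, measurable_fun [set: T] (X i))
  (iX2 : forall i, integ P (fun w => X i w ^+ 2)) (EX : forall i, Ex P (X i) = 0)
  (EX2 : forall i, Ex P (fun w => X i w ^+ 2) = 1)
  (Xtrunc : forall i (t : R), 0 <= t -> Ex P (trunc_sqr (X i) t) = Ex P (trunc_sqr (X 0%N) t))
  (indX : forall (c : nat -> R) m, independent_pair P (fun w => \sum_(j < m) c j * X j w) (X m)).

Definition norm_sum (n : nat) (w : T) : R := \sum_(j < n) (Num.sqrt n%:R)^-1 * X j w.

Variables (Y : nat -> T -> R) (sigma : R).
Hypotheses (sigma0 : 0 < sigma) (mY : forall n, measurable_fun [set: T] (Y n))
  (indYS : forall n, independent_pair P (Y n) (norm_sum n))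
  (Ycvg : forall (g : R -> R) (M : R), continuous g -> (forall x, `|g x| <= M) ->
    Ex P (fun w => g (Y n w)) @[n --> \oo] --> Ex gamma (fun z => g (sigma * z))).

Lemma norm_sum_meas n : measurable_fun [set: T] (norm_sum n).
Proof. by apply: measurable_sum => j; exact: measurable_funM. Qed.

Lemma near0_weight_integ (c : R) n : 0 < c -> integ P (fun w => near0_weight c (Y n w)).
Proof.
move=> c0; apply: (@integ_bounded _ _ _ _ _ 1) => [|w]; last exact: near0_weight_norm.
apply: measurableT_comp => //; apply: continuous_measurable_fun.
exact: near0_weight_continuous.
Qed.

(** The weight is an admissible test function in [Ycvg], so the absence of mass near 0 passes from
    the limit to [Y n]. *)
Lemma eventually_near0_small (e : R) : 0 < e -> exists2 c, 0 < c &
  Ex gamma (fun z => near0_weight c (sigma * z)) <= e /\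
  \forall n \near \oo, Ex P (fun w => near0_weight c (Y n w)) <= 2 * e.
Proof.
move=> e0; have [c c0 hc] := gauss_near0_small sigma0 e0; exists c => //; split => //.
have := Ycvg (near0_weight_continuous c0) (near0_weight_norm c).
move=> /cvgrPdist_le /(_ e e0); apply: filterS => n.
by rewrite ler_norml => /andP[h _]; lra.
Qed.

Section mixture_limit.
Variables (r B : R -> R) (g : R -> R).
Hypotheses (mr : measurable_fun [set: R] r)
  (rB : forall c y : R, 0 < c -> c <= `|y| -> `|r y| <= B c) (sg : smooth_bounded g).

Lemma mixture_integ n : integ P (fun w => gauss_avg g (r (Y n w))).
Proof.
have [cg [M gM] _] := sg.
apply: (@integ_bounded _ _ _ _ _ M) => [|w]; last exact: gauss_avg_bound.
have mg := continuous_measurable_fun (gauss_avg_continuous sg).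
by apply: (measurableT_comp mg); exact: measurableT_comp.
Qed.

(** By independence [Y n] is frozen at [y]. For [|y| >= c] the weights [r y / sqrt n] are at most
    [B c / sqrt n], and the normal approximation of [norm_sum] is uniform in [y]; smaller values of
    [y] are rarely taken. *)
Lemma mixture_limit :
  Ex P (fun w => g (r (Y n w) * norm_sum n w)) - Ex P (fun w => gauss_avg g (r (Y n w)))
    @[n --> \oo] --> 0.
Proof.
have [cg [M gM] _] := sg.
have M0 : 0 <= M := le_trans (normr_ge0 _) (gM 0).
have mg : measurable_fun setT g by exact: continuous_measurable_fun.
have EX2' i : Ex P (fun w => X i w ^+ 2) = 1 ^+ 2 by rewrite expr1n.
have [L L0 HL] := lindeberg_uniform ler01 mX iX2 EX EX2' Xtrunc indX sg.
pose md := lindeberg_modulus P X 1.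
apply/cvgrPdist_le => e0 e00.
pose e := e0 / (1 + 8 * M); have e1 : 0 < e by rewrite divr_gt0//; lra.
have eE : (1 + 8 * M) * e = e0 by rewrite /e mulrC divfK//; apply: lt0r_neq0; lra.
have [c c0 [_ hc]] := eventually_near0_small e1.
have Bc0 : 0 <= B c.
  by apply: le_trans (normr_ge0 _) (rB (y := c) c0 _); rewrite ger0_norm// ltW.
have inv0 (n : nat) : 0 <= B c * (Num.sqrt n%:R)^-1 by rewrite mulr_ge0// invr_ge0 sqrtr_ge0.
have mc : L * B c ^+ 2 * md (B c * (Num.sqrt n%:R)^-1) @[n --> \oo] --> 0.
  rewrite -[X in _ --> X](mulr0 (L * B c ^+ 2)); apply: cvgMr.
  apply: (lindeberg_modulus_cvg 1 mX iX2) => //.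
  rewrite -[X in _ --> X](mulr0 (B c)); apply: cvgMr.
  exact: invr_sqrt_cvg0.
have mrs : measurable_fun [set: R * R] (fun ys => g (r ys.1 * ys.2)).
  by apply: measurableT_comp => //; apply: measurable_funM => //; exact: measurableT_comp.
have inner n w : integ P (fun w' => g (r (Y n w) * norm_sum n w')).
  apply: (@integ_bounded _ _ _ _ _ M) => // .
  by apply: measurableT_comp => //; apply: measurable_funM => //; exact: norm_sum_meas.
have outer n : integ P (fun w => g (r (Y n w) * norm_sum n w)).
  apply: (@integ_bounded _ _ _ _ _ M) => //; apply: measurableT_comp => //.
  by apply: measurable_funM; [exact: measurableT_comp|exact: norm_sum_meas].
near=> n.
have n0 : (0 < n)%N by near: n; exact: nbhs_infty_gt.
have nR : 0 < n%:R :> R by rewrite ltr0n.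
have [j1 E1] := @indep_Ex _ _ _ P _ _ _ _ (Y n) (norm_sum n) (mY n) (norm_sum_meas n)
  (indYS n) (fun ys => g (r ys.1 * ys.2)) mrs (outer n) (inner n).
(* For [|y| < c] both terms are bounded by [M], and [2 M <= 4 M near0_weight c y] because the weight
   is at least one half there. *)
have pt y : `|Ex P (fun w' => g (r y * norm_sum n w')) - gauss_avg g (r y)| <=
    L * B c ^+ 2 * md (B c * (Num.sqrt n%:R)^-1) + 4 * M * near0_weight c y.
  have w0 : 0 <= near0_weight c y by have /andP[] := near0_weight_itv c y.
  have m0 : 0 <= md (B c * (Num.sqrt n%:R)^-1) by exact: (lindeberg_modulus_ge0 P X 1 (inv0 n)).
  have [cy|yc] := leP c `|y|.
    apply: (@le_trans _ _ (L * B c ^+ 2 * md (B c * (Num.sqrt n%:R)^-1))); last first.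
      by rewrite lerDl; apply: mulr_ge0 => //; apply: mulr_ge0.
    have := HL (fun=> r y * (Num.sqrt n%:R)^-1) n (B c * (Num.sqrt n%:R)^-1).
    have s2 : \sum_(j < n) (r y * (Num.sqrt n%:R)^-1) ^+ 2 = r y ^+ 2.
      rewrite sumr_const card_ord exprMn exprVn sqr_sqrtr ?ltW//.
      by rewrite -[LHS]mulr_natr mulfVK// gt_eqF.
    rewrite s2 sqrtr_sqr mul1r.
    have -> : Ex gamma (fun z => g (`|r y| * z)) = gauss_avg g (r y).
      exact: (gauss_avg_norm cg gM).
    have -> : Ex P (fun w => g (\sum_(j < n) r y / Num.sqrt n%:R * X j w)) =
        Ex P (fun w' => g (r y * norm_sum n w')).
      apply: Ex_ext => w; rewrite /norm_sum mulr_sumr.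
      by congr g; apply: eq_bigr => j _; rewrite mulrA.
    move=> h; apply: (le_trans (h _)) => [j _|].
      rewrite normrM [X in _ * X]ger0_norm ?invr_ge0 ?sqrtr_ge0//.
      by rewrite ler_wpM2r ?invr_ge0 ?sqrtr_ge0// rB.
    rewrite ler_wpM2r// ler_wpM2l// -[r y ^+ 2]real_normK ?num_real//.
    by rewrite ler_sqr ?nnegrE// rB.
  have h1 : `|Ex P (fun w' => g (r y * norm_sum n w'))| <= M.
    apply: Ex_bound => //; apply: measurableT_comp => //.
    by apply: measurable_funM => //; exact: norm_sum_meas.
  have h2 := gauss_avg_bound cg gM (r y).
  have h3 := near0_weight_ge c0 yc.
  rewrite (le_trans (ler_normB _ _))//.
  apply: (@le_trans _ _ (4 * M * near0_weight c y)); first by nra.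
  by rewrite lerDr !mulr_ge0// sqr_ge0.
rewrite sub0r normrN E1 -ExB//; last exact: mixture_integ.
apply: (@le_trans _ _ (Ex P (fun w => L * B c ^+ 2 * md (B c * (Num.sqrt n%:R)^-1) +
   4 * M * near0_weight c (Y n w)))).
  apply: Ex_norm_le => //.
  - by apply: integB => //; exact: mixture_integ.
  - by apply: integD; [exact: integ_cst|exact/integZ/near0_weight_integ].
  - by move=> w; exact: pt.
rewrite ExD; [|exact: integ_cst|exact/integZ/near0_weight_integ].
rewrite Ex_cst ExZ; last exact: near0_weight_integ.
have a1 : Ex P (fun w => near0_weight c (Y n w)) <= 2 * e by near: n; exact: hc.
have : `|0 - L * B c ^+ 2 * md (B c * (Num.sqrt n%:R)^-1)| <= e.
  by near: n; exact: (cvgrPdist_le _ _).1 mc _ e1.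
rewrite sub0r normrN => /(le_trans (ler_norm _)) a2.
have a3 : 4 * M * Ex P (fun w => near0_weight c (Y n w)) <= 4 * M * (2 * e).
  by rewrite ler_wpM2l// mulr_ge0.
by rewrite -eE; lra.
Unshelve. all: by end_near. Qed.

End mixture_limit.
End product_limits.

Section weighted_limits.
Context (R : realType) d (T : measurableType d) (P : probability T R).
Notation gamma := (normal_prob (0 : R) 1).
Variables (Y : nat -> T -> R) (sigma : R).
Hypotheses (sigma0 : 0 < sigma) (mY : forall n, measurable_fun [set: T] (Y n))
  (Ycvg : forall (g : R -> R) (M : R), continuous g -> (forall x, `|g x| <= M) ->
    Ex P (fun w => g (Y n w)) @[n --> \oo] --> Ex gamma (fun z => g (sigma * z))).

(* H need not be continuous at 0: the weight cuts off a neighbourhood of 0 that Y rarely visits. *)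
Lemma away_from0_limit (H : R -> R) (M : R) : measurable_fun [set: R] H ->
  (forall y, y != 0 -> {for y, continuous H}) -> (forall y, `|H y| <= M) ->
  Ex P (fun w => H (Y n w)) @[n --> \oo] --> Ex gamma (fun z => H (sigma * z)).
Proof.
move=> mH cH HM; have M0 : 0 <= M := le_trans (normr_ge0 _) (HM 0).
apply/cvgrPdist_le => e0 e00.
pose e := e0 / (1 + 3 * M); have e1 : 0 < e by rewrite divr_gt0//; lra.
have eE : (1 + 3 * M) * e = e0 by rewrite /e mulrC divfK//; apply: lt0r_neq0; lra.
have [c c0 [hg hc]] := eventually_near0_small sigma0 Ycvg e1.
pose G y := (1 - near0_weight c y) * H y.
have w01 y : 0 <= 1 - near0_weight c y <= 1 /\ 0 <= near0_weight c y.
  by have /andP[? ?] := near0_weight_itv c y; split; lra.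
have GM y : `|G y| <= M.
  have [/andP[a b] _] := w01 y; rewrite normrM (ger0_norm a).
  by apply: (@le_trans _ _ (1 * M)); [exact: ler_pM|rewrite mul1r].
have cw := near0_weight_continuous c0.
have cG : continuous G.
  move=> y; have [->|y0] := eqVneq y 0; last first.
    by apply: cvgM; [apply: cvgB; [exact: cvg_cst|exact: cw]|exact: cH].
  have w0 : near0_weight c 0 = 1.
    by rewrite /near0_weight expr0n addr0 divff// expf_neq0// gt_eqF.
  have G0 : G 0 = 0 by rewrite /G w0 subrr mul0r.
  rewrite /continuous_at G0.
  have h : M * (1 - near0_weight c y) @[y --> nbhs (0 : R)] --> (0 : R).
    rewrite -[X in _ --> X](mulr0 M); apply: cvgMr.
    have cw0 : near0_weight c y @[y --> nbhs (0 : R)] --> (1 : R) by rewrite -w0; exact: cw.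
    by rewrite -[X in _ --> X](subrr 1); apply: cvgB => //; exact: cvg_cst.
  apply/cvgrPdist_le => u u0.
  move/cvgrPdist_le : h => /(_ u u0); apply: filterS => z.
  rewrite !sub0r !normrN; have [/andP[a b] _] := w01 z.
  move=> h; apply: le_trans h; rewrite !normrM (ger0_norm a) (ger0_norm M0) mulrC.
  by rewrite ler_wpM2r.
have HG y : `|H y - G y| <= M * near0_weight c y.
  have [_ b] := w01 y; have -> : H y - G y = H y * near0_weight c y by rewrite /G; ring.
  by rewrite normrM (ger0_norm b) ler_wpM2r.
have mG := continuous_measurable_fun cG.
have mwc := continuous_measurable_fun cw.
have key d' (T' : measurableType d') (Q : probability T' R) (Z : T' -> R) :
    measurable_fun setT Z -> `|Ex Q (fun w => H (Z w)) - Ex Q (fun w => G (Z w))| <=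
    M * Ex Q (fun w => near0_weight c (Z w)).
  move=> mZ.
  have i1 : integ Q (fun w => H (Z w)).
    by apply: (@integ_bounded _ _ _ _ _ M) => //; exact: (measurableT_comp mH mZ).
  have i2 : integ Q (fun w => G (Z w)).
    by apply: (@integ_bounded _ _ _ _ _ M) => //; exact: (measurableT_comp mG mZ).
  have i3 : integ Q (fun w => near0_weight c (Z w)).
    apply: (@integ_bounded _ _ _ _ _ 1) => [|w]; last exact: near0_weight_norm.
    exact: (measurableT_comp mwc mZ).
  rewrite -ExB// -ExZ//; apply: Ex_norm_le => //; first exact: integB.
  exact: integZ.
have ms : measurable_fun setT (fun z : R => sigma * z) by exact: measurable_funM.
have kg := key _ _ gamma _ ms.
have := Ycvg cG GM => /cvgrPdist_le /(_ e e1) cGn.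
near=> n.
have kn := key _ _ P _ (mY n).
have h1 : Ex P (fun w => near0_weight c (Y n w)) <= 2 * e by near: n; exact: hc.
have h2 : `|Ex gamma (fun z => G (sigma * z)) - Ex P (fun w => G (Y n w))| <= e.
  by near: n; exact: cGn.
have h3 : M * Ex P (fun w => near0_weight c (Y n w)) <= M * (2 * e) by rewrite ler_wpM2l.
have h4 : M * Ex gamma (fun w => near0_weight c (sigma * w)) <= M * e by rewrite ler_wpM2l.
move: (le_trans kg h4) (le_trans kn h3) h2; rewrite -eE.
by rewrite !ler_norml => /andP[? ?] /andP[? ?] /andP[? ?]; apply/andP; split; lra.
Unshelve. all: by end_near. Qed.

End weighted_limits.

Section ratio_limits.
Context (R : realType) d (T : measurableType d) (P : probability T R).
Notation gamma := (normal_prob (0 : R) 1).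
Variables (X : nat -> T -> R).
Hypotheses (mX : forall i, measurable_fun [set: T] (X i))
  (iX2 : forall i, integ P (fun w => X i w ^+ 2)) (EX : forall i, Ex P (X i) = 0)
  (EX2 : forall i, Ex P (fun w => X i w ^+ 2) = 1)
  (Xtrunc : forall i (t : R), 0 <= t -> Ex P (trunc_sqr (X i) t) = Ex P (trunc_sqr (X 0%N) t))
  (indX : forall (c : nat -> R) m, independent_pair P (fun w => \sum_(j < m) c j * X j w) (X m)).
Variables (Y : nat -> T -> R) (sigma : R).
Hypotheses (sigma0 : 0 < sigma) (mY : forall n, measurable_fun [set: T] (Y n))
  (indYS : forall n, independent_pair P (Y n) (norm_sum X n))
  (Ycvg : forall (g : R -> R) (M : R), continuous g -> (forall x, `|g x| <= M) ->
    Ex P (fun w => g (Y n w)) @[n --> \oo] --> Ex gamma (fun z => g (sigma * z))).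
Variables (g : R -> R) (k : R).
Hypothesis sg : smooth_bounded g.

(** The mixture with [r y = k / y], bounded by [|k| / c] away from 0. The remaining function of [y]
    is continuous except at 0, which is exactly what [away_from0_limit] allows. *)
Lemma ratio_limit : Ex P (fun w => g (k / Y n w * norm_sum X n w)) @[n --> \oo] -->
  Ex gamma (fun y => Ex gamma (fun z => g (k / sigma * z / y))).
Proof.
have [cg [M gM] _] := sg.
have mr : measurable_fun [set: R] (fun y : R => k / y).
  by apply: measurable_funM => //; exact: measurable_invr.
have rB (c y : R) : 0 < c -> c <= `|y| -> `|k / y| <= `|k| / c.
  move=> c0 cy; rewrite normrM normfV ler_wpM2l// lef_pV2 ?posrE//.
  exact: lt_le_trans cy.
have h1 := mixture_limit mX iX2 EX EX2 Xtrunc indX sigma0 mY indYS Ycvg mr rB sg.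
have cH := gauss_avg_continuous sg.
have h2 : Ex P (fun w => gauss_avg g (k / Y n w)) @[n --> \oo] -->
    Ex gamma (fun z => gauss_avg g (k / (sigma * z))).
  apply: (away_from0_limit sigma0 mY Ycvg (H := fun y => gauss_avg g (k / y)) (M := M)).
  - exact: (measurableT_comp (continuous_measurable_fun cH) mr).
  - move=> y y0; apply: continuous_comp; last exact: cH.
    by apply: cvgMr; exact: cvgV.
  - by move=> y; exact: gauss_avg_bound.
have -> : Ex gamma (fun y => Ex gamma (fun z => g (k / sigma * z / y))) =
    Ex gamma (fun z => gauss_avg g (k / (sigma * z))).
  apply: Ex_ext => y; apply: Ex_ext => z; congr g.
  by rewrite invfM; ring.
have E : (fun n => Ex P (fun w => g (k / Y n w * norm_sum X n w))) =
    (fun n => Ex P (fun w => g (k / Y n w * norm_sum X n w)) - Ex P (fun w => gauss_avg g (k / Y n w)) +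
      Ex P (fun w => gauss_avg g (k / Y n w))).
  by apply/funext => n; rewrite subrK.
by rewrite E -[X in _ --> X]add0r; exact: (cvgD h1 h2).
Qed.

(** [gauss_avg g] is even, so [k sg(y)] and [k] give the same value for every [y != 0]: an
    independent random sign does not affect a centred normal limit. *)
Lemma sign_limit : Ex P (fun w => g (k * Num.sg (Y n w) * norm_sum X n w)) @[n --> \oo] -->
  gauss_avg g k.
Proof.
have [cg [M gM] _] := sg.
have msg := @measurable_sgr R.
have mr : measurable_fun [set: R] (fun y : R => k * Num.sg y) by exact: measurable_funM.
have rB (c y : R) : 0 < c -> c <= `|y| -> `|k * Num.sg y| <= `|k|.
  move=> c0 cy; rewrite normrM normr_sg (_ : y != 0) ?mulr1//.
  by rewrite -normr_gt0 (lt_le_trans c0).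
have h1 := mixture_limit mX iX2 EX EX2 Xtrunc indX sigma0 mY indYS Ycvg mr rB sg.
have cH := gauss_avg_continuous sg.
have sgE (y : R) : y != 0 -> gauss_avg g (k * Num.sg y) = gauss_avg g k.
  by move=> y0; case: (sgrP y) y0 => [|_|_] //; rewrite ?eqxx// ?mulr1 ?mulrN1 ?(gauss_avgN cg gM).
have h2 : Ex P (fun w => gauss_avg g (k * Num.sg (Y n w))) @[n --> \oo] -->
    Ex gamma (fun z => gauss_avg g (k * Num.sg (sigma * z))).
  apply: (away_from0_limit sigma0 mY Ycvg (H := fun y => gauss_avg g (k * Num.sg y)) (M := M)).
  - exact: (measurableT_comp (continuous_measurable_fun cH) mr).
  - move=> y y0; rewrite /prop_for /continuous_at sgE//.
    apply: cvg_near_cst; near=> z; apply: sgE; near: z.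
      by apply: (cvgr_neq0 y).
  - by move=> y; exact: gauss_avg_bound.
have M0 : 0 <= M := le_trans (normr_ge0 _) (gM 0).
(* The two integrands differ only at [z = 0], where the weight equals 1; so [2 M near0_weight]
   dominates the difference everywhere, and its mean is as small as desired. *)
have -> : gauss_avg g k = Ex gamma (fun z => gauss_avg g (k * Num.sg (sigma * z))).
  have ms : measurable_fun setT (fun z : R => sigma * z) by exact: measurable_funM.
  have iH : integ gamma (fun z => gauss_avg g (k * Num.sg (sigma * z))).
    apply: (@integ_bounded _ _ _ gamma _ M) => [|z]; last exact: gauss_avg_bound.
    exact: (measurableT_comp (measurableT_comp (continuous_measurable_fun cH) mr) ms).
  apply/eqP; rewrite -subr_eq0 -normr_le0; apply/ler_addgt0Pl => e e0.
  have e1 : 0 < e / (2 * M + 1) by rewrite divr_gt0//; lra.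
  have eE : (2 * M + 1) * (e / (2 * M + 1)) = e by rewrite mulrC divfK//; apply: lt0r_neq0; lra.
  have [c c0 hc] := gauss_near0_small sigma0 e1.
  have iw : integ gamma (fun z => near0_weight c (sigma * z)).
    apply: (@integ_bounded _ _ _ gamma _ 1) => [|z]; last exact: near0_weight_norm.
    exact: (measurableT_comp (continuous_measurable_fun (near0_weight_continuous c0)) ms).
  have -> : gauss_avg g k - Ex gamma (fun z => gauss_avg g (k * Num.sg (sigma * z))) =
      Ex gamma (fun z => gauss_avg g k - gauss_avg g (k * Num.sg (sigma * z))).
    by rewrite ExB ?Ex_cst//; exact: integ_cst.
  apply: (@le_trans _ _ (Ex gamma (fun z => 2 * M * near0_weight c (sigma * z)))).
    apply: Ex_norm_le; first by apply: integB => //; exact: integ_cst.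
      exact: integZ.
    move=> z; have [->|z0] := eqVneq z 0.
      rewrite !mulr0 /near0_weight expr0n addr0 divff ?expf_neq0 ?gt_eqF// mulr1.
      apply: (le_trans (ler_normB _ _)).
      by have := gauss_avg_bound cg gM k; have := gauss_avg_bound cg gM (k * Num.sg 0); lra.
    rewrite sgE ?mulf_neq0 ?(gt_eqF sigma0)// subrr normr0 mulr_ge0//; first by rewrite mulr_ge0.
    by have /andP[] := near0_weight_itv c (sigma * z).
  rewrite ExZ//; apply: (@le_trans _ _ (2 * M * (e / (2 * M + 1)))).
    by rewrite ler_wpM2l// mulr_ge0.
  by rewrite addr0 -[leRHS]eE ler_wpM2r ?(ltW e1)// lerDl.
have E : (fun n => Ex P (fun w => g (k * Num.sg (Y n w) * norm_sum X n w))) =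
    (fun n => Ex P (fun w => g (k * Num.sg (Y n w) * norm_sum X n w)) -
      Ex P (fun w => gauss_avg g (k * Num.sg (Y n w))) +
      Ex P (fun w => gauss_avg g (k * Num.sg (Y n w)))).
  by apply/funext => n; rewrite subrK.
by rewrite E -[X in _ --> X]add0r; exact: (cvgD h1 h2).
Unshelve. all: by end_near. Qed.

End ratio_limits.

(** * The LAD score *)

Section orthogonal_sums.
Context d (T : measurableType d) (R : realType) (P : probability T R).
Variable V : nat -> T -> R.
Hypotheses (mV : forall i, measurable_fun [set: T] (V i))
  (iV2 : forall i, integ P (fun w => V i w ^+ 2)).

Lemma integ_sqr_sum n : integ P (fun w => (\sum_(i < n) V i w) ^+ 2).
Proof.
elim: n => [|n IH].
  have -> : (fun w => (\sum_(i < 0) V i w) ^+ 2) = fun=> 0.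
    by apply/funext => w; rewrite big_ord0 expr0n.
  exact: integ_cst.
have -> : (fun w => (\sum_(i < n.+1) V i w) ^+ 2) = fun w => (\sum_(i < n) V i w + V n w) ^+ 2.
  by apply/funext => w; rewrite big_ord_recr.
by apply: integ_sqrD => //; exact: measurable_sum.
Qed.

(** Orthogonality of each term to the preceding partial sum is the only property of martingale
    differences that the Pythagorean identity requires. *)
Hypothesis orth : forall m, Ex P (fun w => (\sum_(i < m) V i w) * V m w) = 0.

Lemma orthogonal_sum_sqr n : integ P (fun w => (\sum_(i < n) V i w) ^+ 2) /\
  Ex P (fun w => (\sum_(i < n) V i w) ^+ 2) = \sum_(i < n) Ex P (fun w => V i w ^+ 2).
Proof.
elim: n => [|n [i2 E2]].
  have E : (fun w => (\sum_(i < 0) V i w) ^+ 2) = fun=> 0.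
    by apply/funext => w; rewrite big_ord0 expr0n.
  by rewrite E big_ord0 Ex_cst; split => //; exact: integ_cst.
have mS : measurable_fun setT (fun w => \sum_(i < n) V i w) by exact: measurable_sum.
have iSV : integ P (fun w => (\sum_(i < n) V i w) * V n w) by exact: integM.
have E : (fun w => (\sum_(i < n.+1) V i w) ^+ 2) =
    (fun w => (\sum_(i < n) V i w) ^+ 2 + (2 * ((\sum_(i < n) V i w) * V n w) + V n w ^+ 2)).
  by apply/funext => w; rewrite big_ord_recr /=; ring.
have i3 : integ P (fun w => 2 * ((\sum_(i < n) V i w) * V n w) + V n w ^+ 2).
  by apply: integD => //; exact: integZ.
rewrite E; split; first exact: integD.
rewrite ExD// ExD//; last exact: integZ.
by rewrite ExZ// orth mulr0 add0r E2 big_ord_recr.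
Qed.

End orthogonal_sums.

Section innovations.
Context d (T : measurableType d) (R : realType) (P : probability T R).
Variables (eps : int -> {RV P >-> R}) (f : R -> R) (L : R).
Hypotheses (ind : mutually_independent eps) (dens : forall i, has_density (eps i) f)
  (med : forall i, is_median (eps i) 0) (L0 : 0 <= L)
  (fL : forall x y, `|f x - f y| <= L * `|x - y|).

(** All negative indices are included, so that the initial value of the autoregression belongs to
    [past 0]. *)
Definition past (m : nat) : set int := [set j | j <= m%:Z].

(** Shifted by one: the loss pairs [y_i] with the innovation of index [i + 1], so the regressor with
    index [i] depends on [past i] and [innov i] is the first innovation after it. *)
Definition innov (m : nat) : T -> R := eps m.+1%:Z.

Definition sg_diff (a e : R) : R := Num.sg e - Num.sg (e - a).

Lemma pastS m m' : (m <= m')%N -> past m `<=` past m'.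
Proof. by move=> mm' j /= jm; apply: (le_trans jm); rewrite lez_nat. Qed.

Lemma past_innov d' (U : measurableType d') (A : T -> U) m :
  block_fun eps (past m) A -> independent_pair P A (innov m).
Proof.
move=> bA; apply: (@block_fun_indep _ _ _ _ _ _ ind _ _ _ _ (past m) [set m.+1%:Z]) => //.
  apply/seteqP; split => // j [/= jm jE]; move: jm; rewrite jE /past /= lez_nat.
  by rewrite ltnn.
exact: block_fun_coord.
Qed.

Lemma innov_past m : block_fun eps (past m.+1) (innov m).
Proof. by apply: block_fun_coord; rewrite /past /=. Qed.

Lemma measurable_innov m : measurable_fun [set: T] (innov m).
Proof. exact: measurable_funPT. Qed.

Lemma sg_diff_norm a e : `|sg_diff a e| <= 2.
Proof.
rewrite (le_trans (ler_normB _ _))//.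
by have := sg_le1 e; have := sg_le1 (e - a); lra.
Qed.

Lemma measurable_sg_diff2 : measurable_fun [set: R * R] (fun z => sg_diff z.1 z.2).
Proof.
apply: measurable_funB; apply: (measurableT_comp (@measurable_sgr R)) => //.
exact: measurable_funB.
Qed.

(** The sign jumps pointwise, but in mean it is Lipschitz in the threshold because the density is
    bounded by [1 + L]. *)
Lemma Ex_sg_diff_lip m a b :
  integ P (fun w => `|sg_diff a (innov m w) - sg_diff b (innov m w)|) /\
  Ex P (fun w => `|sg_diff a (innov m w) - sg_diff b (innov m w)|) <= 2 * (1 + L) * `|a - b|.
Proof.
have E : (fun w => `|sg_diff a (innov m w) - sg_diff b (innov m w)|) =
    (fun w => `|Num.sg (innov m w - a) - Num.sg (innov m w - b)|).
  by apply/funext => w; rewrite -normrN /sg_diff; congr `|_|; ring.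
rewrite E; split; last exact: (Ex_abs_sg_diff (dens m.+1%:Z) L0 fL).
by apply: integ_norm; apply: integB; exact: integ_sg_shift.
Qed.

Lemma Ex_sg_diff_le m a : integ P (fun w => `|sg_diff a (innov m w)|) /\
  Ex P (fun w => `|sg_diff a (innov m w)|) <= 2 * (1 + L) * `|a|.
Proof.
have := Ex_sg_diff_lip m a 0; rewrite subr0.
have -> : (fun w => `|sg_diff a (innov m w) - sg_diff 0 (innov m w)|) =
    (fun w => `|sg_diff a (innov m w)|).
  by apply/funext => w; rewrite {2}/sg_diff subr0 subrr subr0.
by [].
Qed.

Section fixed_n.
Variables (x : nat -> T -> R) (n : nat).
Hypotheses (bx : forall i, block_fun eps (past i) (x i))
  (ix2 : forall i, integ P (fun w => x i w ^+ 2)).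

Let mx i : measurable_fun [set: T] (x i).
Proof. exact: (block_fun_measurable (@bx i)). Qed.

Let bx0 i : block_fun eps (past i) (x 0%N).
Proof. exact: block_funS (pastS (leq0n i)) (@bx 0). Qed.

Lemma block_fun_psum (V : nat -> T -> R) m : (forall i, block_fun eps (past i.+1) (V i)) ->
  block_fun eps (past m) (fun w => \sum_(i < m) V i w).
Proof.
move=> bV; have -> : (fun w => \sum_(i < m) V i w) = fun w => \sum_(i <- iota 0 m)
    (if (i < m)%N then V i w else 0).
  apply/funext => w; rewrite -[m in iota 0 m]subn0 -/(index_iota 0 m) big_mkord.
  by apply: eq_bigr => i _; rewrite ltn_ord.
apply: block_fun_sum => i; case: ltnP => im; last exact: block_fun_cst.
exact: block_funS (pastS im) (@bV i).
Qed.

Let dx i w := x i w - x 0%N w.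

Let bdx i : block_fun eps (past i) (dx i).
Proof. 
have -> : dx i = fun w => x i w + (-1) * x 0%N w by apply/funext => w; rewrite mulN1r.
by apply: block_funD => //; exact: block_funZ.
Qed.

Let mdx i : measurable_fun [set: T] (dx i).
Proof. exact: (block_fun_measurable (@bdx i)). Qed.

Let idx2 i : integ P (fun w => dx i w ^+ 2).
Proof.
apply: integ_sqrD => //; first exact: measurableT_comp.
by apply: (integ_ext _ (ix2 0)) => w; rewrite sqrrN.
Qed.

(** The summands are martingale differences: [x_i - x_0] depends on [past i], while the next sign
    has mean 0 and mean square 1. *)
Lemma score_gap_sqr :
  integ P (fun w => (\sum_(i < n) (x i w - x 0%N w) * Num.sg (innov i w)) ^+ 2) /\
  Ex P (fun w => (\sum_(i < n) (x i w - x 0%N w) * Num.sg (innov i w)) ^+ 2) =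
  \sum_(i < n) Ex P (fun w => (x i w - x 0%N w) ^+ 2).
Proof.
have msg m : measurable_fun setT (fun w => Num.sg (innov m w)).
  by apply: (measurableT_comp (@measurable_sgr R)); exact: measurable_innov.
have isg m : integ P (fun w => Num.sg (innov m w)).
  by apply: (@integ_bounded _ _ _ _ _ 1) => // w; exact: sg_le1.
have isg2 m : integ P (fun w => Num.sg (innov m w) ^+ 2).
  apply: (@integ_bounded _ _ _ _ _ 1) => [|w]; first exact: measurable_funX.
  by rewrite normrX expr_le1 ?sg_le1.
pose V i w := dx i w * Num.sg (innov i w).
have bsg m : block_fun eps (past m.+1) (fun w => Num.sg (innov m w)).
  exact: (block_fun_comp (@measurable_sgr R) (@innov_past m)).
have bV m : block_fun eps (past m.+1) (V m).
  by apply: block_funM => //; exact: block_funS (pastS (leqnSn m)) (@bdx m).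
have mV m : measurable_fun setT (V m) by exact: (block_fun_measurable (@bV m)).
have V2 m : integ P (fun w => V m w ^+ 2) /\
    Ex P (fun w => V m w ^+ 2) = Ex P (fun w => dx m w ^+ 2).
  have i1 : independent_pair P (fun w => dx m w ^+ 2) (fun w => Num.sg (innov m w) ^+ 2).
    have b2 : block_fun eps (past m) (fun w => dx m w ^+ 2).
      by under eq_fun do rewrite expr2; exact: block_funM.
    have := past_innov b2; move=> i S S' mS mS'.
    have m2 : measurable_fun [set: R] (fun e : R => Num.sg e ^+ 2).
      by apply: measurable_funX; exact: measurable_sgr.
    have mS2 : measurable ((fun e : R => Num.sg e ^+ 2) @^-1` S').
      by rewrite -[X in measurable X]setTI; exact: m2.
    exact: (i S _ mS mS2).
  have mi := measurable_funX 2 (mdx m).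
  have ms := measurable_funX 2 (msg m).
  have E : (fun w => V m w ^+ 2) = (fun w => dx m w ^+ 2 * Num.sg (innov m w) ^+ 2).
    by apply/funext => w; rewrite exprMn.
  rewrite E (indep_ExM mi ms i1)// (Ex_sg_sqr (dens m.+1%:Z) L0 fL) mulr1.
  by split => //; exact: (indep_integM mi ms i1).
have orth m : Ex P (fun w => (\sum_(i < m) V i w) * V m w) = 0.
  pose A w := (\sum_(i < m) V i w) * dx m w.
  have bA : block_fun eps (past m) A by apply: block_funM => //; exact: block_fun_psum.
  have mA := block_fun_measurable bA.
  have iAs : independent_pair P A (fun w => Num.sg (innov m w)).
    move=> S S' mS mS'.
    have mS2 : measurable (@Num.sg R @^-1` S').
      by rewrite -[X in measurable X]setTI; exact: measurable_sgr.
    exact: (past_innov bA mS mS2).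
  have -> : Ex P (fun w => (\sum_(i < m) V i w) * V m w) = Ex P (fun w => A w * Num.sg (innov m w)).
    by apply: Ex_ext => w; rewrite /A /V mulrA.
  have iA : integ P A.
    apply: integM => //; first exact: measurable_sum.
    by apply: integ_sqr_sum => // i; case: (V2 i).
  rewrite (indep_ExM mA (msg m) iAs)// [X in _ * X](_ : _ = 0) ?mulr0//.
  exact: (Ex_sg_median (dens m.+1%:Z) L0 fL (med m.+1%:Z)).
have [i E] := orthogonal_sum_sqr mV (fun m => (V2 m).1) orth n.
by split => //; rewrite E; apply: eq_bigr => m _; case: (V2 m).
Qed.
(** It bounds two gaps at once. Both [x^2] and, in mean, [x sg_diff (u x)] have increments of order
    [|a - b| (|a| + |b|)]. *)
Definition spread : R := \sum_(i < n) Ex P (fun w => `|x i w - x 0%N w| * (`|x i w| + `|x 0%N w|)).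

Let ispread i : integ P (fun w => `|x i w - x 0%N w| * (`|x i w| + `|x 0%N w|)).
Proof.
have m1 : measurable_fun setT (fun w => `|dx i w|) by exact: measurableT_comp.
have m2 j : measurable_fun setT (fun w => `|x j w|) by exact: measurableT_comp.
have i2 j : integ P (fun w => `|x j w| ^+ 2).
  by apply: (integ_ext _ (ix2 j)) => w; rewrite real_normK ?num_real.
apply: (integM m1).
- exact: measurable_funD.
- by apply: (integ_ext _ (idx2 i)) => w; rewrite real_normK ?num_real.
- exact: integ_sqrD.
Qed.

Lemma spread_le eta : 0 < eta -> spread <=
  (1 + eta^-1) * (\sum_(i < n) Ex P (fun w => (x i w - x 0%N w) ^+ 2)) +
  eta * (n%:R * Ex P (fun w => x 0%N w ^+ 2)).
Proof.
move=> eta0.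
have -> : n%:R * Ex P (fun w => x 0%N w ^+ 2) = \sum_(i < n) Ex P (fun w => x 0%N w ^+ 2).
  by rewrite sumr_const card_ord mulr_natl.
rewrite !mulr_sumr -big_split /=; apply: ler_sum => i _.
have j1 : integ P (fun w => (1 + eta^-1) * (x i w - x 0%N w) ^+ 2) by exact: integZ (idx2 i).
have j2 : integ P (fun w => eta * x 0%N w ^+ 2) by exact: integZ (ix2 0).
rewrite -ExZ; last exact: idx2.
rewrite -ExZ; last exact: ix2.
rewrite -ExD//; apply: Ex_le => //; first exact: integD.
move=> w; set a := x i w; set b := x 0%N w.
have h1 : `|a| <= `|a - b| + `|b| by rewrite -{1}(subrK b a) ler_normD.
have h2 : (a - b) ^+ 2 = `|a - b| ^+ 2 by rewrite real_normK ?num_real.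
have h3 : b ^+ 2 = `|b| ^+ 2 by rewrite real_normK ?num_real.
(* AM-GM: 2 |a - b| |b| <= (a - b)^2 / eta + eta b^2 *)
have h4 : 2 * (`|a - b| * `|b|) <= eta^-1 * `|a - b| ^+ 2 + eta * `|b| ^+ 2.
  rewrite -subr_ge0.
  have -> : eta^-1 * `|a - b| ^+ 2 + eta * `|b| ^+ 2 - 2 * (`|a - b| * `|b|) =
      eta^-1 * (`|a - b| - eta * `|b|) ^+ 2 by field; rewrite gt_eqF.
  by rewrite mulr_ge0 ?sqr_ge0// invr_ge0 ltW.
rewrite h2 h3; apply: (@le_trans _ _ (`|a - b| * (`|a - b| + 2 * `|b|))).
  by rewrite ler_wpM2l//; lra.
by rewrite mulrDl mul1r; lra.
Qed.

Lemma sqr_gap :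
  integ P (fun w => `|\sum_(i < n) x i w ^+ 2 - n%:R * x 0%N w ^+ 2|) /\
  Ex P (fun w => `|\sum_(i < n) x i w ^+ 2 - n%:R * x 0%N w ^+ 2|) <= spread.
Proof.
have i1 : integ P (fun w => \sum_(i < n) x i w ^+ 2 - n%:R * x 0%N w ^+ 2).
  apply: integB; [apply: (@integ_sum _ _ _ _ 'I_n) => i _; exact: ix2|exact: integZ (ix2 0)].
split; first exact: integ_norm.
rewrite /spread -Ex_sum; last by move=> i _; exact: ispread.
apply: Ex_le; [exact: integ_norm|by apply: (@integ_sum _ _ _ _ 'I_n) => i _; exact: ispread|move=> w].
have -> : n%:R * x 0%N w ^+ 2 = \sum_(i < n) x 0%N w ^+ 2.
  by rewrite sumr_const card_ord mulr_natl.
rewrite -sumrB (le_trans (ler_norm_sum _ _ _))//; apply: ler_sum => i _.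
by rewrite subr_sqr normrM ler_wpM2l// ler_normD.
Qed.

(** With [h] the sign difference, [a h(u a) - b h(u b) = (a - b) h(u a) + b (h(u a) - h(u b))].
    Given the past, the factors involving [h] have mean absolute value of order [|u a|] and
    [|u| |a - b|], so second moments suffice. *)
Lemma linearisation_gap u :
  integ P (fun w => `|\sum_(i < n) (x i w * sg_diff (u * x i w) (innov i w) -
    x 0%N w * sg_diff (u * x 0%N w) (innov i w))|) /\
  Ex P (fun w => `|\sum_(i < n) (x i w * sg_diff (u * x i w) (innov i w) -
    x 0%N w * sg_diff (u * x 0%N w) (innov i w))|) <= 2 * (1 + L) * `|u| * spread.
Proof.
pose psi (z : (R * R) * R) :=
  z.1.1 * sg_diff (u * z.1.1) z.2 - z.1.2 * sg_diff (u * z.1.2) z.2.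
have mpsi : measurable_fun [set: (R * R) * R] psi.
  have m1 : measurable_fun [set: (R * R) * R] (fun z => z.1.1) by exact: measurableT_comp.
  have m2 : measurable_fun [set: (R * R) * R] (fun z => z.1.2) by exact: measurableT_comp.
  have mk (g : (R * R) * R -> R) : measurable_fun setT g ->
      measurable_fun setT (fun z : (R * R) * R => g z * sg_diff (u * g z) z.2).
    move=> mg; apply: measurable_funM => //.
    have mug : measurable_fun setT (fun z => u * g z) by exact: measurable_funM.
    exact: (measurableT_comp measurable_sg_diff2 (measurable_fun_pair mug measurable_snd)).
  by apply: measurable_funB; exact: mk.
have step (i : nat) : integ P (fun w => `|psi ((x i w, x 0%N w), innov i w)|) /\
    Ex P (fun w => `|psi ((x i w, x 0%N w), innov i w)|) <=
    2 * (1 + L) * `|u| * Ex P (fun w => `|x i w - x 0%N w| * (`|x i w| + `|x 0%N w|)).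
  have bp : block_fun eps (past i) (fun w => (x i w, x 0%N w)) by exact: block_fun_pair.
  rewrite -ExZ; last exact: ispread.
  apply: (@indep_Ex_le _ _ _ P _ _ _ _ (fun w => (x i w, x 0%N w)) (innov i)
    (block_fun_measurable bp) (measurable_innov i) (past_innov bp) (fun z => `|psi z|)
    (fun a => 2 * (1 + L) * `|u| * (`|a.1 - a.2| * (`|a.1| + `|a.2|)))) => //.
  - exact: measurableT_comp.
  - exact: integZ (ispread i).
  move=> [a b] /=.
  have [i1 e1] := Ex_sg_diff_le i (u * a).
  have [i2 e2] := Ex_sg_diff_lip i (u * a) (u * b).
  have mi := measurable_innov i.
  have ipsi : integ P (fun w => `|psi (a, b, innov i w)|).
    apply: (@integ_bounded _ _ _ _ _ (2 * `|a| + 2 * `|b|)) => [|w].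
      apply: measurableT_comp => //.
      exact: (measurableT_comp mpsi (measurable_fun_pair (measurable_cst (a, b)) mi)).
    rewrite normr_id /psi /= (le_trans (ler_normB _ _))// !normrM.
    by rewrite lerD// mulrC ler_wpM2r// sg_diff_norm.
  split => //.
  apply: (@le_trans _ _ (Ex P (fun w => `|a - b| * `|sg_diff (u * a) (innov i w)| +
      `|b| * `|sg_diff (u * a) (innov i w) - sg_diff (u * b) (innov i w)|))).
    apply: Ex_le => //; first by apply: integD; exact: integZ.
    move=> w; rewrite -!normrM; apply: le_trans (ler_normD _ _).
    by rewrite le_eqVlt; apply/orP; left; apply/eqP; congr `|_|; rewrite /psi /=; ring.
  rewrite ExD; [|exact: integZ|exact: integZ].
  rewrite ExZ// ExZ//.
  have e3 : `|a - b| * Ex P (fun w => `|sg_diff (u * a) (innov i w)|) <=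
    `|a - b| * (2 * (1 + L) * `|u * a|) by rewrite ler_wpM2l.
  have e4 : `|b| * Ex P (fun w => `|sg_diff (u * a) (innov i w) - sg_diff (u * b) (innov i w)|) <=
    `|b| * (2 * (1 + L) * `|u * a - u * b|) by rewrite ler_wpM2l.
  apply: (le_trans (lerD e3 e4)); rewrite -mulrBr !normrM.
  by rewrite le_eqVlt; apply/orP; left; apply/eqP; ring.
have iabs : integ P (fun w => \sum_(i < n) `|psi ((x i w, x 0%N w), innov i w)|).
  by apply: (@integ_sum _ _ _ _ 'I_n) => i _; case: (step i).
have h (w : T) : `|\sum_(i < n) (x i w * sg_diff (u * x i w) (innov i w) -
    x 0%N w * sg_diff (u * x 0%N w) (innov i w))| <=
    \sum_(i < n) `|psi ((x i w, x 0%N w), innov i w)| by exact: ler_norm_sum.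
have iS : integ P (fun w => `|\sum_(i < n) (x i w * sg_diff (u * x i w) (innov i w) -
    x 0%N w * sg_diff (u * x 0%N w) (innov i w))|).
  apply: (@integ_le _ _ _ _ _ (fun w => \sum_(i < n) `|psi ((x i w, x 0%N w), innov i w)|)) => //.
    apply: measurableT_comp => //; apply: measurable_sum => i.
    exact: (measurableT_comp mpsi
      (measurable_fun_pair (measurable_fun_pair (@mx i) (@mx 0)) (measurable_innov i))).
  by move=> w; rewrite normr_id.
split => //; apply: (le_trans (Ex_le iS iabs h)).
rewrite Ex_sum; last by move=> i _; case: (step i).
by rewrite /spread mulr_sumr; apply: ler_sum => i _; case: (step i).
Qed.

End fixed_n.
End innovations.

(** * The score with a truncated initial regressor *)

Section localized_sums.
Context d (T : measurableType d) (R : realType) (P : probability T R).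
Variables (eps : int -> {RV P >-> R}) (f : R -> R) (L : R).
Hypotheses (ind : mutually_independent eps) (dens : forall i, has_density (eps i) f)
  (L0 : 0 <= L) (fL : forall x y, `|f x - f y| <= L * `|x - y|).

Local Notation innov := (innov eps).

Definition mean_sg_diff (i : nat) (a : R) : R := Ex P (fun w => sg_diff a (innov i w)).

Lemma mean_sg_diff_lin i a : `|mean_sg_diff i a - 2 * f 0 * a| <= 2 * L * a ^+ 2.
Proof. exact: (Ex_sg_increment (dens i.+1%:Z) L0 fL). Qed.

Let mi i := @measurable_innov _ _ _ _ eps i.

Lemma measurable_sg_diff_innov i a : measurable_fun [set: T] (fun w => sg_diff a (innov i w)).
Proof.
exact: (measurableT_comp (@measurable_sg_diff2 R) (measurable_fun_pair (measurable_cst a) (@mi i))).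
Qed.

Lemma measurable_mean_sg_diff i : measurable_fun [set: R] (mean_sg_diff i).
Proof.
apply: (@measurable_Ex _ _ _ _ _ P (fun z : R * T => sg_diff z.1 (innov i z.2)) 2).
  have m2 : measurable_fun [set: R * T] (fun z => innov i z.2).
    exact: (measurableT_comp (@mi i) measurable_snd).
  exact: (measurableT_comp (@measurable_sg_diff2 R) (measurable_fun_pair measurable_fst m2)).
by move=> z; exact: sg_diff_norm.
Qed.

(** The variance is only linear in [|a|]: as [|sg_diff| <= 2], the mean square is at most twice the
    mean absolute value. *)
Lemma centered_sg_diff i a :
  [/\ integ P (fun w => sg_diff a (innov i w) - mean_sg_diff i a),
      integ P (fun w => (sg_diff a (innov i w) - mean_sg_diff i a) ^+ 2),
      Ex P (fun w => sg_diff a (innov i w) - mean_sg_diff i a) = 0 &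
      Ex P (fun w => (sg_diff a (innov i w) - mean_sg_diff i a) ^+ 2) <= 4 * (1 + L) * `|a|].
Proof.
have ms := @measurable_sg_diff_innov i a.
have ih : integ P (fun w => sg_diff a (innov i w)).
  by apply: (@integ_bounded _ _ _ _ _ 2) => // w; exact: sg_diff_norm.
have ih2 : integ P (fun w => sg_diff a (innov i w) ^+ 2).
  apply: (@integ_bounded _ _ _ _ _ (2 ^+ 2)) => [|w]; first exact: measurable_funX.
  by rewrite normrX ler_sqr ?nnegrE ?sg_diff_norm.
have [ia ea] := Ex_sg_diff_le dens L0 fL i a.
have ic : integ P (fun w => mean_sg_diff i a) by exact: integ_cst.
set m := mean_sg_diff i a.
have E : (fun w => (sg_diff a (innov i w) - m) ^+ 2) =
    (fun w => sg_diff a (innov i w) ^+ 2 + (m ^+ 2 + (- 2 * m) * sg_diff a (innov i w))).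
  by apply/funext => w; ring.
have iz : integ P (fun w => (- 2 * m) * sg_diff a (innov i w)) by exact: integZ.
have im : integ P (fun w => m ^+ 2 + (- 2 * m) * sg_diff a (innov i w)).
  by apply: integD => //; exact: integ_cst.
split.
- exact: integB.
- by rewrite E; exact: integD.
- by rewrite ExB// Ex_cst subrr.
rewrite E ExD// ExD//; last exact: integ_cst.
rewrite Ex_cst ExZ// -/(mean_sg_diff i a) -/m.
have h : Ex P (fun w => sg_diff a (innov i w) ^+ 2) <= 2 * (2 * (1 + L) * `|a|).
  apply: (@le_trans _ _ (2 * Ex P (fun w => `|sg_diff a (innov i w)|))); last by rewrite ler_wpM2l.
  rewrite -ExZ//; apply: Ex_le => //; first exact: integZ.
  move=> w; rewrite -[X in X <= _]ger0_norm ?sqr_ge0// normrX expr2.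
  by rewrite ler_wpM2r// sg_diff_norm.
by have := sqr_ge0 m; lra.
Qed.

Variables (xi : T -> R) (b : R) (n : nat).
Hypotheses (bxi : block_fun eps (past 0) xi) (b0 : 0 <= b) (xib : forall w, `|xi w| <= b).

Let mxi : measurable_fun [set: T] xi.
Proof. exact: (block_fun_measurable bxi). Qed.

Let bxim m : block_fun eps (past m) xi.
Proof. exact: (block_funS (pastS (leq0n m)) bxi). Qed.

Variable u : R.

Let psi i (z : R * R) : R := z.1 * (sg_diff (u * z.1) z.2 - mean_sg_diff i (u * z.1)).

Let mpsi i : measurable_fun [set: R * R] (psi i).
Proof.
have mu : measurable_fun [set: R * R] (fun z => u * z.1) by exact: measurable_funM.
apply: measurable_funM => //; apply: measurable_funB.
  exact: (measurableT_comp (@measurable_sg_diff2 R) (measurable_fun_pair mu measurable_snd)).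
exact: (measurableT_comp (@measurable_mean_sg_diff i) mu).
Qed.

Let psi_section i a : integ P (fun w => psi i (a, innov i w)) /\
  Ex P (fun w => psi i (a, innov i w)) = 0.
Proof.
have [i1 _ e1 _] := centered_sg_diff i (u * a).
by split; [exact: integZ|rewrite ExZ// e1 mulr0].
Qed.

Let psi_section2 i a : integ P (fun w => psi i (a, innov i w) ^+ 2) /\
  Ex P (fun w => psi i (a, innov i w) ^+ 2) <= a ^+ 2 * (4 * (1 + L) * `|u * a|).
Proof.
have [_ i2 _ e2] := centered_sg_diff i (u * a).
have E : (fun w => psi i (a, innov i w) ^+ 2) =
    (fun w => a ^+ 2 * (sg_diff (u * a) (innov i w) - mean_sg_diff i (u * a)) ^+ 2).
  by apply/funext => w; rewrite /psi /= exprMn.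
by rewrite E; split; [exact: integZ|rewrite ExZ// ler_wpM2l// sqr_ge0].
Qed.

(** Given [xi], the summands are centred and orthogonal, each with second moment at most of order
    [b^2 |u| b]. With [b = K / sqrt n] the total is of order [1 / sqrt n]. *)
Lemma localized_sum_sqr :
  integ P (fun w => (\sum_(i < n) xi w *
    (sg_diff (u * xi w) (innov i w) - mean_sg_diff i (u * xi w))) ^+ 2) /\
  Ex P (fun w => (\sum_(i < n) xi w *
    (sg_diff (u * xi w) (innov i w) - mean_sg_diff i (u * xi w))) ^+ 2) <=
  n%:R * (b ^+ 2 * (4 * (1 + L) * (`|u| * b))).
Proof.
pose V i w := psi i (xi w, innov i w).
have mV i : measurable_fun setT (V i).
  exact: (measurableT_comp (@mpsi i) (measurable_fun_pair mxi (@mi i))).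
have V2 i : integ P (fun w => V i w ^+ 2) /\
    Ex P (fun w => V i w ^+ 2) <= b ^+ 2 * (4 * (1 + L) * (`|u| * b)).
  have bd (a : R) : `|a| <= b -> a ^+ 2 * (4 * (1 + L) * `|u * a|) <= b ^+ 2 * (4 * (1 + L) * (`|u| * b)).
    move=> ab; have L4 : 0 <= 4 * (1 + L) by rewrite mulr_ge0// addr_ge0.
    have a2 : a ^+ 2 <= b ^+ 2 by rewrite -[a ^+ 2]real_normK ?num_real// ler_sqr ?nnegrE.
    have ua : `|u * a| <= `|u| * b by rewrite normrM ler_wpM2l.
    apply: ler_pM => //; [exact: sqr_ge0|exact: mulr_ge0|exact: ler_wpM2l].
  have im : integ P ((fun a => a ^+ 2 * (4 * (1 + L) * `|u * a|)) \o xi).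
    apply: (@integ_bounded _ _ _ _ _ (b ^+ 2 * (4 * (1 + L) * (`|u| * b)))) => [|w] /=.
      apply: measurable_funM; first exact: measurable_funX.
      apply: measurable_funM => //; apply: measurableT_comp => //; exact: measurable_funM.
    rewrite ger0_norm; first exact: bd.
    by rewrite mulr_ge0 ?sqr_ge0// mulr_ge0// mulr_ge0// addr_ge0.
  have [j e] := @indep_Ex_le _ _ _ P _ _ _ _ xi (innov i) mxi (@mi i) (past_innov ind (@bxim i))
    (fun z => psi i z ^+ 2) (fun a => a ^+ 2 * (4 * (1 + L) * `|u * a|))
    (measurable_funX 2 (@mpsi i)) (fun z => sqr_ge0 _) im (psi_section2 i).
  split => //; apply: (le_trans e); rewrite -[leRHS](Ex_cst P).
  by apply: Ex_le => //; [exact: integ_cst|move=> w; exact: bd].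
have bV i : block_fun eps (past i.+1) (V i).
  apply: (block_fun_comp (@mpsi i) (A := fun w => (xi w, innov i w))).
  by apply: block_fun_pair => //; exact: innov_past.
have orth m : Ex P (fun w => (\sum_(i < m) V i w) * V m w) = 0.
  have bS : block_fun eps (past m) (fun w => \sum_(i < m) V i w) by exact: block_fun_psum.
  have bA : block_fun eps (past m) (fun w => (\sum_(i < m) V i w, xi w)) by exact: block_fun_pair.
  have iSV : integ P (fun w => (\sum_(i < m) V i w) * V m w).
    apply: integM => //; [exact: measurable_sum| |by case: (V2 m)].
    by apply: integ_sqr_sum => // i; case: (V2 i).
  pose chi (z : (R * R) * R) := z.1.1 * psi m (z.1.2, z.2).
  have mchi : measurable_fun setT chi.
    have m1 : measurable_fun [set: (R * R) * R] (fun z => z.1.1) by exact: measurableT_comp.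
    have m2 : measurable_fun [set: (R * R) * R] (fun z => z.1.2) by exact: measurableT_comp.
    apply: measurable_funM => //.
    exact: (measurableT_comp (@mpsi m) (measurable_fun_pair m2 measurable_snd)).
  have [_ E] := @indep_Ex _ _ _ P _ _ _ _ (fun w => (\sum_(i < m) V i w, xi w)) (innov m)
    (block_fun_measurable bA) (@mi m) (past_innov ind bA) chi mchi iSV
    (fun w => integZ (\sum_(i < m) V i w) (psi_section m (xi w)).1).
  rewrite [LHS]E -[RHS](Ex_cst P); apply: Ex_ext => w /=.
  have [j e] := psi_section m (xi w).
  by rewrite /chi /= ExZ// e mulr0.
have [j e] := orthogonal_sum_sqr mV (fun i => (V2 i).1) orth n.
split; first exact: j.
rewrite [leLHS]e; apply: (@le_trans _ _ (\sum_(i < n) b ^+ 2 * (4 * (1 + L) * (`|u| * b)))).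
  by apply: ler_sum => i _; case: (V2 i).
by rewrite sumr_const card_ord [leRHS]mulr_natl.
Qed.

(** The error per term is [|xi|] times [2 L u^2 xi^2], cubic in [xi]. This is the place that needs
    the bound [b]; with [b = K / sqrt n] the sum is again of order [1 / sqrt n]. *)
Lemma localized_drift w :
  `|\sum_(i < n) xi w * mean_sg_diff i (u * xi w) - 2 * f 0 * u * (n%:R * xi w ^+ 2)| <=
  n%:R * (b * (2 * L * (u ^+ 2 * b ^+ 2))).
Proof.
have -> : 2 * f 0 * u * (n%:R * xi w ^+ 2) = \sum_(i < n) xi w * (2 * f 0 * (u * xi w)).
  by rewrite sumr_const card_ord -[RHS]mulr_natl; ring.
rewrite -sumrB (le_trans (ler_norm_sum _ _ _))//.
have -> : n%:R * (b * (2 * L * (u ^+ 2 * b ^+ 2))) = \sum_(i < n) b * (2 * L * (u ^+ 2 * b ^+ 2)).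
  by rewrite sumr_const card_ord [LHS]mulr_natl.
apply: ler_sum => i _; rewrite -mulrBr normrM.
apply: ler_pM => //; apply: (le_trans (mean_sg_diff_lin i _)).
rewrite exprMn ler_wpM2l ?mulr_ge0// ler_wpM2l ?sqr_ge0//.
by rewrite -[xi w ^+ 2]real_normK ?num_real// ler_sqr ?nnegrE.
Qed.

End localized_sums.

Section score_approximation.
Context d (T : measurableType d) (R : realType) (P : probability T R).
Variables (eps : int -> {RV P >-> R}) (f : R -> R) (L : R).
Hypotheses (ind : mutually_independent eps) (dens : forall i, has_density (eps i) f)
  (med : forall i, is_median (eps i) 0) (L0 : 0 <= L)
  (fL : forall x y, `|f x - f y| <= L * `|x - y|).
Variables (x : nat -> nat -> T -> R) (V : R).
Hypotheses (bx : forall n i, block_fun eps (past i) (x n i))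
  (ix2 : forall n i, integ P (fun w => x n i w ^+ 2)) (V0 : 0 <= V)
  (gap_cvg : (\sum_(i < n) Ex P (fun w => (x n i w - x n 0%N w) ^+ 2)) @[n --> \oo] --> (0 : R))
  (x0V : \forall n \near \oo, n%:R * Ex P (fun w => x n 0%N w ^+ 2) <= V).

Local Notation innov := (innov eps).

(** For the regressors used later and [n > 0] this is the normalised initial value, the variable [Y]
    of the argument. *)
Definition level n w : R := Num.sqrt n%:R * x n 0%N w.

Definition score (n : nat) (u : R) (w : T) : R :=
  \sum_(i < n) x n i w * Num.sg (innov i w - u * x n i w).

Definition sign_sum : nat -> T -> R := norm_sum (fun i w => Num.sg (innov i w)).

Let mx n i : measurable_fun [set: T] (x n i).
Proof. exact: (block_fun_measurable (@bx n i)). Qed.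

Let mi i := @measurable_innov _ _ _ _ eps i.

Let msg i : measurable_fun [set: T] (fun w => Num.sg (innov i w)).
Proof. by apply: (measurableT_comp (@measurable_sgr R)); exact: mi. Qed.

Lemma spread_cvg : spread P (x n) n @[n --> \oo] --> (0 : R).
Proof.
pose D n := \sum_(i < n) Ex P (fun w => (x n i w - x n 0%N w) ^+ 2).
(* The parameter that balances the two terms of [spread_le]: of the order of the square root of the
   vanishing gap [D n], with a harmonic term added to keep it positive. *)
pose eta n := Num.sqrt (D n + n.+1%:R^-1).
have D0 n : 0 <= D n by apply: sumr_ge0 => i _; apply: Ex_ge0 => w; exact: sqr_ge0.
have h0 n : 0 < D n + n.+1%:R^-1 by rewrite ltr_wpDl// invr_gt0.
have eta0 n : 0 < eta n by rewrite sqrtr_gt0.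
have eta2 n : eta n ^+ 2 = D n + n.+1%:R^-1 by rewrite sqr_sqrtr// ltW.
have ceta : eta n @[n --> \oo] --> (0 : R).
  have c0 : D n + n.+1%:R^-1 @[n --> \oo] --> (0 : R).
    by rewrite -[X in _ --> X]addr0; apply: cvgD => //; exact: cvg_harmonic.
  rewrite -[X in _ --> X](sqrtr0 R).
  exact: (cvg_comp _ _ c0 (@sqrt_continuous R 0)).
have cb : eta n * eta n + eta n * (1 + V) @[n --> \oo] --> (0 : R).
  rewrite -[X in _ --> X](_ : 0 * 0 + 0 * (1 + V) = 0); last by rewrite !mul0r addr0.
  by apply: cvgD; apply: cvgM => //; exact: cvg_cst.
apply: (@squeeze_cvgr _ _ _ _ (fun=> 0) (fun n => eta n * eta n + eta n * (1 + V))) => //;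
  last exact: cvg_cst.
near=> n.
have v : n%:R * Ex P (fun w => x n 0%N w ^+ 2) <= V by near: n.
have s0 : 0 <= spread P (x n) n.
  by apply: sumr_ge0 => i _; apply: Ex_ge0 => w; rewrite mulr_ge0// addr_ge0.
rewrite s0 /=; apply: (le_trans (spread_le n (@bx n) (@ix2 n) (eta0 n))).
have Dn : D n <= eta n ^+ 2 by rewrite eta2 lerDl invr_ge0.
have e1 : (1 + (eta n)^-1) * D n <= (1 + (eta n)^-1) * eta n ^+ 2.
  by rewrite ler_wpM2l// addr_ge0// invr_ge0 ltW.
have e2 : (1 + (eta n)^-1) * eta n ^+ 2 = eta n * eta n + eta n by field; rewrite gt_eqF.
have e3 : eta n * (n%:R * Ex P (fun w => x n 0%N w ^+ 2)) <= eta n * V by rewrite ler_wpM2l// ltW.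
by rewrite -/(D n); lra.
Unshelve. all: by end_near. Qed.

Lemma small_sqr_gap : small P (fun n w => \sum_(i < n) x n i w ^+ 2 - level n w ^+ 2).
Proof.
apply: (small_markov (b := fun n => spread P (x n) n)); last exact: spread_cvg.
  move=> n; apply: measurable_funB; last by apply: measurable_funX; exact: measurable_funM.
  by apply: measurable_sum => i; exact: measurable_funX.
apply: nearW => n; have := sqr_gap n (@bx n) (@ix2 n).
have -> // : (fun w => `|\sum_(i < n) x n i w ^+ 2 - n%:R * x n 0%N w ^+ 2|) =
    (fun w => `|\sum_(i < n) x n i w ^+ 2 - level n w ^+ 2|).
by apply/funext => w; rewrite exprMn sqr_sqrtr.
Qed.

Lemma clamp_norm (K y : R) : 0 <= K -> `|clamp (- K) K y| <= K.
Proof. by move=> K0; rewrite ler_norml /clamp le_max lexx/= ge_max ge_min lexx orbT andbT; lra. Qed.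

Lemma clamp_id (K y : R) : `|y| <= K -> clamp (- K) K y = y.
Proof. by rewrite ler_norml /clamp => /andP[a b]; rewrite min_l// max_r. Qed.

(** Writing [sg (e - a) = sg e - sg_diff a e] splits the score in two. Replacing [x_i] by [x_0]
    costs [At] in the sign sum and [B1] in the sum of differences. Once [x_0] is truncated, [B2] is
    the centred fluctuation, and the remaining mean is linear in [u] up to the drift error. *)
Lemma small_score (u : R) :
  small P (fun n w => score n u w - (level n w * sign_sum n w - 2 * f 0 * u * level n w ^+ 2)).
Proof.
pose At n w := \sum_(i < n) (x n i w - x n 0%N w) * Num.sg (innov i w).
pose B1 n w := \sum_(i < n) (x n i w * sg_diff (u * x n i w) (innov i w) -
    x n 0%N w * sg_diff (u * x n 0%N w) (innov i w)).
have msd n i j : measurable_fun setT (fun w => x n i w * sg_diff (u * x n i w) (innov j w)).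
  apply: measurable_funM => //.
  have mu : measurable_fun setT (fun w => u * x n i w) by exact: measurable_funM.
  exact: (measurableT_comp (@measurable_sg_diff2 R) (measurable_fun_pair mu (@mi j))).
have sA : small P At.
  apply: (small_chebyshev (b := fun n => \sum_(i < n) Ex P (fun w => (x n i w - x n 0%N w) ^+ 2))) => //.
    move=> n; apply: measurable_sum => i; apply: measurable_funM => //; exact: measurable_funB.
  apply: nearW => n.
  have [i e] := score_gap_sqr ind dens med L0 fL n (@bx n) (@ix2 n).
  by split; [exact: i|rewrite [leLHS]e].
have sB1 : small P B1.
  apply: (small_markov (b := fun n => 2 * (1 + L) * `|u| * spread P (x n) n)).
  - by move=> n; apply: measurable_sum => i; exact: measurable_funB.
  - by apply: nearW => n; exact: (linearisation_gap ind dens L0 fL n (@bx n) (@ix2 n) u).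
  - by rewrite -[X in _ --> X](mulr0 (2 * (1 + L) * `|u|)); apply: cvgMr; exact: spread_cvg.
move=> e eta e0 eta0.
have e2 : 0 < e / 2 by rewrite divr_gt0.
have eta2 : 0 < eta / 2 by rewrite divr_gt0.
have mlev n : measurable_fun setT (level n) by exact: measurable_funM.
have [K K0 bK] : exists2 K, 0 < K & mostly P (e / 2) (fun n w => `|level n w| <= K).
  apply: (mostly_bounded V0) => //; move: x0V; apply: filterS => n vn.
  have E : (fun w => level n w ^+ 2) = (fun w => n%:R * x n 0%N w ^+ 2).
    by apply/funext => w; rewrite exprMn sqr_sqrtr.
  by rewrite E ExZ//; split => //; exact: integZ.
pose s n : R := (Num.sqrt n%:R)^-1.
have s0 n : 0 <= s n by rewrite invr_ge0 sqrtr_ge0.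
(* The truncated [x_0], bounded by [K / sqrt n] everywhere and equal to [x_0] where [|level| <= K].
   [K] depends on the tolerated probability but not on [n]. *)
pose xi n w := s n * clamp (- K) K (level n w).
have bxi n : block_fun eps (past 0) (xi n).
  apply: block_funZ; apply: (block_fun_comp (g := clamp (- K) K)).
    by apply: measurable_maxr => //; exact: measurable_minr.
  by apply: block_funZ; exact: bx.
have xib n w : `|xi n w| <= s n * K.
  by rewrite normrM (ger0_norm (s0 n)) ler_wpM2l// clamp_norm// ltW.
have sK n : 0 <= s n * K by rewrite mulr_ge0// ltW.
have mxi n : measurable_fun setT (xi n) by exact: (block_fun_measurable (@bxi n)).
pose B2 n w := \sum_(i < n) xi n w *
    (sg_diff (u * xi n w) (innov i w) - mean_sg_diff eps i (u * xi n w)).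
have ns n : (0 < n)%N -> n%:R * s n ^+ 2 = 1 :> R.
  by move=> n0; rewrite exprVn sqr_sqrtr// mulfV// pnatr_eq0 -lt0n.
have sB2 : small P B2.
  apply: (small_chebyshev (b := fun n => K ^+ 3 * (4 * (1 + L) * `|u|) * s n)).
  - move=> n; apply: measurable_sum => i; apply: measurable_funM => //.
    have mu : measurable_fun setT (fun w => u * xi n w) by exact: measurable_funM.
    apply: measurable_funB.
      exact: (measurableT_comp (@measurable_sg_diff2 R) (measurable_fun_pair mu (@mi i))).
    exact: (measurableT_comp (@measurable_mean_sg_diff _ _ _ _ eps i) mu).
  - near=> n; have n0 : (0 < n)%N by near: n; exact: nbhs_infty_gt.
    have [i h] := localized_sum_sqr ind dens L0 fL n (@bxi n) (sK n) (xib n) u.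
    split; [exact: i|apply: (le_trans h)].
    rewrite le_eqVlt; apply/orP; left; apply/eqP.
    transitivity ((n%:R * s n ^+ 2) * (K ^+ 3 * (4 * (1 + L) * `|u|) * s n)); first by ring.
    by rewrite ns// mul1r.
  - rewrite -[X in _ --> X](mulr0 (K ^+ 3 * (4 * (1 + L) * `|u|))).
    by apply: cvgMr; exact: invr_sqrt_cvg0.
have drift : K ^+ 3 * (2 * L * u ^+ 2) * s n @[n --> \oo] --> 0.
  rewrite -[X in _ --> X](mulr0 (K ^+ 3 * (2 * L * u ^+ 2))).
  by apply: cvgMr; exact: invr_sqrt_cvg0.
have sAB := smallD (smallD sA (smallN sB1)) (smallN sB2).
have := mostly_and (sAB _ _ e2 eta2) bK; rewrite -splitr => h.
apply: (mostly_imp h); near=> n => w [h1 h2].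
have n0 : (0 < n)%N by near: n; exact: nbhs_infty_gt.
have dn : `|0 - K ^+ 3 * (2 * L * u ^+ 2) * s n| <= eta / 2.
  by near: n; exact: (cvgrPdist_le _ _).1 drift _ eta2.
have xiE : xi n w = x n 0%N w.
  by rewrite /xi clamp_id// /level /s mulKf// sqrtr_eq0 -ltNge ltr0n.
have dr := localized_drift dens L0 fL n (sK n) (xib n) u w.
have drE : n%:R * (s n * K * (2 * L * (u ^+ 2 * (s n * K) ^+ 2))) =
    (n%:R * s n ^+ 2) * (K ^+ 3 * (2 * L * u ^+ 2) * s n) by ring.
rewrite drE ns// mul1r in dr.
have dr2 : `|\sum_(i < n) xi n w * mean_sg_diff eps i (u * xi n w) -
   2 * f 0 * u * (n%:R * xi n w ^+ 2)| <= eta / 2.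
  by apply: (le_trans dr); apply: le_trans (ler_norm _) _; rewrite -normrN -sub0r.
(* On the good event [xi] equals [x_0], so the error is an exact combination of the four pieces
   already bounded. *)
have -> : score n u w - (level n w * sign_sum n w - 2 * f 0 * u * level n w ^+ 2) =
   (At n w - B1 n w - B2 n w) - (\sum_(i < n) xi n w * mean_sg_diff eps i (u * xi n w) -
   2 * f 0 * u * (n%:R * xi n w ^+ 2)).
  have lv2 : level n w ^+ 2 = n%:R * x n 0%N w ^+ 2 by rewrite exprMn sqr_sqrtr.
  have lvS : level n w * sign_sum n w = \sum_(i < n) x n 0%N w * Num.sg (innov i w).
    rewrite /sign_sum /norm_sum mulr_sumr; apply: eq_bigr => i _.
    rewrite /level -/(s n); transitivity ((Num.sqrt n%:R * s n) * (x n 0%N w * Num.sg (innov i w))).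
      by ring.
    by rewrite mulfV ?mul1r// sqrtr_eq0 -ltNge ltr0n.
  rewrite lv2 lvS /At /B1 /B2 xiE.
  have E1 : score n u w = \sum_(i < n) x n i w * Num.sg (innov i w) -
      \sum_(i < n) x n i w * sg_diff (u * x n i w) (innov i w).
    by rewrite -sumrB; apply: eq_bigr => i _; rewrite /sg_diff; ring.
  under [\sum_(i < n) (x n i w - _) * _]eq_bigr do rewrite mulrBl.
  under [\sum_(i < n) _ * (_ - _)]eq_bigr do rewrite mulrBr.
  by rewrite E1 !sumrB; ring.
by rewrite (le_trans (ler_normB _ _))// [leRHS]splitr lerD.
Unshelve. all: by end_near. Qed.
End score_approximation.

(** * Linearisation of the LAD estimator *)

Section grid.
Context d (T : measurableType d) (R : realType) (P : probability T R).
Variables (Y S v : nat -> T -> R) (M : nat -> R -> T -> R) (a : R).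
Hypotheses (a0 : 0 < a) (Mmono : forall n u w, 0 <= (v n w - u) * M n u w)
  (Mlin : forall u, small P (fun n w => M n u w - (Y n w * S n w - a * u * Y n w ^+ 2)))
  (Ylow : forall e, 0 < e -> exists2 c, 0 < c & mostly P e (fun n w => c <= `|Y n w|))
  (Yup : forall e, 0 < e -> exists2 K, 0 < K & mostly P e (fun n w => `|Y n w| <= K))
  (Sup : forall e, 0 < e -> exists2 K, 0 < K & mostly P e (fun n w => `|S n w| <= K)).

(* The linear approximation of M vanishes at W; its sign at a grid point on either side of W,
   at distance between h and 2h, is that of M, which traps v. *)
Lemma grid_trap (h c B : R) (N : nat) (n : nat) (w : T) (W := a^-1 / Y n w * S n w) :
  0 < h -> 0 < c -> 0 <= B -> (2 * B + 3 * h) / h + 1 < N%:R -> c <= `|Y n w| -> `|W| <= B ->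
  (forall j, (j < N)%N -> let u := - B - 2 * h + j%:R * h in
    `|M n u w - (Y n w * S n w - a * u * Y n w ^+ 2)| <= a * c ^+ 2 * h / 2) ->
  `|v n w - W| <= 2 * h.
Proof.
move=> h0 c0 B0 NB cY WB good.
have Y0 : Y n w != 0 by rewrite -normr_gt0 (lt_le_trans c0).
have c2 : c ^+ 2 <= Y n w ^+ 2.
  by rewrite -[Y n w ^+ 2]real_normK ?num_real// ler_sqr ?nnegrE// ltW.
have acc : 0 < a * c ^+ 2 * h by rewrite !mulr_gt0// exprn_gt0.
have YS u : Y n w * S n w - a * u * Y n w ^+ 2 = a * Y n w ^+ 2 * (W - u).
  by rewrite /W; field; rewrite Y0 gt_eqF.
have aY : a * c ^+ 2 <= a * Y n w ^+ 2 by rewrite ler_pM2l.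
have up j : (j < N)%N -> let u := - B - 2 * h + j%:R * h in W + h <= u -> v n w <= u.
  move=> jN u Wu; have g := good j jN; cbv zeta in g; rewrite -/u YS in g.
  have Mu : M n u w < 0.
    have : a * c ^+ 2 * h <= a * Y n w ^+ 2 * (u - W).
      by rewrite ler_pM ?mulr_ge0 ?exprn_ge0 ?(ltW a0) ?(ltW c0) ?(ltW h0)//; lra.
    by move: g; rewrite ler_norml => /andP[_ g]; nra.
  have := Mmono n u w; rewrite leNgt => /negP hh; rewrite leNgt; apply/negP => uv; apply: hh.
  by rewrite nmulr_llt0// subr_gt0.
have dn j : (j < N)%N -> let u := - B - 2 * h + j%:R * h in u <= W - h -> u <= v n w.
  move=> jN u Wu; have g := good j jN; cbv zeta in g; rewrite -/u YS in g.
  have Mu : 0 < M n u w.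
    have : a * c ^+ 2 * h <= a * Y n w ^+ 2 * (W - u).
      by rewrite ler_pM ?mulr_ge0 ?exprn_ge0 ?(ltW a0) ?(ltW c0) ?(ltW h0)//; lra.
    by move: g; rewrite ler_norml => /andP[g _]; nra.
  have := Mmono n u w; rewrite leNgt => /negP hh; rewrite leNgt; apply/negP => uv; apply: hh.
  by rewrite pmulr_llt0// subr_lt0.
move: WB; rewrite ler_norml => /andP[W1 W2].
have grid t : 0 <= t -> t <= (2 * B + 3 * h) / h ->
    exists2 j, ((j.+1 < N)%N) & j%:R <= t < j.+1%:R.
  move=> t0 tN; have /andP[t1 t2] := truncn_itv t0; exists (Num.truncn t); last exact/andP.
  rewrite -(ltr_nat R); apply: le_lt_trans NB; rewrite -natr1; lra.
(* With [j] the integer part of this quotient, grid point [j + 1] lies between [W + h] and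
   [W + 2 h]. *)
have r1 : 0 <= (W + B + 3 * h) / h by rewrite divr_ge0 ?(ltW h0)//; lra.
have r2 : (W + B + 3 * h) / h <= (2 * B + 3 * h) / h by rewrite ler_pM2r ?invr_gt0//; lra.
have [j jN /andP[j1 j2]] := grid _ r1 r2.
(* With [i] the integer part of this quotient, grid point [i] lies between [W - 2 h] and [W - h]. *)
have r3 : 0 <= (W + B + h) / h by rewrite divr_ge0 ?(ltW h0)//; lra.
have r4 : (W + B + h) / h <= (2 * B + 3 * h) / h by rewrite ler_pM2r ?invr_gt0//; lra.
have [i iN /andP[i1 i2]] := grid _ r3 r4.
rewrite ler_pdivlMr// in j1; rewrite ltr_pdivrMr// in j2.
rewrite ler_pdivlMr// in i1; rewrite ltr_pdivrMr// in i2.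
have U := up j.+1 jN; have D := dn i (ltnW iN); cbv zeta in U, D.
rewrite -natr1 mulrDl mul1r in j2 U; rewrite -natr1 mulrDl mul1r in i2.
rewrite ler_norml; apply/andP; split.
  by have := D ltac:(lra); lra.
by have := U ltac:(lra); lra.
Qed.

(** The bounds on [|Y|] from below and on [|S|] from above confine [W] to [[-B, B]], so one finite
    grid serves all large [n]. Control of [M] at each fixed [u] is then enough, every grid point
    being granted failure probability [e / (3 N)]. *)
Lemma lad_linearisation : small P (fun n w => v n w - a^-1 / Y n w * S n w).
Proof.
move=> e eta e0 eta0; have e3 : 0 < e / 3 by rewrite divr_gt0.
have [c c0 mc] := Ylow e3; have [K K0 mK] := Sup e3.
pose h := eta / 2; have h0 : 0 < h by rewrite divr_gt0.
pose B := a^-1 / c * K; have B0 : 0 <= B by rewrite !mulr_ge0 ?invr_ge0// ltW.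
pose N := (Num.truncn ((2 * B + 3 * h) / h + 1)).+1.
have NB : (2 * B + 3 * h) / h + 1 < N%:R.
  have : 0 <= (2 * B + 3 * h) / h + 1 by rewrite addr_ge0// divr_ge0 ?(ltW h0)//; lra.
  by move=> /truncn_itv /andP[].
have eN : 0 < e / 3 / N%:R by rewrite divr_gt0// ltr0n.
have th : 0 < a * c ^+ 2 * h / 2 by rewrite divr_gt0// !mulr_gt0// exprn_gt0.
have mg := mostly_forall (ltW eN) (fun j (_ : (j < N)%N) => Mlin (- B - 2 * h + j%:R * h) eN th).
have := mostly_and (mostly_and mc mK) mg.
have -> : e / 3 + e / 3 + N%:R * (e / 3 / N%:R) = e by field; rewrite pnatr_eq0.
move=> hh; apply: (mostly_imp hh); apply: nearW => n w [[h1 h2] h3].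
have -> : eta = 2 * h by rewrite /h mulrC divfK.
apply: (grid_trap (c := c) (B := B) (N := N)) => //.
rewrite normrM; apply: ler_pM => //; rewrite normrM normfV (gtr0_norm a0).
rewrite ler_pM2l ?invr_gt0// normfV lef_pV2 ?posrE//; exact: lt_le_trans h1.
Qed.

Variable Q : nat -> T -> R.
Hypotheses (Q0 : forall n w, 0 <= Q n w) (QY : small P (fun n w => Q n w ^+ 2 - Y n w ^+ 2)).

(** As [|Y| W = sg(Y) S / a], the difference is [Q (v - W) + (Q - |Y|) W]: a bounded factor times a
    small one in each term. *)
Lemma studentised_linearisation :
  small P (fun n w => Q n w * v n w - a^-1 * Num.sg (Y n w) * S n w).
Proof.
move=> e eta e0 eta0; have e5 : 0 < e / 5 by rewrite divr_gt0.
have [c c0 mc] := Ylow e5; have [K K0 mK] := Sup e5; have [K' K'0 mK'] := Yup e5.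
pose B := a^-1 / c * K; have B0 : 0 < B by rewrite !mulr_gt0 ?invr_gt0.
pose t := Num.min 1 (eta / (2 * B)); have t0 : 0 < t by rewrite lt_min ltr01 divr_gt0// mulr_gt0.
pose th := eta / (2 * (K' + 1)); have th0 : 0 < th by rewrite divr_gt0// mulr_gt0// addr_gt0.
have ct : 0 < c * t by rewrite mulr_gt0.
have := mostly_and (mostly_and (mostly_and (mostly_and mc mK) mK') (QY e5 ct))
  (lad_linearisation e5 th0).
have -> : e / 5 + e / 5 + e / 5 + e / 5 + e / 5 = e by field.
move=> hh; apply: (mostly_imp hh); apply: nearW => n w [[[[h1 h2] h3] h4] h5].
have Y0 : Y n w != 0 by rewrite -normr_gt0 (lt_le_trans c0).
set W := a^-1 / Y n w * S n w.
have WB : `|W| <= B.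
  rewrite normrM; apply: ler_pM => //; rewrite normrM normfV (gtr0_norm a0).
  rewrite ler_pM2l ?invr_gt0// normfV lef_pV2 ?posrE//; exact: lt_le_trans h1.
(* From [(Q - |Y|) (Q + |Y|) = Q^2 - Y^2], where the second factor is at least [c]. *)
have QYt : `|Q n w - `|Y n w| | <= t.
  have : `|Q n w - `|Y n w| | * (Q n w + `|Y n w|) <= c * t.
    rewrite -[X in _ * X]ger0_norm ?addr_ge0// -normrM -subr_sqr real_normK ?num_real//.
  move=> hq; rewrite -(ler_pM2l c0); apply: le_trans hq; rewrite mulrC ler_wpM2l//.
  by rewrite (le_trans h1)// lerDr.
have tB : t * B <= eta / 2.
  have : t <= eta / (2 * B) by rewrite ge_min lexx orbT.
  have B2 : 0 < 2 * B by rewrite pmulr_rgt0.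
  by rewrite ler_pdivlMr// => ?; lra.
have t1 : t <= 1 by rewrite ge_min lexx.
have QK : `|Q n w| <= K' + 1.
  rewrite ger0_norm//; move: QYt; rewrite ler_norml => /andP[_ ?]; lra.
have -> : Q n w * v n w - a^-1 * Num.sg (Y n w) * S n w =
    Q n w * (v n w - W) + (Q n w - `|Y n w|) * W.
  have : `|Y n w| * W = a^-1 * Num.sg (Y n w) * S n w.
    by rewrite /W {1}normrEsg; field; rewrite Y0 gt_eqF.
  by move=> <-; ring.
have thE : (K' + 1) * th = eta / 2.
  by rewrite /th; field; rewrite gt_eqF// addr_gt0.
rewrite (le_trans (ler_normD _ _))// [leRHS]splitr (normrM _ (v n w - W)) (normrM _ W); apply: lerD.
  rewrite -thE; apply: ler_pM => //.
apply: le_trans tB; apply: ler_pM => //.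
Qed.

End grid.

(** * Moments and rates *)

Section weighted_sums.
Context d (T : measurableType d) (R : realType) (P : probability T R).
Variables (X : nat -> T -> R) (tau : R).
Hypotheses (mX : forall i, measurable_fun [set: T] (X i))
  (iX2 : forall i, integ P (fun w => X i w ^+ 2)) (EX : forall i, Ex P (X i) = 0)
  (EX2 : forall i, Ex P (fun w => X i w ^+ 2) = tau ^+ 2)
  (indX : forall (c : nat -> R) m, independent_pair P (fun w => \sum_(j < m) c j * X j w) (X m)).

Lemma weighted_sum_sqr (c : nat -> R) m :
  integ P (fun w => (\sum_(j < m) c j * X j w) ^+ 2) /\
  Ex P (fun w => (\sum_(j < m) c j * X j w) ^+ 2) = tau ^+ 2 * \sum_(j < m) c j ^+ 2.
Proof.
have mV i : measurable_fun setT (fun w => c i * X i w) by exact: measurable_funM.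
have E2 i : (fun w => (c i * X i w) ^+ 2) = (fun w => c i ^+ 2 * X i w ^+ 2).
  by apply/funext => w; rewrite exprMn.
have iV2 i : integ P (fun w => (c i * X i w) ^+ 2) by rewrite E2; exact: integZ.
have iX i : integ P (X i) by exact: integ_sqr.
have orth k : Ex P (fun w => (\sum_(i < k) c i * X i w) * (c k * X k w)) = 0.
  have mS : measurable_fun setT (fun w => \sum_(i < k) c i * X i w) by exact: measurable_sum.
  have iS : integ P (fun w => \sum_(i < k) c i * X i w).
    by apply: integ_sqr => //; exact: (integ_sqr_sum mV).
  have -> : Ex P (fun w => (\sum_(i < k) c i * X i w) * (c k * X k w)) =
      Ex P (fun w => c k * ((\sum_(i < k) c i * X i w) * X k w)).
    by apply: Ex_ext => w; ring.
  rewrite ExZ; last exact: (indep_integM mS (mX k) (@indX c k)).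
  by rewrite (indep_ExM mS (mX k) (@indX c k))// EX !mulr0.
have [i e] := orthogonal_sum_sqr mV iV2 orth m.
split; first exact: i.
rewrite [LHS]e mulr_sumr; apply: eq_bigr => j _.
by rewrite E2 ExZ// EX2 mulrC.
Qed.

End weighted_sums.

Section law_transfer.
Context d (T : measurableType d) (R : realType) (P : probability T R).
Variables (X X' : {RV P >-> R}).
Hypothesis lXX : has_law X (distribution P X').

Lemma same_law_density f : has_density X' f -> has_density X f.
Proof. by move=> [mf f0 l]; split => // A mA; rewrite lXX// l. Qed.

Lemma same_law_median m : is_median X' m -> is_median X m.
Proof.
have h (A : set R) : measurable A -> P (X @^-1` A) = P (X' @^-1` A) by exact: lXX.
move=> [h1 h2]; split.
  have := h `]-oo, m]%classic (measurable_itv _).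
  have -> : X @^-1` `]-oo, m]%classic = [set w | X w <= m].
    by apply/seteqP; split => w /=; rewrite in_itv.
  have -> : X' @^-1` `]-oo, m]%classic = [set w | X' w <= m].
    by apply/seteqP; split => w /=; rewrite in_itv.
  by move=> ->.
have := h `[m, +oo[%classic (measurable_itv _).
have -> : X @^-1` `[m, +oo[%classic = [set w | m <= X w].
  by apply/seteqP; split => w /=; rewrite in_itv/= andbT.
have -> : X' @^-1` `[m, +oo[%classic = [set w | m <= X' w].
  by apply/seteqP; split => w /=; rewrite in_itv/= andbT.
by move=> ->.
Qed.

End law_transfer.

Section moments.
Context d (T : measurableType d) (R : realType) (P : probability T R).
Variables (X : {RV P >-> R}) (sigma : R).
Hypotheses (XL2 : (X : T -> R) \in Lfun P 2%:E) (X0 : 'E_P[X]%E = 0%E)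
  (XV : 'V_P[X]%E = (sigma ^+ 2)%:E).

Lemma L2_moments : [/\ integ P (fun w => X w ^+ 2), Ex P X = 0 &
  Ex P (fun w => X w ^+ 2) = sigma ^+ 2].
Proof.
have i2 : integ P (fun w => X w ^+ 2) by exact: Lfun2_integrable_sqr.
have i1 : integ P X by apply: integ_sqr => //; exact: measurable_funPT.
split => //.
  by have := X0; rewrite unlock (integ_fin i1) => -[].
have := XV; rewrite varianceE// X0 expe2 mule0 sube0 unlock.
have -> : (\int[P]_w ((X ^+ 2) w)%:E = \int[P]_w (X w ^+ 2)%:E)%E.
  by apply: eq_integral => w _.
by rewrite (integ_fin i2) => -[].
Qed.

(** A density bounded by [1 + L] cannot concentrate at 0. With [a = 1 / (8 (1 + L))],
    [1 <= h / 2 + X^2 / a^2] pointwise, and [h / 2] has mean at most one quarter; a vanishing second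
    moment would contradict this. *)
Lemma density_sigma_neq0 f L : has_density X f -> 0 <= L ->
  (forall x y, `|f x - f y| <= L * `|x - y|) -> sigma != 0.
Proof.
move=> den L0 fL; have [i2 _ E2] := L2_moments.
pose a := (8 * (1 + L))^-1; have L8 : 0 < 8 * (1 + L) by rewrite mulr_gt0//; lra.
have a0 : 0 < a by rewrite invr_gt0.
pose h w := `|Num.sg (X w - a) - Num.sg (X w - (- a))|.
have ih : integ P h by apply: integ_norm; apply: integB; exact: integ_sg_shift.
have h1 : Ex P h <= 2 * (1 + L) * `|a - - a| by exact: (Ex_abs_sg_diff den L0 fL).
have a2 : 0 < a ^+ 2 by rewrite exprn_gt0.
have i3 : integ P (fun w => (a ^+ 2)^-1 * X w ^+ 2) by exact: integZ.
have i4 : integ P (fun w => 2^-1 * h w) by exact: integZ.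
have : 1 <= Ex P (fun w => 2^-1 * h w + (a ^+ 2)^-1 * X w ^+ 2).
  rewrite -[leLHS](Ex_cst P); apply: Ex_le; [exact: integ_cst|exact: integD|move=> w].
  have [Xa|aX] := ltP `|X w| a.
    have : h w = 2.
      move: Xa; rewrite ltr_norml => /andP[x1 x2]; rewrite /h ltr0_sg ?gtr0_sg; [|lra|lra].
      by rewrite -opprD normrN ger0_norm.
    move=> ->; rewrite mulVf// lerDl mulr_ge0 ?invr_ge0 ?sqr_ge0//.
  apply: (@le_trans _ _ ((a ^+ 2)^-1 * X w ^+ 2)); last by rewrite lerDr mulr_ge0// normr_ge0.
  rewrite mulrC ler_pdivlMr// mul1r -[X w ^+ 2]real_normK ?num_real//.
  by rewrite ler_sqr ?nnegrE// ltW.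
rewrite ExD// ExZ// ExZ// E2 => H1.
have h2 : 2 * (1 + L) * `|a - - a| = 2^-1.
  by rewrite opprK ger0_norm ?addr_ge0 ?(ltW a0)// /a; field; rewrite gt_eqF//; lra.
apply/negP => /eqP s0; rewrite s0 expr0n mulr0 addr0 in H1.
lra.
Qed.

End moments.

Section rates.
Context (R : realType).
Variables (rho : nat -> R) (kappa : nat -> nat).
Hypotheses (rho_gt1 : forall n, 1 < rho n)
  (rho_rate : n%:R * (rho n - 1) @[n --> \oo] --> (0 : R))
  (kappa_gt0 : forall n, (0 < kappa n)%N)
  (kappa_rate : ((kappa n)%:R / n%:R : R) @[n --> \oo] --> +oo)
  (kappa_rho_rate : (kappa n)%:R * (rho n - 1) @[n --> \oo] --> (0 : R)).

(** Squeezed by [1 <= rho^m <= exp (m (rho - 1))]. It serves with [m = n] for the sample and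
    [m = kappa] for the initial value. *)
Lemma rho_pow_cvg (m : nat -> nat) :
  (m n)%:R * (rho n - 1) @[n --> \oo] --> (0 : R) -> rho n ^+ m n @[n --> \oo] --> (1 : R).
Proof.
move=> mr; apply: (@squeeze_cvgr _ _ _ _ (fun=> 1) (fun n => expR ((m n)%:R * (rho n - 1)))).
- apply: nearW => n; rewrite expRM_natl exprn_ege1 ?(ltW (rho_gt1 n))//=.
  rewrite lerXn2r ?nnegrE ?expR_ge0//; first by rewrite (le_trans _ (ltW (rho_gt1 n))).
  by have := expR_ge1Dx (rho n - 1); rewrite addrC subrK.
- exact: cvg_cst.
- rewrite -[X in _ --> X](@expR0 R); exact: (cvg_comp _ _ mr (@continuous_expR R 0)).
Qed.

Lemma sample_over_kappa : (n%:R / (kappa n)%:R : R) @[n --> \oo] --> (0 : R).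
Proof.
have h : \forall n \near \oo, 0 < ((kappa n)%:R / n%:R : R).
  near=> n; rewrite divr_gt0 ?ltr0n//; near: n; exact: nbhs_infty_gt.
have E : (fun n => (n%:R / (kappa n)%:R : R)) = (fun n => ((kappa n)%:R / n%:R : R)^-1).
  by apply/funext => n; rewrite invfM invrK mulrC.
by rewrite E; exact: (gtr0_cvgV0 h).2 kappa_rate.
Unshelve. all: by end_near. Qed.

Lemma invr_kappa_cvg0 : ((kappa n)%:R^-1 : R) @[n --> \oo] --> (0 : R).
Proof.
apply: (@squeeze_cvgr _ _ _ _ (fun=> 0) (fun n => n%:R / (kappa n)%:R)).
- near=> n; rewrite invr_ge0 ler0n /= ler_peMl ?invr_ge0// ler1n.
  near: n; exact: nbhs_infty_gt.
- exact: cvg_cst.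
- exact: sample_over_kappa.
Unshelve. all: by end_near. Qed.

Lemma initial_weight_max : (Num.sqrt (kappa n)%:R)^-1 * rho n ^+ kappa n @[n --> \oo] --> (0 : R).
Proof.
rewrite -[X in _ --> X](mul0r 1); apply: cvgM; last exact: rho_pow_cvg.
have E : (fun n => (Num.sqrt (kappa n)%:R)^-1 : R) = fun n => Num.sqrt ((kappa n)%:R^-1).
  by apply/funext => n; rewrite sqrtrV.
rewrite E -[X in _ --> X](sqrtr0 R).
exact: (cvg_comp _ _ invr_kappa_cvg0 (@sqrt_continuous R 0)).
Qed.

(** There are [kappa + 1] terms, each between [1 / kappa] and [rho^(2 kappa) / kappa]. *)
Lemma initial_weight_sqr :
  (\sum_(j < (kappa n).+1) ((Num.sqrt (kappa n)%:R)^-1 * rho n ^+ j) ^+ 2) @[n --> \oo] --> (1 : R).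
Proof.
have r1 n : 1 <= rho n := ltW (rho_gt1 n).
have k0 n : 0 < (kappa n)%:R :> R by rewrite ltr0n.
have c1 : 1 + (kappa n)%:R^-1 @[n --> \oo] --> (1 : R).
  by rewrite -[X in _ --> X]addr0; apply: cvgD; [exact: cvg_cst|exact: invr_kappa_cvg0].
have c2 : (1 + (kappa n)%:R^-1) * (rho n ^+ kappa n * rho n ^+ kappa n) @[n --> \oo] --> (1 : R).
  rewrite -[X in _ --> X](_ : 1 * (1 * 1) = 1); last by rewrite !mulr1.
  by apply: cvgM => //; apply: cvgM; exact: rho_pow_cvg.
have bd (n : nat) (q : R) : \sum_(j < (kappa n).+1) (kappa n)%:R^-1 * q = (1 + (kappa n)%:R^-1) * q.
  rewrite sumr_const card_ord -[LHS]mulr_natl -natr1; field; exact: lt0r_neq0.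
have sq n j : ((Num.sqrt (kappa n)%:R)^-1 * rho n ^+ j) ^+ 2 = (kappa n)%:R^-1 * (rho n ^+ j * rho n ^+ j).
  by rewrite exprMn exprVn sqr_sqrtr ?ltW// -expr2.
apply: (@squeeze_cvgr _ _ _ _ _ _ _ _ 1 c1 c2); apply: nearW => n; apply/andP; split.
  rewrite -[leLHS]mulr1 -bd; apply: ler_sum => j _.
  by rewrite sq ler_wpM2l ?invr_ge0 ?(ltW (k0 n))// -exprD exprn_ege1.
rewrite -bd; apply: ler_sum => j _; rewrite sq ler_wpM2l ?invr_ge0 ?(ltW (k0 n))//.
have h : rho n ^+ j <= rho n ^+ kappa n by rewrite ler_weXn2l// -ltnS.
by rewrite ler_pM// exprn_ge0// (le_trans ler01).
Qed.

(* The bound on the mean square of y_i - y_0, summed over i and divided by n kappa_n. *)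
Lemma gap_bound_cvg (V s : R) :
  2 * (rho n ^+ n - 1) ^+ 2 * V + 2 * s * (n%:R / (kappa n)%:R) * (rho n ^+ n * rho n ^+ n)
    @[n --> \oo] --> (0 : R).
Proof.
have cr : rho n ^+ n @[n --> \oo] --> (1 : R) by exact: rho_pow_cvg.
have c1 : rho n ^+ n - 1 @[n --> \oo] --> (0 : R).
  by rewrite -[X in _ --> X](subrr 1); apply: cvgB => //; exact: cvg_cst.
rewrite -[X in _ --> X](_ : 2 * (0 * 0) * V + 2 * s * 0 * (1 * 1) = 0); last by ring.
apply: cvgD; apply: cvgM; try exact: cvg_cst.
- by under eq_fun do rewrite expr2; apply: cvgMr; apply: cvgM.
- by apply: cvgMr; exact: sample_over_kappa.
- exact: cvgM.
Qed.

End rates.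

(** * The near-explosive autoregression *)

Section bounded_away.
Context (R : realType) d (T : measurableType d) (P : probability T R).
Notation gamma := (normal_prob (0 : R) 1).
Variables (Y : nat -> T -> R) (sigma : R).
Hypotheses (sigma0 : 0 < sigma) (mY : forall n, measurable_fun [set: T] (Y n))
  (Ycvg : forall (g : R -> R) (M : R), continuous g -> (forall x, `|g x| <= M) ->
    Ex P (fun w => g (Y n w)) @[n --> \oo] --> Ex gamma (fun z => g (sigma * z))).

Lemma mostly_away_from0 (e : R) : 0 < e ->
  exists2 c : R, 0 < c & mostly P e (fun n w => c <= `|Y n w|).
Proof.
(* Where [|Y| < c] the weight is at least one half, so it suffices that the weight be at most one
   quarter; its mean [2 (e / 8)] is [e / 4], as Markov's inequality asks. *)
move=> e0; have e8 : 0 < e / 8 by rewrite divr_gt0.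
have [c c0 [_ hc]] := eventually_near0_small sigma0 Ycvg e8; exists c => //.
have mw n : measurable_fun setT (fun w => near0_weight c (Y n w)).
  exact: (measurableT_comp (continuous_measurable_fun (near0_weight_continuous c0)) (mY n)).
have q0 : 0 < 4^-1 :> R by rewrite invr_gt0.
have := @mostly_markov _ _ _ P (fun n w => near0_weight c (Y n w)) e 4^-1 q0 mw.
have wE n w : `|near0_weight c (Y n w)| = near0_weight c (Y n w).
  by rewrite ger0_norm//; have /andP[] := near0_weight_itv c (Y n w).
have h : \forall n \near \oo, integ P (fun w => `|near0_weight c (Y n w)|) /\
    Ex P (fun w => `|near0_weight c (Y n w)|) <= e * 4^-1.
  move: hc; apply: filterS => n hn.
  have -> : (fun w => `|near0_weight c (Y n w)|) = (fun w => near0_weight c (Y n w)).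
    by apply/funext => w; exact: wE.
  split; last by lra.
  by apply: (@integ_bounded _ _ _ _ _ 1) => // w; exact: near0_weight_norm.
move=> /(_ h) hh; apply: (mostly_imp hh); apply: nearW => n w; rewrite wE => w4.
rewrite leNgt; apply/negP => /(near0_weight_ge c0); lra.
Qed.

End bounded_away.

Section transfer.
Context d (T : measurableType d) (R : realType) (P : probability T R).
Variables (X X' : {RV P >-> R}).
Hypothesis lXX : has_law X (distribution P X').

Lemma same_law_trunc_sqr (q : R -> R) (t : R) : measurable_fun [set: R] q -> 0 <= t ->
  integ P (fun w => q (X w) ^+ 2) ->
  Ex P (trunc_sqr (fun w => q (X w)) t) = Ex P (trunc_sqr (fun w => q (X' w)) t).
Proof.
move=> mq t0 i2.
have mq' : measurable_fun [set: R] (fun e => q e ^+ 2 * Num.min 1 (t * `|q e|)).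
  apply: measurable_funM; first exact: measurable_funX.
  apply: measurable_minr => //; apply: measurable_funM => //; exact: measurableT_comp.
apply: (same_law_Ex lXX mq').
have mqX : measurable_fun setT (fun w => q (X w)).
  by apply: (measurableT_comp mq); exact: measurable_funPT.
exact: (trunc_sqr_integ mqX i2 t0).
Qed.

End transfer.

Section near_explosive_lad.
Context (R : realType) d (T : measurableType d) (P : probability T R).
Notation gamma := (normal_prob (0 : R) 1).
Variables (eps : int -> {RV P >-> R}) (sigma : R) (f : R -> R) (L : R)
  (rho : nat -> R) (kappa : nat -> nat) (y : nat -> nat -> {RV P >-> R})
  (rho_hat : nat -> {RV P >-> R}).
Hypotheses (ind : mutually_independent eps)
  (same : forall i j, has_law (eps i) (distribution P (eps j)))
  (dens : forall i, has_density (eps i) f) (med : forall i, is_median (eps i) 0)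
  (L0 : 0 <= L) (fL : forall x y, `|f x - f y| <= L * `|x - y|)
  (eps2 : forall i, integ P (fun w => eps i w ^+ 2)) (Eeps : forall i, Ex P (eps i) = 0)
  (Eeps2 : forall i, Ex P (fun w => eps i w ^+ 2) = sigma ^+ 2)
  (sigma0 : 0 < sigma) (f0 : 0 < f 0)
  (rho_gt1 : forall n, 1 < rho n)
  (rho_rate : n%:R * (rho n - 1) @[n --> \oo] --> (0 : R))
  (kappa_gt0 : forall n, (0 < kappa n)%N)
  (kappa_rate : ((kappa n)%:R / n%:R : R) @[n --> \oo] --> +oo)
  (kappa_rho_rate : (kappa n)%:R * (rho n - 1) @[n --> \oo] --> (0 : R))
  (y_init : forall n w,
    y n 0%N w = \sum_(0 <= j < (kappa n).+1) rho n ^+ j * eps (- j%:Z) w)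
  (y_rec : forall n i w, (1 <= i <= n)%N -> y n i w = rho n * y n i.-1 w + eps i%:Z w)
  (rho_hat_lad : forall n w, is_lad n (fun i => y n i w) (rho_hat n w)).

Let innov := innov eps.

Let k0 n : 0 < (kappa n)%:R :> R.
Proof. by rewrite ltr0n. Qed.

Let sk0 n : 0 < Num.sqrt (kappa n)%:R :> R.
Proof. by rewrite sqrtr_gt0. Qed.

Let start (j : nat) : T -> R := eps (- j%:Z).

Let mstart j : measurable_fun [set: T] (start j).
Proof. exact: measurable_funPT. Qed.

Let start_ind (c : nat -> R) m :
  independent_pair P (fun w => \sum_(j < m) c j * start j w) (start m).
Proof.
apply: (@indep_partial_sum _ _ _ _ _ _ ind (fun j : nat => - j%:Z) idfun c m).
  by move=> i j /oppr_inj [].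
exact: measurable_id.
Qed.

Let start_trunc i (t : R) : 0 <= t ->
  Ex P (trunc_sqr (start i) t) = Ex P (trunc_sqr (start 0%N) t).
Proof.
move=> t0; exact: (@same_law_trunc_sqr _ _ _ _ (eps (- i%:Z)) (eps (- 0%:Z)) (@same _ _) idfun t
  (@measurable_id _ _ _) t0 (@eps2 _)).
 Qed.

Definition scaled_start n w : R := (Num.sqrt (kappa n)%:R)^-1 * y n 0%N w.

Let scaled_startE n w : scaled_start n w =
  \sum_(j < (kappa n).+1) ((Num.sqrt (kappa n)%:R)^-1 * rho n ^+ j) * start j w.
Proof.
rewrite /scaled_start y_init big_mkord mulr_sumr.
by apply: eq_bigr => j _; rewrite mulrA.
Qed.

Lemma scaled_start_cvg (g : R -> R) (M : R) : continuous g -> (forall x, `|g x| <= M) ->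
  Ex P (fun w => g (scaled_start n w)) @[n --> \oo] --> Ex gamma (fun z => g (sigma * z)).
Proof.
move=> cg gM.
have -> : (fun n => Ex P (fun w => g (scaled_start n w))) = (fun n => Ex P (fun w => g
    (\sum_(j < (kappa n).+1) ((Num.sqrt (kappa n)%:R)^-1 * rho n ^+ j) * start j w))).
  by apply/funext => n; apply: Ex_ext => w; rewrite scaled_startE.
apply: (@lindeberg_clt R d T P start sigma (ltW sigma0) mstart (fun j => @eps2 _)
  (fun j => @Eeps _) (fun j => @Eeps2 _) start_trunc start_ind
  (fun n j => (Num.sqrt (kappa n)%:R)^-1 * rho n ^+ j) (fun n => (kappa n).+1)
  (fun n => (Num.sqrt (kappa n)%:R)^-1 * rho n ^+ kappa n) g M) => //.
- by move=> n; rewrite mulr_ge0 ?invr_ge0 ?sqrtr_ge0// exprn_ge0// (le_trans ler01)// ltW.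
- move=> n j jk; have r0 : 0 <= rho n by rewrite (le_trans ler01)// ltW.
  rewrite ger0_norm ?mulr_ge0 ?invr_ge0 ?sqrtr_ge0 ?exprn_ge0//.
  by rewrite ler_wpM2l ?invr_ge0 ?sqrtr_ge0// ler_weXn2l// ltW.
- exact: initial_weight_max.
- exact: initial_weight_sqr.
Qed.

Lemma scaled_start_sqr : [/\ forall n, integ P (fun w => scaled_start n w ^+ 2) &
  Ex P (fun w => scaled_start n w ^+ 2) @[n --> \oo] --> sigma ^+ 2].
Proof.
have E n : (fun w => scaled_start n w ^+ 2) = (fun w =>
    (\sum_(j < (kappa n).+1) ((Num.sqrt (kappa n)%:R)^-1 * rho n ^+ j) * start j w) ^+ 2).
  by apply/funext => w; rewrite scaled_startE.
have h n := weighted_sum_sqr mstart (fun j => @eps2 _) (fun j => @Eeps _) (fun j => @Eeps2 _)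
  start_ind (fun j => (Num.sqrt (kappa n)%:R)^-1 * rho n ^+ j) (kappa n).+1.
split; first by move=> n; rewrite E; case: (h n).
have -> : (fun n => Ex P (fun w => scaled_start n w ^+ 2)) = (fun n => sigma ^+ 2 *
    \sum_(j < (kappa n).+1) ((Num.sqrt (kappa n)%:R)^-1 * rho n ^+ j) ^+ 2).
  by apply/funext => n; rewrite E; case: (h n).
rewrite -[X in _ --> X]mulr1; apply: cvgMr; exact: initial_weight_sqr.
Qed.

(* y n i is only specified for i <= n; ar_path extends it to all i. *)
Definition ar_path n i w : R :=
  rho n ^+ i * y n 0%N w + \sum_(j < i) rho n ^+ (i.-1 - j) * innov j w.

Lemma ar_pathS n i w : ar_path n i.+1 w = rho n * ar_path n i w + innov i w.
Proof.
rewrite /ar_path big_ord_recr /= subnn expr0 mul1r exprS mulrDr mulrA addrA; congr (_ + _ + _).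
rewrite mulr_sumr; apply: eq_bigr => j _; rewrite mulrA -exprS; congr (_ ^+ _ * _).
by case: i j => [[]//|m] j; rewrite /= subSn// -ltnS.
Qed.

Lemma ar_pathE n i w : (i <= n)%N -> y n i w = ar_path n i w.
Proof.
elim: i => [|i IH] iin; first by rewrite /ar_path expr0 mul1r big_ord0 addr0.
by rewrite y_rec ?iin// IH ?ar_pathS// ltnW.
Qed.

(** The rescaled [y_i], which is the regressor of the observation with index [i + 1] and hence goes
    with [innov i]. *)
Definition regressor n i w : R := (Num.sqrt n%:R)^-1 * ((Num.sqrt (kappa n)%:R)^-1 * ar_path n i w).

Lemma block_fun_start n : block_fun eps (past 0) (y n 0%N : T -> R).
Proof.
have -> : (y n 0%N : T -> R) = fun w => \sum_(0 <= j < (kappa n).+1) rho n ^+ j * start j w.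
  by apply/funext => w; rewrite y_init.
apply: block_fun_sum => j; apply: block_funZ; apply: block_fun_coord.
by rewrite /past /= oppr_le0.
Qed.

Lemma block_fun_regressor n i : block_fun eps (past i) (regressor n i).
Proof.
apply: block_funZ; apply: block_funZ; apply: block_funD.
  by apply: block_funZ; exact: (block_funS (pastS (leq0n i)) (@block_fun_start n)).
apply: (block_fun_psum (V := fun j w => rho n ^+ (i.-1 - j) * innov j w)) => j.
by apply: block_funZ; exact: innov_past.
Qed.

Let sr0 n i : 0 <= rho n ^+ i.
Proof. by rewrite exprn_ge0// (le_trans ler01)// ltW. Qed.

Let sr1 n i : 1 <= rho n ^+ i.
Proof. by rewrite exprn_ege1// ltW. Qed.

Let mi j : measurable_fun [set: T] (innov j).
Proof. exact: measurable_innov. Qed.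

Let innov_ind (q : R -> R) (c : nat -> R) m : measurable_fun [set: R] q ->
  independent_pair P (fun w => \sum_(j < m) c j * q (innov j w)) (fun w => q (innov m w)).
Proof.
move=> mq; apply: (@indep_partial_sum _ _ _ _ _ _ ind (fun j : nat => j.+1%:Z) q c m) => //.
by move=> i j [].
Qed.

(** The contribution of the innovations after time 0. Its mean square is of order [n], against
    [kappa n] for the initial value, which is why the latter dominates. *)
Let shock n i w : R := \sum_(j < i) rho n ^+ (i.-1 - j) * innov j w.

Let shock_sqr n i : integ P (fun w => shock n i w ^+ 2) /\ ((i <= n)%N ->
  Ex P (fun w => shock n i w ^+ 2) <= sigma ^+ 2 * (n%:R * (rho n ^+ n * rho n ^+ n))).
Proof.
have [j e] := weighted_sum_sqr mi (fun j => @eps2 _) (fun j => @Eeps _) (fun j => @Eeps2 _)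
  (fun c m => @innov_ind idfun c m (@measurable_id _ _ _)) (fun j => rho n ^+ (i.-1 - j)) i.
split => [|iin]; first exact: j.
rewrite [leLHS]e ler_wpM2l ?sqr_ge0//.
apply: (@le_trans _ _ (\sum_(j < i) rho n ^+ n * rho n ^+ n)).
  apply: ler_sum => k _; rewrite expr2.
  have h : rho n ^+ (i.-1 - k) <= rho n ^+ n.
    rewrite ler_weXn2l//; first by rewrite ltW.
    by rewrite (leq_trans (leq_subr _ _))// (leq_trans (leq_pred _)).
  by rewrite ler_pM.
by rewrite sumr_const card_ord -[leLHS]mulr_natl ler_wpM2r ?mulr_ge0// ler_nat.
Qed.

Let mshock n i : measurable_fun [set: T] (shock n i).
Proof. by apply: measurable_sum => j; exact: measurable_funM. Qed.

Let mss n : measurable_fun [set: T] (scaled_start n).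
Proof. by apply: measurable_funM => //; exact: measurable_funPT. Qed.

Let regressorE n i w : regressor n i w =
  (Num.sqrt n%:R)^-1 * (rho n ^+ i * scaled_start n w + (Num.sqrt (kappa n)%:R)^-1 * shock n i w).
Proof. by rewrite /regressor /ar_path /scaled_start -/(shock n i w); ring. Qed.

Let regressor0 n w : regressor n 0 w = (Num.sqrt n%:R)^-1 * scaled_start n w.
Proof. by rewrite regressorE /shock big_ord0 expr0; ring. Qed.

Lemma measurable_regressor n i : measurable_fun [set: T] (regressor n i).
Proof. exact: (block_fun_measurable (@block_fun_regressor n i)). Qed.

Lemma regressor_sqr n i : integ P (fun w => regressor n i w ^+ 2).
Proof.
have [iss _] := scaled_start_sqr; have [ish _] := shock_sqr n i.
have i1 : integ P (fun w => (rho n ^+ i * scaled_start n w + (Num.sqrt (kappa n)%:R)^-1 * shock n i w) ^+ 2).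
  apply: integ_sqrD; try exact: measurable_funM.
    by apply: (integ_ext _ (integZ ((rho n ^+ i) ^+ 2) (iss n))) => w; rewrite [RHS]exprMn.
  by apply: (integ_ext _ (integZ ((Num.sqrt (kappa n)%:R)^-1 ^+ 2) ish)) => w; rewrite [RHS]exprMn.
apply: (integ_ext _ (integZ ((Num.sqrt n%:R)^-1 ^+ 2) i1)) => w.
by rewrite regressorE [RHS]exprMn.
Qed.

Let V : R := sigma ^+ 2 + 1.

Let ss_le : \forall n \near \oo, Ex P (fun w => scaled_start n w ^+ 2) <= V.
Proof.
have [_ c] := scaled_start_sqr; move/cvgrPdist_le : c => /(_ 1 ltr01); apply: filterS => n.
by rewrite ler_norml /V => /andP[h _]; lra.
Qed.

(** Up to the factor [1 / sqrt n], the gap is [(rho^i - 1)] times the scaled start plus the shock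
    over [sqrt kappa]. The first part vanishes since [n (rho - 1)] tends to 0, the second since
    [n / kappa] does. *)
Lemma regressor_gap_cvg :
  (\sum_(i < n) Ex P (fun w => (regressor n i w - regressor n 0%N w) ^+ 2)) @[n --> \oo] --> (0 : R).
Proof.
have [iss _] := scaled_start_sqr.
apply: (@squeeze_cvgr _ _ _ _ (fun=> 0) (fun n => 2 * (rho n ^+ n - 1) ^+ 2 * V +
    2 * sigma ^+ 2 * (n%:R / (kappa n)%:R) * (rho n ^+ n * rho n ^+ n))); last first.
- exact: gap_bound_cvg.
- exact: cvg_cst.
near=> n; apply/andP; split.
  by apply: sumr_ge0 => i _; apply: Ex_ge0 => w; exact: sqr_ge0.
have n0 : (0 < n)%N by near: n; exact: nbhs_infty_gt.
have nR : 0 < n%:R :> R by rewrite ltr0n.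
have v : Ex P (fun w => scaled_start n w ^+ 2) <= V by near: n; exact: ss_le.
set b := (X in _ <= X).
(* The bound is divided evenly among the terms, each of which carries a factor [1 / n]. *)
have -> : b = \sum_(i < n) n%:R^-1 * b.
  by rewrite sumr_const card_ord -[RHS]mulr_natl mulrA mulfV ?mul1r// gt_eqF.
apply: ler_sum => i _.
have [ish] := shock_sqr n i; move=> /(_ (ltnW (ltn_ord i))) shl.
have j1 : integ P (fun w => 2 * (rho n ^+ i - 1) ^+ 2 * scaled_start n w ^+ 2) by exact: integZ.
have j2 : integ P (fun w => 2 * (kappa n)%:R^-1 * shock n i w ^+ 2) by exact: integZ.
have j3 := integD j1 j2.
have key w : (regressor n i w - regressor n 0%N w) ^+ 2 <= n%:R^-1 *
    (2 * (rho n ^+ i - 1) ^+ 2 * scaled_start n w ^+ 2 + 2 * (kappa n)%:R^-1 * shock n i w ^+ 2).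
  have -> : regressor n i w - regressor n 0 w = (Num.sqrt n%:R)^-1 *
      ((rho n ^+ i - 1) * scaled_start n w + (Num.sqrt (kappa n)%:R)^-1 * shock n i w).
    by rewrite regressor0 regressorE; ring.
  rewrite exprMn exprVn sqr_sqrtr ?(ltW nR)// ler_wpM2l ?invr_ge0 ?(ltW nR)//.
  have -> : (kappa n)%:R^-1 = (Num.sqrt (kappa n)%:R)^-1 ^+ 2 :> R.
    by rewrite exprVn sqr_sqrtr// ltW.
  set p := (rho n ^+ i - 1); set q := (Num.sqrt _)^-1.
  have := sqr_ge0 (p * scaled_start n w - q * shock n i w); lra.
apply: (@le_trans _ _ (Ex P (fun w => n%:R^-1 *
    (2 * (rho n ^+ i - 1) ^+ 2 * scaled_start n w ^+ 2 + 2 * (kappa n)%:R^-1 * shock n i w ^+ 2)))).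
  apply: Ex_le => //; last exact: integZ.
  apply: (@integ_le _ _ _ _ _ _ _ _ (integZ n%:R^-1 j3)) => [|w]; last by rewrite ger0_norm ?sqr_ge0.
  by apply: measurable_funX; apply: measurable_funB; exact: measurable_regressor.
rewrite ExZ// ler_wpM2l ?invr_ge0 ?(ltW nR)// ExD// ExZ// ExZ// /b; apply: lerD.
  have E0 : 0 <= Ex P (fun w => scaled_start n w ^+ 2) by apply: Ex_ge0 => w; exact: sqr_ge0.
  have h2 : (rho n ^+ i - 1) ^+ 2 <= (rho n ^+ n - 1) ^+ 2.
    rewrite ler_sqr ?nnegrE ?subr_ge0// lerD2r ler_weXn2l//; first by rewrite ltW.
    exact: ltnW.
  by apply: ler_pM => //; [rewrite mulr_ge0// sqr_ge0|rewrite ler_wpM2l].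
have -> : 2 * sigma ^+ 2 * (n%:R / (kappa n)%:R) * (rho n ^+ n * rho n ^+ n) =
    2 * (kappa n)%:R^-1 * (sigma ^+ 2 * (n%:R * (rho n ^+ n * rho n ^+ n))) by ring.
by rewrite ler_wpM2l// mulr_ge0// invr_ge0 ltW.
Unshelve. all: by end_near. Qed.

Local Notation lev := (level regressor).

Lemma level_start n w : (0 < n)%N -> lev n w = scaled_start n w.
Proof. by move=> n0; rewrite /level regressor0 mulVKf// sqrtr_eq0 -ltNge ltr0n. Qed.

Lemma level_cvg (g : R -> R) (M : R) : continuous g -> (forall x, `|g x| <= M) ->
  Ex P (fun w => g (lev n w)) @[n --> \oo] --> Ex gamma (fun z => g (sigma * z)).
Proof.
move=> cg gM; have h := scaled_start_cvg cg gM.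
apply: cvg_trans h; apply: near_eq_cvg; near=> n.
by apply: Ex_ext => w; rewrite level_start//; near: n; exact: nbhs_infty_gt.
Unshelve. all: by end_near. Qed.

Lemma regressor0_sqr : \forall n \near \oo, n%:R * Ex P (fun w => regressor n 0%N w ^+ 2) <= V.
Proof.
have [iss _] := scaled_start_sqr.
near=> n; have n0 : (0 < n)%N by near: n; exact: nbhs_infty_gt.
have nR : 0 < n%:R :> R by rewrite ltr0n.
have -> : (fun w => regressor n 0%N w ^+ 2) = (fun w => n%:R^-1 * scaled_start n w ^+ 2).
  by apply/funext => w; rewrite regressor0 exprMn exprVn sqr_sqrtr// ltW.
rewrite ExZ// mulrA mulfV ?mul1r ?gt_eqF//; near: n; exact: ss_le.
Unshelve. all: by end_near. Qed.

Definition lad_error n w : R := Num.sqrt (n%:R * (kappa n)%:R) * (rho_hat n w - rho n).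

Definition studentised_error n w : R :=
  Num.sqrt (\sum_(1 <= i < n.+1) y n i.-1 w ^+ 2) * (rho_hat n w - rho n).

(** Since [y_{i+1} - r y_i = eps_{i+1} - (r - rho) y_i], the loss is that of a regression of the
    innovations on the rescaled regressors, with local parameter [u = sqrt(n kappa) (r - rho)]. *)
Let residual n w (r : R) : lad_loss n (fun i => y n i w) r =
  n%:R^-1 * \sum_(i < n) `|innov i w - Num.sqrt (n%:R * (kappa n)%:R) * (r - rho n) * regressor n i w|.
Proof.
rewrite /lad_loss big_add1 /= big_mkord; congr (_ * _); apply: eq_bigr => i _.
have n0 : (0 < n)%N by apply: leq_ltn_trans (ltn_ord i).
have sn : Num.sqrt n%:R != 0 :> R by rewrite sqrtr_eq0 -ltNge ltr0n.
have sk : Num.sqrt (kappa n)%:R != 0 :> R by rewrite gt_eqF.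
rewrite !ar_pathE ?ar_pathS//; last by rewrite ltnW.
congr `|_|; rewrite /regressor sqrtrM//.
have -> : Num.sqrt n%:R * Num.sqrt (kappa n)%:R * (r - rho n) *
    ((Num.sqrt n%:R)^-1 * ((Num.sqrt (kappa n)%:R)^-1 * ar_path n i w)) = (r - rho n) * ar_path n i w.
  by field; rewrite sn sk.
by ring.
Qed.

Lemma score_mono n u w : 0 <= (lad_error n w - u) * score eps regressor n u w.
Proof.
apply: (@lad_subgradient R n (fun i => innov i w) (fun i => regressor n i w)) => u'.
have [->|n0] := posnP n; first by rewrite !big_ord0.
have nR : 0 < n%:R :> R by rewrite ltr0n.
have s0 : Num.sqrt (n%:R * (kappa n)%:R) != 0 :> R by rewrite gt_eqF// sqrtr_gt0 mulr_gt0.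
(* The competing slope whose local parameter is [u']. *)
have := rho_hat_lad n w (rho n + u' / Num.sqrt (n%:R * (kappa n)%:R)).
rewrite !residual ler_pM2l ?invr_gt0// -/(lad_error n w).
by rewrite [rho n + _]addrC addrK [_ * (u' / _)]mulrC divfK.
Qed.

Let sgi i := fun w : T => Num.sg (innov i w).

Let msgi i : measurable_fun [set: T] (sgi i).
Proof. exact: (measurableT_comp (@measurable_sgr R) (@mi i)). Qed.

Let sgi2 i : integ P (fun w => sgi i w ^+ 2).
Proof.
apply: (@integ_bounded _ _ _ _ _ 1) => [|w]; first exact: measurable_funX.
by rewrite normrX expr_le1 ?sg_le1.
Qed.

Let Esgi i : Ex P (sgi i) = 0.
Proof. exact: (Ex_sg_median (dens i.+1%:Z) L0 fL (med i.+1%:Z)). Qed.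

Let Esgi2 i : Ex P (fun w => sgi i w ^+ 2) = 1.
Proof. exact: (Ex_sg_sqr (dens i.+1%:Z) L0 fL). Qed.

Let sgi_trunc i (t : R) : 0 <= t -> Ex P (trunc_sqr (sgi i) t) = Ex P (trunc_sqr (sgi 0%N) t).
Proof.
move=> t0; exact: (@same_law_trunc_sqr _ _ _ _ (eps i.+1%:Z) (eps 1%:Z) (@same _ _) (@Num.sg R) t
  (@measurable_sgr R) t0 (@sgi2 i)).
Qed.

Let sgi_ind (c : nat -> R) m : independent_pair P (fun w => \sum_(j < m) c j * sgi j w) (sgi m).
Proof. exact: (@innov_ind (@Num.sg R) c m (@measurable_sgr R)). Qed.

Let mlev n : measurable_fun [set: T] (lev n).
Proof. by apply: measurable_funM => //; exact: measurable_regressor. Qed.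

Let msum n : measurable_fun [set: T] (sign_sum eps n).
Proof. exact: (norm_sum_meas msgi n). Qed.

(** The level involves innovations of index at most 0, the sign sum only positive indices. *)
Lemma level_sign_indep n : independent_pair P (lev n) (sign_sum eps n).
Proof.
apply: (@block_fun_indep _ _ _ _ _ _ ind _ _ _ _ (past 0) [set j | 0 < j]).
- by apply/seteqP; split => // j [/= j0 /lt_geF]; rewrite j0.
- by apply: block_funZ; exact: block_fun_regressor.
- apply: (@block_fun_sum _ _ _ _ _ _ _ 'I_n) => i; apply: block_funZ.
  apply: (block_fun_comp (@measurable_sgr R)).
  by apply: block_fun_coord.
Qed.

Let levU e : 0 < e -> exists2 K : R, 0 < K & mostly P e (fun n w => `|lev n w| <= K).
Proof.
have V0 : 0 <= V by rewrite addr_ge0// sqr_ge0.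
apply: (mostly_bounded V0) => //; move: regressor0_sqr; apply: filterS => n vn.
have E : (fun w => lev n w ^+ 2) = (fun w => n%:R * regressor n 0%N w ^+ 2).
  by apply/funext => w; rewrite exprMn sqr_sqrtr.
have ir := regressor_sqr n 0.
by rewrite E ExZ//; split => //; exact: integZ.
Qed.

Let sumU e : 0 < e -> exists2 K : R, 0 < K & mostly P e (fun n w => `|sign_sum eps n w| <= K).
Proof.
apply: (mostly_bounded (@ler01 R)) => //; near=> n.
have n0 : (0 < n)%N by near: n; exact: nbhs_infty_gt.
have nR : 0 < n%:R :> R by rewrite ltr0n.
have E2 i : Ex P (fun w => sgi i w ^+ 2) = 1 ^+ 2 by rewrite Esgi2 expr1n.
have [i e2] := weighted_sum_sqr msgi sgi2 Esgi E2 sgi_ind (fun=> (Num.sqrt n%:R)^-1) n.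
split; first exact: i.
rewrite [leLHS]e2 expr1n mul1r sumr_const card_ord exprVn sqr_sqrtr ?(ltW nR)//.
by rewrite -[leLHS]mulr_natl mulfV// gt_eqF.
Unshelve. all: by end_near. Qed.

Let a0 : 0 < 2 * f 0.
Proof. by rewrite mulr_gt0. Qed.

Let gram n w : R := Num.sqrt (\sum_(i < n) regressor n i w ^+ 2).

Let gram_ge0 n w : 0 <= gram n w.
Proof. exact: sqrtr_ge0. Qed.

Let gramE n w : studentised_error n w = gram n w * lad_error n w.
Proof.
have [->|n0] := posnP n.
  by rewrite /studentised_error /gram big_geq// big_ord0 sqrtr0 !mul0r.
have nR : 0 < n%:R :> R by rewrite ltr0n.
rewrite /studentised_error /lad_error /gram mulrCA mulrA -sqrtrM ?mulr_ge0//; congr (Num.sqrt _ * _).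
rewrite big_add1 /= big_mkord mulr_sumr; apply: eq_bigr => i _.
rewrite ar_pathE; last by rewrite ltnW.
rewrite /regressor !exprMn !exprVn !sqr_sqrtr//.
by field; rewrite !gt_eqF.
Qed.

Let small_gram : small P (fun n w => gram n w ^+ 2 - lev n w ^+ 2).
Proof.
have h := small_sqr_gap block_fun_regressor regressor_sqr regressor_gap_cvg regressor0_sqr.
apply: (small_eq _ h); apply: nearW => n w.
by rewrite /gram sqr_sqrtr// sumr_ge0// => i _; exact: sqr_ge0.
Qed.

Let Mlin (u : R) : small P (fun n w => score eps regressor n u w -
  (lev n w * sign_sum eps n w - 2 * f 0 * u * lev n w ^+ 2)).
Proof.
have V0 : 0 <= V by rewrite addr_ge0// sqr_ge0.
exact: (small_score ind dens med L0 fL block_fun_regressor regressor_sqr V0 regressor_gap_cvg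
  regressor0_sqr u).
Qed.

Let levL e : 0 < e -> exists2 c : R, 0 < c & mostly P e (fun n w => c <= `|lev n w|).
Proof. by move=> e0; exact: (mostly_away_from0 sigma0 mlev level_cvg e0). Qed.

Lemma measurable_lad_error n : measurable_fun [set: T] (lad_error n).
Proof.
apply: measurable_funM => //; apply: measurable_funB => //; exact: measurable_funPT.
Qed.

Lemma measurable_studentised_error n : measurable_fun [set: T] (studentised_error n).
Proof.
have mg : measurable_fun setT (gram n).
  apply: (measurableT_comp (continuous_measurable_fun (@sqrt_continuous R))).
  by apply: measurable_sum => i; apply: measurable_funX; exact: measurable_regressor.
have -> : studentised_error n = fun w => gram n w * lad_error n w by apply/funext => w; exact: gramE.
by apply: measurable_funM => //; exact: measurable_lad_error.
Qed.

Let small_limit (X X' : nat -> T -> R) (g : R -> R) (l : R) :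
  (forall n, measurable_fun [set: T] (X n)) -> (forall n, measurable_fun [set: T] (X' n)) ->
  small P (fun n w => X n w - X' n w) -> smooth_bounded g ->
  Ex P (g \o X' n) @[n --> \oo] --> l -> Ex P (g \o X n) @[n --> \oo] --> l.
Proof.
move=> mX mX' sXX sg c; have h := small_Ex mX mX' sXX sg.
have E : (fun n => Ex P (g \o X n)) =
    (fun n => Ex P (g \o X n) - Ex P (g \o X' n) + Ex P (g \o X' n)).
  by apply/funext => n; rewrite subrK.
by rewrite E -[l]add0r; exact: (cvgD h c).
Qed.

Lemma lad_error_limit (g : R -> R) : smooth_bounded g ->
  Ex P (g \o lad_error n) @[n --> \oo] -->
  Ex gamma (fun y => Ex gamma (fun z => g ((2 * f 0)^-1 / sigma * z / y))).
Proof.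
move=> sg; have h := lad_linearisation a0 score_mono Mlin levL sumU.
apply: (small_limit measurable_lad_error _ h sg).
  move=> n; apply: measurable_funM => //; apply: measurable_funM => //.
  exact: (measurableT_comp (@measurable_invr R) (@mlev n)).
exact: (ratio_limit msgi sgi2 Esgi Esgi2 sgi_trunc sgi_ind sigma0 mlev level_sign_indep level_cvg sg).
Qed.

Lemma studentised_error_limit (g : R -> R) : smooth_bounded g ->
  Ex P (g \o studentised_error n) @[n --> \oo] --> gauss_avg g (2 * f 0)^-1.
Proof.
move=> sg; have h := studentised_linearisation a0 score_mono Mlin levL levU sumU gram_ge0 small_gram.
have h' : small P (fun n w => studentised_error n w -
    (2 * f 0)^-1 * Num.sg (lev n w) * sign_sum eps n w).
  by apply: (small_eq _ h); apply: nearW => n w; rewrite gramE.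
apply: (small_limit measurable_studentised_error _ h' sg).
  move=> n; apply: measurable_funM => //; apply: measurable_funM => //.
  exact: (measurableT_comp (@measurable_sgr R) (@mlev n)).
exact: (sign_limit msgi sgi2 Esgi Esgi2 sgi_trunc sgi_ind sigma0 mlev level_sign_indep level_cvg sg).
Qed.

End near_explosive_lad.

Lemma smooth_cvg_in_distribution (R : realType) d (T : measurableType d) (P : probability T R)
    (X : nat -> T -> R) d' (T' : measurableType d') (P' : probability T' R) (Z : T' -> R) :
  (forall n, measurable_fun [set: T] (X n)) -> measurable_fun [set: T'] Z ->
  (forall g, smooth_bounded g -> Ex P (g \o X n) @[n --> \oo] --> Ex P' (g \o Z)) ->
  cvg_in_distribution P X P' Z.
Proof.
move=> mX mZ h; split => // g cg [M gM].
have mg : measurable_fun setT g by exact: continuous_measurable_fun.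
have E d0 (T0 : measurableType d0) (P0 : probability T0 R) (X0 : T0 -> R) :
    measurable_fun setT X0 -> ('E_P0[g \o X0])%E = (Ex P0 (g \o X0))%:E.
  move=> mX0; rewrite unlock integ_fin//.
  by apply: (@integ_bounded _ _ _ _ _ M) => [|w]; [exact: measurableT_comp|exact: gM].
rewrite E//; under eq_fun do rewrite E//.
apply/fine_cvgP; split; first exact: nearW.
exact: (smooth_test_functions mX mZ h cg gM).
Qed.

Theorem theorem2p2 (R : realType) (d : measure_display) (T : measurableType d)
    (P : probability T R)
    (eps : int -> {RV P >-> R}) (sigma : R) (f : R -> R)
    (rho : nat -> R) (kappa : nat -> nat)
    (y : nat -> nat -> {RV P >-> R}) (rho_hat : nat -> {RV P >-> R})
    (dC : measure_display) (TC : measurableType dC) (PC : probability TC R)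
    (C : {RV PC >-> R})
    (dN : measure_display) (TN : measurableType dN) (PN : probability TN R)
    (N : {RV PN >-> R})
    (eps_iid : iid eps)
    (eps_L2 : forall i, (eps i : T -> R) \in Lfun P 2%:E)
    (eps_mean : forall i, 'E_P[eps i]%E = 0%E)
    (sigma_ge0 : 0 <= sigma)
    (eps_var : forall i, 'V_P[eps i]%E = (sigma ^+ 2)%:E)
    (eps_median : is_median (eps 1) 0)
    (eps_density : has_density (eps 1) f)
    (f_derivable : forall x, derivable f x 1)
    (f0_gt0 : 0 < f 0)
    (f'_bounded :
      (ereal_sup [set (`|f^`()%classic x|)%:E | x in [set: R]] < +oo)%E)
    (rho_gt1 : forall n, 1 < rho n)
    (rho_rate : n%:R * (rho n - 1) @[n --> \oo] --> (0 : R))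
    (kappa_gt0 : forall n, (0 < kappa n)%N)
    (kappa_rate : ((kappa n)%:R / n%:R : R) @[n --> \oo] --> +oo)
    (kappa_rho_rate : (kappa n)%:R * (rho n - 1) @[n --> \oo] --> (0 : R))
    (y_init : forall n w,
      y n 0%N w = \sum_(0 <= j < (kappa n).+1) rho n ^+ j * eps (- j%:Z) w)
    (y_rec : forall n i w, (1 <= i <= n)%N ->
      y n i w = rho n * y n i.-1 w + eps i%:Z w)
    (rho_hat_lad : forall n w, is_lad n (fun i => y n i w) (rho_hat n w))
    (C_cauchy : has_law C (cauchy_prob R))
    (N_normal : has_law N (normal_prob 0 (Num.sqrt (1 / (4 * f 0 ^+ 2))))) :
  cvg_in_distribution P
    (fun n w => Num.sqrt (n%:R * (kappa n)%:R) * (rho_hat n w - rho n))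
    PC (fun w => C w / (2 * sigma * f 0))
  /\
  cvg_in_distribution P
    (fun n w => Num.sqrt (\sum_(1 <= i < n.+1) y n i.-1 w ^+ 2)
                  * (rho_hat n w - rho n))
    PN N.

Proof.
have [ind same] := eps_iid.
have [L L0 fL] := derivable_lipschitz f_derivable f'_bounded.
have dens i : has_density (eps i) f by exact: (same_law_density (@same i 1) eps_density).
have med i : is_median (eps i) 0 by exact: (same_law_median (@same i 1) eps_median).
have mom i := L2_moments (eps_L2 i) (eps_mean i) (eps_var i).
have s0 : 0 < sigma.
  rewrite lt_def sigma_ge0 andbT.
  exact: (density_sigma_neq0 (eps_L2 1) (eps_mean 1) (eps_var 1) eps_density L0 fL).
have eps2 i : integ P (fun w => eps i w ^+ 2) by case: (mom i).
have Eeps i : Ex P (eps i) = 0 by case: (mom i).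
have Eeps2 i : Ex P (fun w => eps i w ^+ 2) = sigma ^+ 2 by case: (mom i).
have a0 : 0 < 2 * f 0 by rewrite mulr_gt0.
split.
  apply: smooth_cvg_in_distribution.
  - exact: measurable_lad_error.
  - by apply: measurable_funM => //; exact: measurable_funPT.
  move=> g sg; have [cg [M gM] _] := sg.
  have := lad_error_limit ind same dens med L0 fL eps2 Eeps Eeps2 s0 f0_gt0 rho_gt1 rho_rate
    kappa_gt0 kappa_rate kappa_rho_rate y_init y_rec rho_hat_lad sg.
  rewrite (normal_ratio_cauchy C_cauchy ((2 * f 0)^-1 / sigma) cg gM).
  have -> // : Ex PC (fun w => g ((2 * f 0)^-1 / sigma * C w)) =
      Ex PC (g \o (fun w => C w / (2 * sigma * f 0))).
  apply: Ex_ext => w /=; congr g; rewrite mulrC; congr (_ * _).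
  by rewrite -invfM; congr (_^-1); ring.
have sE : Num.sqrt (1 / (4 * f 0 ^+ 2)) = (2 * f 0)^-1.
  have -> : 1 / (4 * f 0 ^+ 2) = ((2 * f 0)^-1) ^+ 2 by field; rewrite gt_eqF.
  by rewrite sqrtr_sqr ger0_norm// invr_ge0 ltW.
rewrite sE in N_normal.
apply: smooth_cvg_in_distribution.
- exact: (measurable_studentised_error rho_hat kappa_gt0 y_init y_rec).
- exact: measurable_funPT.
move=> g sg; have [cg [M gM] _] := sg.
have k0 : 0 < (2 * f 0)^-1 by rewrite invr_gt0.
have -> : Ex PN (g \o N) = gauss_avg g (2 * f 0)^-1.
  exact: (normal_law_scale k0 N_normal cg gM).
exact: (studentised_error_limit ind same dens med L0 fL eps2 Eeps Eeps2 s0 f0_gt0 rho_gt1 rho_rate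
    kappa_gt0 kappa_rate kappa_rho_rate y_init y_rec rho_hat_lad sg).
Qed.
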